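(* Let $\Sigma$ be a complete, connected, oriented, immersed $C^2$ surface with constant mean curvature in $(\mathbb{S}^3,g_h)$. If $\Sigma$ contains an isolated singular point then $\Sigma$ is congruent with a sphere $\mathcal{S}_\lambda$ for some $\lambda\in\mathbb{R}$.
   Context: Identify $(x_1,y_1,x_2,y_2)\in\mathbb{R}^4$ with the quaternion $x_1+iy_1+jx_2+ky_2$; $p\cdot q$ is the quaternion product and $\langle\cdot,\cdot\rangle$ the Euclidean product. $\mathbb{S}^3$ is the unit sphere with the induced Riemannian metric $g$ and Levi-Civita connection $D$. Put $V(p)=i\cdot p$, $E_1(p)=j\cdot p$, $E_2(p)=k\cdot p$. The horizontal distribution $\mathcal{H}$ is spanned by $E_1,E_2$, and $g_h$ is the restriction of $g$ to $\mathcal{H}$. $J(X):=D_XV$; on horizontal vectors $J(X)=i\cdot X$. A geodesic of curvature $\lambda$ in $(\mathbb{S}^3,g_h)$ is a $C^2$ horizontal curve (tangent to $\mathcal{H}$) parameterized by arc-length with $D_{\dot\gamma}\dot\gamma+2\lambda J(\dot\gamma)=0$. For an oriented $C^2$ immersed surface $\Sigma$ with unit normal $N$ in $(\mathbb{S}^3,g)$, $N_h=N-\langle N,V\rangle V$, and the singular set $\Sigma_0$ is the set of points $p$ with $T_p\Sigma=\mathcal{H}_p$ (equivalently $N_h(p)=0$); its points are the singular points. On $\Sigma-\Sigma_0$ put $\nu_h=N_h/|N_h|$; the mean curvature $H$ in $(\mathbb{S}^3,g_h)$ is defined there by $-2H=\mathrm{div}_\Sigma\nu_h$, the divergence relative to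 $\Sigma$. ''Constant mean curvature'' means $H$ is constant on $\Sigma-\Sigma_0$. $\Sigma$ is complete if it is complete in $(\mathbb{S}^3,g)$. Two surfaces are congruent if some isometry of $(\mathbb{S}^3,g)$ preserving $\mathcal{H}$ maps one onto the other. For $\lambda\in\mathbb{R}$, let $p=(1,0,0,0)$ and let $\gamma_\theta$ be the geodesic of curvature $\lambda$ with $\gamma_\theta(0)=p$ and $\dot\gamma_\theta(0)=(\cos\theta)E_1(p)+(\sin\theta)E_2(p)$. Then $\mathcal{S}_\lambda:=\{\gamma_\theta(s):\theta\in[0,2\pi],\ s\in[0,\pi/\sqrt{1+\lambda^2}]\}$. *)

(* Defs.v *)
From HB Require Import structures.
From mathcomp Require Import all_boot all_order all_algebra.
From mathcomp Require Import all_classical all_reals all_analysis.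

Set Implicit Arguments.
Unset Strict Implicit.
Unset Printing Implicit Defensive.

Import Order.TTheory GRing.Theory Num.Theory.
Import numFieldNormedType.Exports.

Local Open Scope classical_set_scope.
Local Open Scope ring_scope.

(* [U] is meant to be open and [V] finite-dimensional, so that a function
   with continuous directional derivatives has a continuous differential. *)
Fixpoint Ck (R : realType) (V W : normedModType R) (k : nat) (U : set V)
    (F : V -> W) : Prop :=
  match k with
  | 0 => forall x, U x -> {for x, continuous F}
  | k'.+1 => (forall x, U x -> differentiable F x) /\
             (forall v, Ck k' U (fun x => 'D_v F x))
  end.

(* The norm of the library on ['rV[R]_n] is the sup norm; it is used for
   topology and differentiability only, and [enorm] for all lengths. *)
Definition dot (R : realType) (n : nat) (u v : 'rV[R]_n) : R :=
  \sum_(i < n) u ord0 i * v ord0 i.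

Definition enorm (R : realType) (n : nat) (u : 'rV[R]_n) : R :=
  Num.sqrt (dot u u).

(* The quaternion a + i b + j c + k d. *)
Definition quat (R : realType) (a b c d : R) : 'rV[R]_4 :=
  \row_(m < 4) nth 0 [:: a; b; c; d] m.

Definition qmul (R : realType) (p q : 'rV[R]_4) : 'rV[R]_4 :=
  let a := p ord0 (inord 0) in let b := p ord0 (inord 1) in
  let c := p ord0 (inord 2) in let d := p ord0 (inord 3) in
  let a' := q ord0 (inord 0) in let b' := q ord0 (inord 1) in
  let c' := q ord0 (inord 2) in let d' := q ord0 (inord 3) in
  quat (a * a' - b * b' - c * c' - d * d')
       (a * b' + b * a' + c * d' - d * c')
       (a * c' - b * d' + c * a' + d * b')
       (a * d' + b * c' - c * b' + d * a').

Definition Vfield (R : realType) (p : 'rV[R]_4) : 'rV[R]_4 :=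
  qmul (quat 0 1 0 0) p.
Definition E1 (R : realType) (p : 'rV[R]_4) : 'rV[R]_4 :=
  qmul (quat 0 0 1 0) p.
Definition E2 (R : realType) (p : 'rV[R]_4) : 'rV[R]_4 :=
  qmul (quat 0 0 0 1) p.

Definition S3 (R : realType) : set 'rV[R]_4 := [set p | dot p p = 1].
Arguments S3 {R}.

Definition tangentS3 (R : realType) (p : 'rV[R]_4) : set 'rV[R]_4 :=
  [set X | dot X p = 0].

Definition horizontal (R : realType) (p : 'rV[R]_4) : set 'rV[R]_4 :=
  [set X | exists a b : R, X = a *: E1 p + b *: E2 p].

(* The Levi-Civita connection of the unit sphere is the Euclidean derivative
   followed by the orthogonal projection onto the tangent space of the sphere. *)
Definition tproj (R : realType) (p w : 'rV[R]_4) : 'rV[R]_4 :=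
  w - dot w p *: p.

Definition covD (R : realType) (W : 'rV[R]_4 -> 'rV[R]_4) (p X : 'rV[R]_4)
  : 'rV[R]_4 := tproj p ('d W p X).

Definition J (R : realType) (p X : 'rV[R]_4) : 'rV[R]_4 :=
  covD (@Vfield R) p X.

(* Arc-length geodesics of curvature [lambda], defined on the whole line. *)
Definition geodesic (R : realType) (lambda : R) (gam : R -> 'rV[R]_4) : Prop :=
  Ck 2 [set: R] gam /\
  forall s : R,
    [/\ S3 (gam s),
        horizontal (gam s) (derive1 gam s),
        enorm (derive1 gam s) = 1 &
        tproj (gam s) (derive1 (derive1 gam) s)
          + (2 * lambda) *: J (gam s) (derive1 gam s) = 0].

Definition Slambda (R : realType) (lambda : R) : set 'rV[R]_4 :=
  [set q | exists (theta s : R) (gam : R -> 'rV[R]_4),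
    let p := quat 1 0 0 0 in
    [/\ 0 <= theta <= 2 * pi,
        0 <= s <= pi / Num.sqrt (1 + lambda ^+ 2),
        geodesic lambda gam,
        gam 0 = p /\
        derive1 gam 0 = cos theta *: E1 p + sin theta *: E2 p &
        q = gam s]].

(* A chart with domain [param @` cdom]; [param] and [coord] are total functions
   that are only meaningful on [cdom] and [param @` cdom] respectively. *)
Record chart (R : realType) (M : topologicalType) := Chart {
  cdom : set 'rV[R]_2;
  param : 'rV[R]_2 -> M;
  coord : M -> 'rV[R]_2 }.

Definition cimage (R : realType) (M : topologicalType) (c : chart R M) : set M :=
  param c @` cdom c.

Definition chart_homeo (R : realType) (M : topologicalType) (c : chart R M)
  : Prop :=
  [/\ open (cdom c), open (cimage c),
      forall u, cdom c u -> coord c (param c u) = u,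
      forall u, cdom c u -> {for u, continuous (param c)} &
      forall x, cimage c x -> {for x, continuous (coord c)}].

Definition C2_atlas (R : realType) (M : topologicalType) (A : set (chart R M))
  : Prop :=
  [/\ forall c, A c -> chart_homeo c,
      forall x : M, exists2 c, A c & cimage c x &
      forall c c', A c -> A c' ->
        Ck 2 (cdom c `&` param c @^-1` cimage c') (coord c' \o param c)].

(* A C^2 surface without boundary. *)
Definition C2_surface (R : realType) (M : topologicalType) (A : set (chart R M))
  : Prop :=
  [/\ hausdorff_space M, second_countable (T := M) & C2_atlas A].

Definition C2_immersion_S3 (R : realType) (M : topologicalType)
    (A : set (chart R M)) (f : M -> 'rV[R]_4) : Prop :=
  (forall x, S3 (f x)) /\
  forall c, A c ->
    Ck 2 (cdom c) (f \o param c) /\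
    forall u, cdom c u -> injective ('d (f \o param c) u).

Definition tangentSpace (R : realType) (M : topologicalType)
    (A : set (chart R M)) (f : M -> 'rV[R]_4) (x : M) : set 'rV[R]_4 :=
  [set w | exists (c : chart R M) (u a : 'rV[R]_2),
    [/\ A c, cdom c u, param c u = x & w = 'd (f \o param c) u a]].

(* An orientation is given by the choice of a continuous unit normal. *)
Definition unit_normal (R : realType) (M : topologicalType)
    (A : set (chart R M)) (f N : M -> 'rV[R]_4) : Prop :=
  continuous N /\
  forall x, [/\ dot (N x) (N x) = 1, tangentS3 (f x) (N x) &
                forall w, tangentSpace A f x w -> dot (N x) w = 0].

Definition singular_set (R : realType) (M : topologicalType)
    (A : set (chart R M)) (f : M -> 'rV[R]_4) : set M :=
  [set x | tangentSpace A f x = horizontal (f x)].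

Definition Nh (R : realType) (M : topologicalType) (f N : M -> 'rV[R]_4) (x : M)
  : 'rV[R]_4 := N x - dot (N x) (Vfield (f x)) *: Vfield (f x).

Definition nuh (R : realType) (M : topologicalType) (f N : M -> 'rV[R]_4) (x : M)
  : 'rV[R]_4 := (enorm (Nh f N x))^-1 *: Nh f N x.

(* The divergence relative to the surface, at [x], of a vector field [W] along
   [f]: the sum of <D_e W, e> over any orthonormal basis of the tangent space,
   with e the image under the differential of a vector in some chart. *)
Definition has_divergence (R : realType) (M : topologicalType)
    (A : set (chart R M)) (f W : M -> 'rV[R]_4) (x : M) (d : R) : Prop :=
  forall (c : chart R M) (u a b : 'rV[R]_2),
    A c -> cdom c u -> param c u = x ->
    let e := 'd (f \o param c) u in
    let DW := fun v => tproj (f x) ('d (W \o param c) u v) in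
    dot (e a) (e a) = 1 -> dot (e b) (e b) = 1 -> dot (e a) (e b) = 0 ->
    d = dot (DW a) (e a) + dot (DW b) (e b).

Definition has_mean_curvature (R : realType) (M : topologicalType)
    (A : set (chart R M)) (f N : M -> 'rV[R]_4) (x : M) (H : R) : Prop :=
  has_divergence A f (nuh f N) x (- 2 * H).

Definition constant_mean_curvature (R : realType) (M : topologicalType)
    (A : set (chart R M)) (f N : M -> 'rV[R]_4) : Prop :=
  exists H : R, forall x, ~ singular_set A f x -> has_mean_curvature A f N x H.

Definition C1_curve (R : realType) (M : topologicalType) (A : set (chart R M))
    (gam : R -> M) : Prop :=
  continuous gam /\
  forall c, A c -> Ck 1 (gam @^-1` cimage c) (coord c \o gam).

Definition curve_length (R : realType) (M : topologicalType)
    (f : M -> 'rV[R]_4) (gam : R -> M) : \bar R :=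
  (\int[lebesgue_measure]_(t in `[0%R, 1%R]) (enorm (derive1 (f \o gam) t))%:E)%E.

(* The distance of the Riemannian metric induced by [f]. The velocity of a
   curve may vanish, so the corners of a piecewise C^1 curve can be removed by
   a reparametrization and C^1 curves give the same infimum. *)
Definition surface_dist (R : realType) (M : topologicalType)
    (A : set (chart R M)) (f : M -> 'rV[R]_4) (x y : M) : \bar R :=
  ereal_inf [set l | exists gam : R -> M,
    [/\ C1_curve A gam, gam 0 = x, gam 1 = y & l = curve_length f gam]].

Definition complete_surface (R : realType) (M : topologicalType)
    (A : set (chart R M)) (f : M -> 'rV[R]_4) : Prop :=
  forall x_ : nat -> M,
    (forall eps : R, 0 < eps -> exists n0 : nat, forall m n : nat,
      (n0 <= m)%N -> (n0 <= n)%N ->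
      (surface_dist A f (x_ m) (x_ n) < eps%:E)%E) ->
    exists x : M, forall eps : R, 0 < eps -> exists n0 : nat, forall n : nat,
      (n0 <= n)%N -> (surface_dist A f (x_ n) x < eps%:E)%E.

Definition isolated_singular_point (R : realType) (M : topologicalType)
    (A : set (chart R M)) (f : M -> 'rV[R]_4) (x : M) : Prop :=
  singular_set A f x /\
  exists U : set M, [/\ open U, U x & U `&` singular_set A f = [set x]].

(* [phi] is a smooth extension, to a neighborhood of the sphere, of a
   Riemannian isometry of the sphere. *)
Definition S3_isometry (R : realType) (phi : 'rV[R]_4 -> 'rV[R]_4) : Prop :=
  [/\ exists O : set 'rV[R]_4, [/\ open O, S3 `<=` O & forall k, Ck k O phi],
      set_bij S3 S3 phi &
      forall p X Y, S3 p -> tangentS3 p X -> tangentS3 p Y ->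
        dot ('d phi p X) ('d phi p Y) = dot X Y].

Definition preserves_horizontal (R : realType) (phi : 'rV[R]_4 -> 'rV[R]_4)
  : Prop :=
  forall p, S3 p -> 'd phi p @` horizontal p = horizontal (phi p).

(* The immersed surface, and not only its image, is mapped onto [S]: every
   point of [S] corresponds to exactly one point of [M]. *)
Definition congruent (R : realType) (M : topologicalType) (f : M -> 'rV[R]_4)
    (S : set 'rV[R]_4) : Prop :=
  exists phi : 'rV[R]_4 -> 'rV[R]_4,
    [/\ S3_isometry phi, preserves_horizontal phi &
        set_bij [set: M] S (phi \o f)].

(* Main.v *)
Require Import Defs.
From HB Require Import structures.
From mathcomp Require Import all_boot all_order all_algebra.
From mathcomp Require Import all_classical all_reals all_analysis.
From mathcomp Require Import ring lra.
Import Order.TTheory GRing.Theory Num.Theory.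
Import numFieldNormedType.Exports.
Local Open Scope classical_set_scope.
Local Open Scope ring_scope.
Set Implicit Arguments.
Unset Strict Implicit.
Unset Printing Implicit Defensive.

(** Write i for the vertical field V. Away from the singular points, the characteristic
    field Z = i nu_h is tangent to the surface and horizontal, and the mean curvature
    equation says that its integral curves are geodesics of curvature H
    (char_field_derivative): the vector of the tangent plane orthogonal to Z does not
    contribute to the divergence of nu_h, because nu_h is a horizontal unit field and V
    is a Killing field. A geodesic of curvature lam solves the linear equation x'' = - x
    - 2 lam i x', so the geodesic flow Phi on the pairs (point, velocity) is explicit,
    and the surface lifted by x |-> (f x, Z x) is locally invariant under it (nagumo,
    flow_box).

    Let x0 be an isolated singular point, p = f x0. The normal at x0 is plus or minus i
    p; reversing the orientation, it is i p. The derivative of i N_h at x0 is then an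
    operator B of the horizontal plane with trace 2 (singular_expansion): the identity
    comes from the rotation of the horizontal planes, and the shape operator, being
    symmetric, contributes no trace. Suppose that a horizontal vector w is not an
    eigenvector of B. The flow lines through points which approach x0 in the direction w
    miss x0, but converge to a flow line through x0 with velocity e = B w / |B w|. Along
    this line Z is continuous, whereas the derivative of i N_h along it is B e, which
    should point in the direction of e before and after x0, hence is e times a number
    both nonnegative and nonpositive. So B e = 0, and an operator with B B w = 0 and
    trace 2 has w as an eigenvector after all (operator_eigen). Therefore B is the
    identity (operator_id), Z is almost radial near x0, the distance to p decreases
    along the backward flow lines, and these reach x0. A neighborhood of x0 is a disc,
    the union of the geodesics leaving p in all the horizontal directions
    (isolated_structure).

    These geodesics can be continued in the surface. Completeness gives them a limit in
    finite time (ray_limit), and they go on as long as the limit is not singular. The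
    geodesics leaving p at the time s sweep a surface with an explicit normal direction:
    a certain vector of the complex line of p, depending on s only, is in the span of f
    and N (normal_condition). At a singular point it would be a complex multiple of f,
    which is not the case before the time l = pi / sqrt (1 + lam^2) at which all the
    geodesics meet again, at a point of the complex line of p called the pole
    (ends_regular, out_total). The flow lines from x0 up to the time l form an open set;
    its closure adds only x0 and points over the pole (closure_swept). A punctured
    neighborhood of such a point is connected, hence contained in the swept set, so that
    the closure is open, and it is the whole connected surface. The point over the pole
    where a flow line ends depends continuously on the direction, so there is only one
    (common_end). Moreover the height is injective along the geodesics, so f is a
    bijection onto the union of the geodesics of length l leaving p (sweep_bijective).
    The right translation by the conjugate of p is an isometry which commutes with the
    left multiplications, and carries this union to the sphere (Slambda_geo). *)

(** * Quaternions in coordinates *)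

Section Quaternions.
Variable R : realType.
Implicit Types u v w p q e : 'rV[R]_4.

Definition crd u (k : nat) : R := u ord0 (inord k).

(** Identities between vectors are checked on the four coordinates, by [ring]. *)
Lemma rv4P u v : crd u 0 = crd v 0 -> crd u 1 = crd v 1 -> crd u 2 = crd v 2 ->
  crd u 3 = crd v 3 -> u = v.
Proof.
move=> h0 h1 h2 h3; apply/rowP => -[[|[|[|[|//]]]] hi];
 [move: h0|move: h1|move: h2|move: h3]; rewrite /crd; congr (u _ _ = v _ _);
 by apply/val_inj; rewrite /= inordK.
Qed.

Lemma dotE u v : dot u v = crd u 0 * crd v 0 + crd u 1 * crd v 1
   + crd u 2 * crd v 2 + crd u 3 * crd v 3.
Proof.
rewrite /dot /crd !big_ord_recl big_ord0 addr0 !addrA.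
by congr (_ + _ + _ + _); congr (u _ _ * v _ _); apply/val_inj; rewrite /= inordK.
Qed.

Lemma crd_quat (a b c d : R) : [/\ crd (quat a b c d) 0 = a,
  crd (quat a b c d) 1 = b, crd (quat a b c d) 2 = c & crd (quat a b c d) 3 = d].
Proof. by split; rewrite /crd /quat mxE inordK. Qed.

Lemma crd_quat0 (a b c d : R) : crd (quat a b c d) 0 = a. Proof. by case: (crd_quat a b c d). Qed.
Lemma crd_quat1 (a b c d : R) : crd (quat a b c d) 1 = b. Proof. by case: (crd_quat a b c d). Qed.
Lemma crd_quat2 (a b c d : R) : crd (quat a b c d) 2 = c. Proof. by case: (crd_quat a b c d). Qed.
Lemma crd_quat3 (a b c d : R) : crd (quat a b c d) 3 = d. Proof. by case: (crd_quat a b c d). Qed.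
Definition crdq := (crd_quat0, crd_quat1, crd_quat2, crd_quat3).

Lemma crdD u v k : crd (u + v) k = crd u k + crd v k. Proof. by rewrite /crd mxE. Qed.
Lemma crdN u k : crd (- u) k = - crd u k. Proof. by rewrite /crd mxE. Qed.
Lemma crdZ a u k : crd (a *: u) k = a * crd u k. Proof. by rewrite /crd mxE. Qed.
Lemma crd0 k : crd 0 k = 0. Proof. by rewrite /crd mxE. Qed.
Definition crdE := (crdD, crdN, crdZ, crd0, crdq).

Lemma qmulE p q : qmul p q =
  quat (crd p 0 * crd q 0 - crd p 1 * crd q 1 - crd p 2 * crd q 2 - crd p 3 * crd q 3)
       (crd p 0 * crd q 1 + crd p 1 * crd q 0 + crd p 2 * crd q 3 - crd p 3 * crd q 2)
       (crd p 0 * crd q 2 - crd p 1 * crd q 3 + crd p 2 * crd q 0 + crd p 3 * crd q 1)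
       (crd p 0 * crd q 3 + crd p 1 * crd q 2 - crd p 2 * crd q 1 + crd p 3 * crd q 0).
Proof. by []. Qed.

Lemma VfieldE p : Vfield p = quat (- crd p 1) (crd p 0) (- crd p 3) (crd p 2).
Proof. by rewrite /Vfield qmulE !crdq; apply: rv4P; rewrite !crdq; ring. Qed.
Lemma E1E p : E1 p = quat (- crd p 2) (crd p 3) (crd p 0) (- crd p 1).
Proof. by rewrite /E1 qmulE !crdq; apply: rv4P; rewrite !crdq; ring. Qed.
Lemma E2E p : E2 p = quat (- crd p 3) (- crd p 2) (crd p 1) (crd p 0).
Proof. by rewrite /E2 qmulE !crdq; apply: rv4P; rewrite !crdq; ring. Qed.

Lemma dotC u v : dot u v = dot v u. Proof. by rewrite !dotE; ring. Qed.
Lemma dotDl u v w : dot (u + v) w = dot u w + dot v w.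
Proof. by rewrite !dotE !crdE; ring. Qed.
Lemma dotDr u v w : dot w (u + v) = dot w u + dot w v.
Proof. by rewrite !dotE !crdE; ring. Qed.
Lemma dotZl a u w : dot (a *: u) w = a * dot u w.
Proof. by rewrite !dotE !crdE; ring. Qed.
Lemma dotZr a u w : dot w (a *: u) = a * dot w u.
Proof. by rewrite !dotE !crdE; ring. Qed.
Lemma dotNl u w : dot (- u) w = - dot u w.
Proof. by rewrite !dotE !crdE; ring. Qed.
Lemma dotNr u w : dot w (- u) = - dot w u.
Proof. by rewrite !dotE !crdE; ring. Qed.
Lemma dot0l u : dot 0 u = 0. Proof. by rewrite !dotE !crdE; ring. Qed.
Lemma dot0r u : dot u 0 = 0. Proof. by rewrite !dotE !crdE; ring. Qed.
Definition dotl := (dotDl, dotDr, dotZl, dotZr, dotNl, dotNr, dot0l, dot0r).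

Lemma dot_ge0 u : 0 <= dot u u.
Proof. by rewrite dotE !addr_ge0// -expr2 sqr_ge0. Qed.
Lemma dot_eq0 u : dot u u = 0 -> u = 0.
Proof.
rewrite dotE => h; apply: rv4P; rewrite crd0; apply/eqP; rewrite -sqrf_eq0; apply/eqP; nra.
Qed.
Lemma enorm_ge0 u : 0 <= enorm u. Proof. exact: sqrtr_ge0. Qed.
Lemma enorm_sqr u : enorm u ^+ 2 = dot u u. Proof. by rewrite sqr_sqrtr// dot_ge0. Qed.
Lemma enorm_eq0 u : enorm u = 0 -> u = 0.
Proof. by move=> h; apply: dot_eq0; rewrite -enorm_sqr h expr0n. Qed.
Lemma enorm_gt0 u : u != 0 -> 0 < enorm u.
Proof. by move=> h; rewrite lt_neqAle enorm_ge0 andbT eq_sym; apply: contra h => /eqP/enorm_eq0->. Qed.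
Lemma dot_gt0 u : u != 0 -> 0 < dot u u.
Proof. by move=> h; rewrite -enorm_sqr exprn_gt0// enorm_gt0. Qed.
Lemma enormZ a u : enorm (a *: u) = `|a| * enorm u.
Proof. by rewrite /enorm !dotl mulrA -expr2 sqrtrM ?sqr_ge0// sqrtr_sqr. Qed.
Lemma enorm1 u : dot u u = 1 -> enorm u = 1.
Proof. by rewrite /enorm => ->; rewrite sqrtr1. Qed.
Lemma dot_CS u v : dot u v ^+ 2 <= dot u u * dot v v.
Proof.
have [->|v0] := eqVneq v 0; first by rewrite !dotl expr0n mulr0.
have := dot_ge0 (dot v v *: u - dot u v *: v); rewrite !dotl (dotC v u).
set a := dot u u; set b := dot u v; set c := dot v v.
have c0 : 0 < c by exact: dot_gt0.
move=> h; have : 0 <= c * (a * c - b ^+ 2) by move: h; nra.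
by rewrite pmulr_rge0// subr_ge0.
Qed.
Lemma dot_le_enorm u v : `|dot u v| <= enorm u * enorm v.
Proof.
rewrite -(@ler_pXn2r _ 2)// ?nnegrE ?mulr_ge0 ?enorm_ge0//.
by rewrite real_normK ?num_real// exprMn !enorm_sqr dot_CS.
Qed.
Lemma enormD u v : enorm (u + v) <= enorm u + enorm v.
Proof.
rewrite -(@ler_pXn2r _ 2)// ?nnegrE ?addr_ge0 ?enorm_ge0//.
rewrite enorm_sqr !dotl (dotC v u) sqrrD !enorm_sqr.
have := dot_le_enorm u v; have := ler_norm (dot u v); lra.
Qed.
Lemma enormN u : enorm (- u) = enorm u.
Proof. by rewrite /enorm !dotl opprK. Qed.

Lemma crd_le_norm u k : `|crd u k| <= `|u|.
Proof.
rewrite [in leRHS]/Num.Def.normr/= mx_normrE.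
by apply: le_trans; last exact: (le_bigmax _ (fun i => `|u i.1 i.2|) (ord0, inord k)).
Qed.
Lemma norm_le_crd u a : 0 <= a -> `|crd u 0| <= a -> `|crd u 1| <= a ->
  `|crd u 2| <= a -> `|crd u 3| <= a -> `|u| <= a.
Proof.
move=> a0 h0 h1 h2 h3; rewrite [in leLHS]/Num.Def.normr/= mx_normrE.
apply: bigmax_le => // -[i j] _ /=; rewrite ord1.
case: j => -[|[|[|[|//]]]] hi;
 [move: h0|move: h1|move: h2|move: h3]; rewrite /crd; congr (`|u _ _| <= _);
 by apply/val_inj; rewrite /= inordK.
Qed.
Lemma norm_le_enorm u : `|u| <= enorm u.
Proof.
have H k : `|crd u k| <= enorm u -> `|crd u k| <= enorm u by [].
by apply: norm_le_crd; rewrite ?enorm_ge0// -sqrtr_sqr ler_wsqrtr// dotE; nra.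
Qed.
Lemma enorm_le_norm u : enorm u <= 2 * `|u|.
Proof.
rewrite -(@ler_pXn2r _ 2)// ?nnegrE ?mulr_ge0 ?enorm_ge0// enorm_sqr dotE.
have sq k : crd u k * crd u k <= `|u| ^+ 2.
  rewrite -expr2 -real_normK ?num_real//.
  by rewrite ler_pXn2r// ?nnegrE ?normr_ge0 ?crd_le_norm.
have := sq 0; have := sq 1; have := sq 2; have := sq 3; lra.
Qed.
Lemma dot_le_norm u v : `|dot u v| <= 4 * `|u| * `|v|.
Proof.
apply: (le_trans (dot_le_enorm _ _)).
rewrite (_ : 4 * _ * _ = (2 * `|u|) * (2 * `|v|)); last by ring.
by apply: ler_pM; rewrite ?enorm_ge0 ?enorm_le_norm.
Qed.

Lemma VfieldD u v : Vfield (u + v) = Vfield u + Vfield v.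
Proof. by rewrite !VfieldE; apply: rv4P; rewrite !crdE; ring. Qed.
Lemma VfieldZ a u : Vfield (a *: u) = a *: Vfield u.
Proof. by rewrite !VfieldE; apply: rv4P; rewrite !crdE; ring. Qed.
Lemma VfieldN u : Vfield (- u) = - Vfield u.
Proof. by rewrite !VfieldE; apply: rv4P; rewrite !crdE; ring. Qed.
Lemma Vfield0 : Vfield 0 = 0 :> 'rV[R]_4.
Proof. by rewrite !VfieldE; apply: rv4P; rewrite !crdE; ring. Qed.
Lemma VfieldK u : Vfield (Vfield u) = - u.
Proof. by rewrite !VfieldE; apply: rv4P; rewrite !crdE; ring. Qed.
Lemma dotVV u v : dot (Vfield u) (Vfield v) = dot u v.
Proof. by rewrite !dotE !VfieldE !crdE; ring. Qed.
Lemma dotVl u v : dot (Vfield u) v = - dot u (Vfield v).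
Proof. by rewrite !dotE !VfieldE !crdE; ring. Qed.
Lemma dotV0 u : dot u (Vfield u) = 0.
Proof. by rewrite !dotE !VfieldE !crdE; ring. Qed.
Lemma dotV0' u : dot (Vfield u) u = 0.
Proof. by rewrite dotC dotV0. Qed.
Definition Vl := (VfieldD, VfieldZ, VfieldN, VfieldK, Vfield0).
Lemma enormV u : enorm (Vfield u) = enorm u. Proof. by rewrite /enorm dotVV. Qed.
Lemma E2V p : E2 p = Vfield (E1 p).
Proof. by rewrite VfieldE E1E E2E !crdE; apply: rv4P; rewrite !crdE; ring. Qed.
Lemma dotE1p p : dot (E1 p) p = 0.
Proof. by rewrite E1E dotE !crdE; ring. Qed.
Lemma dotE1V p : dot (E1 p) (Vfield p) = 0.
Proof. by rewrite E1E VfieldE dotE !crdE; ring. Qed.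
Lemma dotE1E1 p : dot (E1 p) (E1 p) = dot p p.
Proof. by rewrite E1E !dotE !crdE; ring. Qed.
Lemma dotE2p p : dot (E2 p) p = 0.
Proof. by rewrite E2E dotE !crdE; ring. Qed.
Lemma dotE2V p : dot (E2 p) (Vfield p) = 0.
Proof. by rewrite E2V dotVV dotE1p. Qed.

(** Holds for any p, without square roots, since the frame p, i p, j p, k p is orthogonal
    and all its vectors have the norm of p. *)
Lemma frame_expand p v : dot p p *: v = dot v p *: p + dot v (Vfield p) *: Vfield p
   + dot v (E1 p) *: E1 p + dot v (E2 p) *: E2 p.
Proof. by rewrite E1E E2E VfieldE !dotE; apply: rv4P; rewrite !crdE; ring. Qed.

Lemma horizontalP p e : dot p p = 1 ->
  horizontal p e <-> dot e p = 0 /\ dot e (Vfield p) = 0.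
Proof.
move=> pp; split=> [[a [b ->]]|[h1 h2]].
  by rewrite !dotl dotE1p dotE2p dotE1V dotE2V; split; ring.
have := frame_expand p e; rewrite pp scale1r h1 h2 !scale0r !add0r => ->.
by eexists; eexists; reflexivity.
Qed.

Lemma unitary_expand p e v : dot p p = 1 -> dot e e = 1 -> dot e p = 0 ->
  dot e (Vfield p) = 0 ->
  v = dot v p *: p + dot v (Vfield p) *: Vfield p + dot v e *: e + dot v (Vfield e) *: Vfield e.
Proof.
move=> pp ee ep eVp; have /horizontalP : dot e p = 0 /\ dot e (Vfield p) = 0 by [].
move=> /(_ pp) [a [b eE]].
have ab : a ^+ 2 + b ^+ 2 = 1.
  move: ee; rewrite eE E2V !dotl dotVV dotVl dotV0 dotE1E1 pp.
  by rewrite !(mulr0,oppr0,addr0,add0r,mulr1) => <-; ring.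
have := frame_expand p v; rewrite pp scale1r E2V => vE.
rewrite {1}vE -!addrA; congr (_ + (_ + _)).
rewrite eE E2V !Vl !dotl.
by apply: rv4P; rewrite !crdE -[LHS]mul1r -ab; ring.
Qed.
End Quaternions.

(** * Calculus of maps to the four-dimensional space *)

Section Calculus.
Variables (R : realType) (V : normedModType R).
Implicit Types (F G : V -> 'rV[R]_4) (x v : V).

Lemma is_derive_crd F x v d k : is_derive x v F d ->
  is_derive x v (fun y => crd (F y) k) (crd d k).
Proof.
case=> h <-; split; first by move/derivable_mxP : h; apply.
by rewrite derive_mx// /crd mxE.
Qed.

Lemma is_derive_rv4 F x v d :
  (forall k, (k < 4)%N -> is_derive x v (fun y => crd (F y) k) (crd d k)) ->
  is_derive x v F d.
Proof.
move=> h; have dF : derivable F x v.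
  apply/derivable_mxP => i j; rewrite ord1.
  have := h j (ltn_ord j); rewrite /crd.
  by under eq_fun do rewrite inord_val; case.
split=> //; rewrite derive_mx//; apply: rv4P;
 by rewrite {1}/crd mxE; apply: (@derive_val _ _ _ x v _ _ (h _ _)).
Qed.

Lemma is_derive_dot F G x v dF dG : is_derive x v F dF -> is_derive x v G dG ->
  is_derive x v (fun y => dot (F y) (G y)) (dot dF (G x) + dot (F x) dG).
Proof.
move=> hF hG.
pose f k := fun y => crd (F y) k; pose g k := fun y => crd (G y) k.
have hf k : is_derive x v (f k) (crd dF k) by exact: is_derive_crd.
have hg k : is_derive x v (g k) (crd dG k) by exact: is_derive_crd.
have -> : (fun y => dot (F y) (G y)) = f 0 * g 0 + f 1 * g 1 + f 2 * g 2 + f 3 * g 3.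
  by apply/funext => y; rewrite dotE.
have hfg k := is_deriveM (hf k) (hg k).
apply: (is_derive_eq (is_deriveD (is_deriveD (is_deriveD (hfg 0) (hfg 1)) (hfg 2)) (hfg 3))).
by rewrite !dotE /f /g /GRing.scale/=; ring.
Qed.

Lemma is_derive_V F x v dF : is_derive x v F dF ->
  is_derive x v (fun y => Vfield (F y)) (Vfield dF).
Proof.
move=> h; have hf k := is_derive_crd k h.
apply: is_derive_rv4.
move => [|[|[|[|//]]]] _; under eq_fun do rewrite VfieldE crdq; rewrite VfieldE crdq.
- exact: (is_deriveN (hf 1)).
- exact: hf.
- exact: (is_deriveN (hf 3)).
- exact: hf.
Qed.

Lemma is_derive_scale (a : V -> R) F x v da dF : is_derive x v a da -> is_derive x v F dF ->
  is_derive x v (fun y => a y *: F y) (da *: F x + a x *: dF).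
Proof.
move=> ha hF; apply: is_derive_rv4 => k _.
have hf := is_derive_crd k hF.
under eq_fun do rewrite crdZ.
apply: (is_derive_eq (@is_deriveM _ _ a _ x v _ _ ha hf)).
by rewrite !crdE /GRing.scale/=; ring.
Qed.

Lemma is_derive_scalel (a : V -> R) (w : 'rV[R]_4) x v da : is_derive x v a da ->
  is_derive x v (fun y => a y *: w) (da *: w).
Proof.
move=> ha; apply: (is_derive_eq (is_derive_scale ha (is_derive_cst w x v))).
by rewrite scaler0 addr0.
Qed.

Lemma differentiable_crd F x k : differentiable F x ->
  differentiable (fun y => crd (F y) k) x.
Proof.
move=> h; apply: (@differentiable_comp _ _ _ _ F (fun w => w ord0 (inord k)) x h).
exact: differentiable_coord.
Qed.

Lemma quat_delta (u : 'rV[R]_4) : u = crd u 0 *: quat 1 0 0 0 + crd u 1 *: quat 0 1 0 0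
  + crd u 2 *: quat 0 0 1 0 + crd u 3 *: quat 0 0 0 1.
Proof. by apply: rv4P; rewrite !crdE; ring. Qed.

Lemma differentiable_rv4 F x :
  (forall k, (k < 4)%N -> differentiable (fun y => crd (F y) k) x) ->
  differentiable F x.
Proof.
move=> h; have -> : F = (fun y => crd (F y) 0 *: quat 1 0 0 0) +
   (fun y => crd (F y) 1 *: quat 0 1 0 0) + (fun y => crd (F y) 2 *: quat 0 0 1 0)
   + (fun y => crd (F y) 3 *: quat 0 0 0 1).
  by apply/funext => y; rewrite {1}(quat_delta (F y)).
have Z k (w : 'rV[R]_4) : (k < 4)%N -> differentiable (fun y => crd (F y) k *: w) x.
  by move=> k4; apply: differentiableZl; exact: h.
exact: (differentiableD (differentiableD (differentiableD
  (Z 0 _ isT) (Z 1 _ isT)) (Z 2 _ isT)) (Z 3 _ isT)).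
Qed.

Lemma differentiable_dot F G x : differentiable F x -> differentiable G x ->
  differentiable (fun y => dot (F y) (G y)) x.
Proof.
move=> hF hG.
pose f k := fun y => crd (F y) k; pose g k := fun y => crd (G y) k.
have -> : (fun y => dot (F y) (G y)) = f 0 * g 0 + f 1 * g 1 + f 2 * g 2 + f 3 * g 3.
  by apply/funext => y; rewrite dotE.
have M k : differentiable (f k * g k) x.
  by apply: differentiableM; exact: differentiable_crd.
exact: (differentiableD (differentiableD (differentiableD (M _) (M _)) (M _)) (M _)).
Qed.

Lemma differentiable_scale (a : V -> R) F x : differentiable a x -> differentiable F x ->
  differentiable (fun y => a y *: F y) x.
Proof.
move=> ha hF; apply: differentiable_rv4 => k _; under eq_fun do rewrite crdZ.
by apply: (@differentiableM _ _ a (fun y => crd (F y) k)) => //; exact: differentiable_crd.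
Qed.

End Calculus.

Section Limits.
Variables (R : realType) (T : Type).
Implicit Types (F G : T -> 'rV[R]_4).

Lemma cvg_crd (Fl : set_system T) {FF : Filter Fl} F (l : 'rV[R]_4) k : F @ Fl --> l ->
  (fun y => crd (F y) k) @ Fl --> crd l k.
Proof. by move=> h; exact: (cvg_comp _ _ h (@coord_continuous _ _ _ _ _ l)). Qed.

Lemma cvg_rv4 (Fl : set_system T) {FF : Filter Fl} F (l : 'rV[R]_4) :
  (forall k, (k < 4)%N -> (fun y => crd (F y) k) @ Fl --> crd l k) -> F @ Fl --> l.
Proof.
move=> h; rewrite (quat_delta l).
have -> : F = fun y => crd (F y) 0 *: quat 1 0 0 0 + crd (F y) 1 *: quat 0 1 0 0
  + crd (F y) 2 *: quat 0 0 1 0 + crd (F y) 3 *: quat 0 0 0 1.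
  by apply/funext => y; rewrite {1}(quat_delta (F y)).
have Z k (w : 'rV[R]_4) : (k < 4)%N -> (fun y => crd (F y) k *: w) @ Fl --> crd l k *: w.
  by move=> k4; apply: cvgZr_tmp; exact: h.
exact: (cvgD (cvgD (cvgD (Z 0 _ isT) (Z 1 _ isT)) (Z 2 _ isT)) (Z 3 _ isT)).
Qed.

Lemma cvg_dot (Fl : set_system T) {FF : Filter Fl} F G (l m : 'rV[R]_4) :
  F @ Fl --> l -> G @ Fl --> m -> (fun y => dot (F y) (G y)) @ Fl --> dot l m.
Proof.
move=> hF hG; rewrite dotE; under eq_fun do rewrite dotE.
have M k : (fun y => crd (F y) k * crd (G y) k) @ Fl --> crd l k * crd m k.
  by apply: cvgM; exact: cvg_crd.
exact: (cvgD (cvgD (cvgD (M 0) (M 1)) (M 2)) (M 3)).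
Qed.

Lemma cvg_V (Fl : set_system T) {FF : Filter Fl} F (l : 'rV[R]_4) : F @ Fl --> l ->
  (fun y => Vfield (F y)) @ Fl --> Vfield l.
Proof.
move=> h; have c k : (fun y => crd (F y) k) @ Fl --> crd l k by exact: cvg_crd.
have cN k : (fun y => - crd (F y) k) @ Fl --> - crd l k by exact: cvgN.
apply: cvg_rv4 => -[|[|[|[|//]]]] _; under eq_fun do rewrite VfieldE crdq;
  rewrite VfieldE crdq.
- exact: cN.
- exact: c.
- exact: cN.
- exact: c.
Qed.
End Limits.

Section Continuity.
Variables (R : realType) (T : topologicalType).
Implicit Types (F G : T -> 'rV[R]_4).

Lemma continuous_dot F G (x : T) : {for x, continuous F} -> {for x, continuous G} ->
  {for x, continuous (fun y => dot (F y) (G y))}.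
Proof. by move=> hF hG; exact: (@cvg_dot _ _ (nbhs x) _ F G (F x) (G x)). Qed.

Lemma continuous_V F (x : T) : {for x, continuous F} ->
  {for x, continuous (fun y => Vfield (F y))}.
Proof. by move=> hF; exact: (@cvg_V _ _ (nbhs x) _ F (F x)). Qed.
End Continuity.

Lemma differentiable_V (R : realType) (V : normedModType R) (F : V -> 'rV[R]_4) x :
  differentiable F x -> differentiable (fun y => Vfield (F y)) x.
Proof.
move=> h; have c k := differentiable_crd k h.
have cN k : differentiable (fun y => - crd (F y) k) x by exact: differentiableN.
apply: differentiable_rv4 => -[|[|[|[|//]]]] _; under eq_fun do rewrite VfieldE crdq.
- exact: cN.
- exact: c.
- exact: cN.
- exact: c.
Qed.

(** * The geodesic flow *)

Section Flow.
Variable R : realType.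
Variable lam : R.
Implicit Types (q e : 'rV[R]_4) (s t : R).

Definition tau : R := Num.sqrt (1 + lam ^+ 2).
Definition fC s : R := cos (tau * s).
Definition fS s : R := sin (tau * s) / tau.
Definition cosl s : R := cos (lam * s).
Definition sinl s : R := sin (lam * s).
(** The coefficients [fal], [fbe], [fmu], [fnu] are those of a geodesic on its origin q, on i q,
    on its velocity e and on i e: the characteristic equation of x'' + 2 lam i x' + x = 0 has the
    roots i (- lam + tau) and i (- lam - tau). *)
Definition fal s := cosl s * fC s + lam * (sinl s * fS s).
Definition fbe s := lam * (cosl s * fS s) - sinl s * fC s.
Definition fmu s := cosl s * fS s.
Definition fnu s := - (sinl s * fS s).
Definition fk1 s := cosl s * fC s - lam * (sinl s * fS s).
Definition fk2 s := - (lam * (cosl s * fS s)) - sinl s * fC s.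

Definition geo q e s : 'rV[R]_4 :=
  fal s *: q + fbe s *: Vfield q + fmu s *: e + fnu s *: Vfield e.
Definition dgeo q e s : 'rV[R]_4 :=
  - fmu s *: q + - fnu s *: Vfield q + fk1 s *: e + fk2 s *: Vfield e.

Lemma tau_sqr : tau ^+ 2 = 1 + lam ^+ 2.
Proof. by rewrite sqr_sqrtr// addr_ge0// sqr_ge0. Qed.
Lemma tau_gt0 : 0 < tau.
Proof. by rewrite sqrtr_gt0 ltr_pwDl// sqr_ge0. Qed.
Lemma tau_neq0 : tau != 0. Proof. by rewrite gt_eqF// tau_gt0. Qed.
Lemma lam_lt_tau : `|lam| < tau.
Proof.
rewrite -(@ltr_pXn2r _ 2)// ?nnegrE ?ltW ?tau_gt0// tau_sqr real_normK ?num_real//.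
by rewrite ltrDr.
Qed.

Lemma cosl_sinl s : cosl s ^+ 2 + sinl s ^+ 2 = 1. Proof. exact: cos2Dsin2. Qed.
Lemma fC_fS s : fC s ^+ 2 + (1 + lam ^+ 2) * fS s ^+ 2 = 1.
Proof.
by rewrite -tau_sqr /fS expr_div_n mulrC divfK ?expf_neq0 ?tau_neq0// cos2Dsin2.
Qed.

Lemma is_derive_cosM (a s : R) : is_derive s 1 (fun s => cos (a * s)) (- (a * sin (a * s))).
Proof.
have h : is_derive s 1 (fun s => a * s) a.
  by apply: (is_derive_eq (is_deriveZ a (is_derive_id s 1))); rewrite /GRing.scale/= mulr1.
apply: (is_derive_eq (is_derive1_comp (is_derive_cos (a * s)) h)).
by rewrite /GRing.scale/=; ring.
Qed.
Lemma is_derive_sinM (a s : R) : is_derive s 1 (fun s => sin (a * s)) (a * cos (a * s)).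
Proof.
have h : is_derive s 1 (fun s => a * s) a.
  by apply: (is_derive_eq (is_deriveZ a (is_derive_id s 1))); rewrite /GRing.scale/= mulr1.
apply: (is_derive_eq (is_derive1_comp (is_derive_sin (a * s)) h)).
by rewrite /GRing.scale/=; ring.
Qed.
Lemma is_derive_cosl s : is_derive s 1 cosl (- (lam * sinl s)).
Proof. exact: is_derive_cosM. Qed.
Lemma is_derive_sinl s : is_derive s 1 sinl (lam * cosl s).
Proof. exact: is_derive_sinM. Qed.
Lemma is_derive_fC s : is_derive s 1 fC (- ((1 + lam ^+ 2) * fS s)).
Proof.
apply: (is_derive_eq (is_derive_cosM tau s)); rewrite -tau_sqr /fS.
by field; exact: tau_neq0.
Qed.
Lemma is_derive_fS s : is_derive s 1 fS (fC s).
Proof.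
have -> : fS = tau^-1 *: (fun s => sin (tau * s)).
  by apply/funext => y; rewrite /fS mulrC.
apply: (is_derive_eq (is_deriveZ tau^-1 (is_derive_sinM tau s))).
by rewrite /GRing.scale/= mulKf// tau_neq0.
Qed.

Let dM (f g : R -> R) s df dg : is_derive s 1 f df -> is_derive s 1 g dg ->
  is_derive s 1 (fun x => f x * g x) (df * g s + f s * dg).
Proof.
move=> hf hg; apply: (is_derive_eq (is_deriveM hf hg)); rewrite /GRing.scale/=; ring.
Qed.
Let dZ (a : R) (f : R -> R) s df : is_derive s 1 f df ->
  is_derive s 1 (fun x => a * f x) (a * df).
Proof. by move=> hf; exact: (is_deriveZ a hf). Qed.

Lemma is_derive_fal s : is_derive s 1 fal (- fmu s).
Proof.
apply: (is_derive_eq (is_deriveD (dM (is_derive_cosl s) (is_derive_fC s))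
  (dZ lam (dM (is_derive_sinl s) (is_derive_fS s))))).
by rewrite /fmu; ring.
Qed.
Lemma is_derive_fbe s : is_derive s 1 fbe (- fnu s).
Proof.
apply: (is_derive_eq (is_deriveB (dZ lam (dM (is_derive_cosl s) (is_derive_fS s)))
  (dM (is_derive_sinl s) (is_derive_fC s)))).
by rewrite /fnu; ring.
Qed.
Lemma is_derive_fmu s : is_derive s 1 fmu (fk1 s).
Proof.
apply: (is_derive_eq (dM (is_derive_cosl s) (is_derive_fS s))).
by rewrite /fk1; ring.
Qed.
Lemma is_derive_fnu s : is_derive s 1 fnu (fk2 s).
Proof.
apply: (is_derive_eq (is_deriveN (dM (is_derive_sinl s) (is_derive_fS s)))).
by rewrite /fk2; ring.
Qed.
Lemma is_derive_fk1 s : is_derive s 1 fk1 (- fmu s + 2 * lam * fk2 s).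
Proof.
apply: (is_derive_eq (is_deriveB (dM (is_derive_cosl s) (is_derive_fC s))
  (dZ lam (dM (is_derive_sinl s) (is_derive_fS s))))).
by rewrite /fmu /fk2; ring.
Qed.
Lemma is_derive_fk2 s : is_derive s 1 fk2 (- fnu s - 2 * lam * fk1 s).
Proof.
apply: (is_derive_eq (is_deriveB (is_deriveN (dZ lam (dM (is_derive_cosl s) (is_derive_fS s))))
  (dM (is_derive_sinl s) (is_derive_fC s)))).
by rewrite /fnu /fk1; ring.
Qed.

Lemma is_derive_geo q e s : is_derive s 1 (geo q e) (dgeo q e s).
Proof.
exact: (is_deriveD (is_deriveD (is_deriveD (is_derive_scalel q (is_derive_fal s))
  (is_derive_scalel (Vfield q) (is_derive_fbe s))) (is_derive_scalel e (is_derive_fmu s)))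
  (is_derive_scalel (Vfield e) (is_derive_fnu s))).
Qed.

Lemma is_derive_dgeo q e s : is_derive s 1 (dgeo q e)
  (- geo q e s - (2 * lam) *: Vfield (dgeo q e s)).
Proof.
apply: (is_derive_eq (is_deriveD (is_deriveD (is_deriveD
  (is_derive_scalel q (is_deriveN (is_derive_fmu s)))
  (is_derive_scalel (Vfield q) (is_deriveN (is_derive_fnu s))))
  (is_derive_scalel e (is_derive_fk1 s)))
  (is_derive_scalel (Vfield e) (is_derive_fk2 s)))).
rewrite /geo /dgeo !Vl; apply: rv4P; rewrite !crdE /fal /fbe /fmu /fnu /fk1 /fk2; ring.
Qed.

Lemma flow0 q e : geo q e 0 = q /\ dgeo q e 0 = e.
Proof.
rewrite /geo /dgeo /fal /fbe /fmu /fnu /fk1 /fk2 /cosl /sinl /fC /fS !mulr0 cos0 sin0.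
by split; apply: rv4P; rewrite !crdE; ring.
Qed.
Lemma geo0 q e : geo q e 0 = q. Proof. by case: (flow0 q e). Qed.
Lemma dgeo0 q e : dgeo q e 0 = e. Proof. by case: (flow0 q e). Qed.

(** The energy |x|^2 + |x'|^2 of a solution is constant because the
    multiplication by i is skew-symmetric; by linearity this gives uniqueness. *)
Lemma flow_unique (x x' : R -> 'rV[R]_4) :
  (forall t, is_derive t 1 x (x' t)) ->
  (forall t, is_derive t 1 x' (- x t - (2 * lam) *: Vfield (x' t))) ->
  forall t, x t = geo (x 0) (x' 0) t /\ x' t = dgeo (x 0) (x' 0) t.
Proof.
move=> hx hx'.
pose d t := x t - geo (x 0) (x' 0) t; pose d' t := x' t - dgeo (x 0) (x' 0) t.
have hd t : is_derive t 1 d (d' t) by exact: (is_deriveB (hx t) (is_derive_geo _ _ t)).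
have hd' t : is_derive t 1 d' (- d t - (2 * lam) *: Vfield (d' t)).
  apply: (is_derive_eq (is_deriveB (hx' t) (is_derive_dgeo _ _ t))).
  rewrite /d /d'; move: (geo _ _ _) (dgeo _ _ _) (x t) (x' t) => a b c c'.
  by rewrite !Vl; apply: rv4P; rewrite !crdE; ring.
have hE t : is_derive t 1 (fun t => dot (d t) (d t) + dot (d' t) (d' t)) 0.
  apply: (is_derive_eq (is_deriveD (is_derive_dot (hd t) (hd t)) (is_derive_dot (hd' t) (hd' t)))).
  by move: (d t) (d' t) => a b; rewrite !dotl dotV0 dotV0' (dotC b a); ring.
move=> t; have := is_derive_0_is_cst t 0 hE.
rewrite {3 4}/d {3 4}/d' geo0 dgeo0 !subrr dot0l addr0 => h.
have := dot_ge0 (d t); have := dot_ge0 (d' t) => h1 h2.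
split; apply/eqP; rewrite -subr_eq0; apply/eqP; apply: dot_eq0; rewrite -/(d t) -/(d' t); lra.
Qed.

(** The pair (point, velocity) is the state of a geodesic; on states the flow is a group. *)
Definition Phi s (v : 'rV[R]_4 * 'rV[R]_4) := (geo v.1 v.2 s, dgeo v.1 v.2 s).

Lemma Phi0 v : Phi 0 v = v.
Proof. by rewrite /Phi geo0 dgeo0; case: v. Qed.

Lemma is_derive_shiftl (f : R -> 'rV[R]_4) (a t : R) df : is_derive (a + t) 1 f df ->
  is_derive t 1 (fun s => f (a + s)) df.
Proof.
move=> h; apply: is_derive_rv4 => k _; have hk := is_derive_crd k h.
have ha : is_derive t 1 (fun s => a + s) 1.
  by apply: (is_derive_eq (is_deriveD (is_derive_cst a t 1) (is_derive_id t 1))); rewrite add0r.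
apply: (is_derive_eq (@is_derive1_comp _ (fun y => crd (f y) k) (fun s => a + s) _ _ _ hk ha)).
by rewrite /GRing.scale/=; ring.
Qed.

(** Both sides solve the equation of the geodesics in t with the same initial state. *)
Lemma PhiD s t v : Phi t (Phi s v) = Phi (s + t) v.
Proof.
have h1 (u : R) : is_derive u 1 (fun u => geo v.1 v.2 (s + u)) (dgeo v.1 v.2 (s + u)).
  by apply: is_derive_shiftl; exact: is_derive_geo.
have h2 (u : R) : is_derive u 1 (fun u => dgeo v.1 v.2 (s + u))
    (- geo v.1 v.2 (s + u) - (2 * lam) *: Vfield (dgeo v.1 v.2 (s + u))).
  by apply: is_derive_shiftl; exact: is_derive_dgeo.
have [e1 e2] := flow_unique h1 h2 t.
by rewrite /Phi /= e1 e2 addr0.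
Qed.

Lemma PhiK s v : Phi (- s) (Phi s v) = v.
Proof. by rewrite PhiD subrr Phi0. Qed.

(** A point of the sphere and a unit horizontal vector at this point. *)
Definition unitary_pair (v : 'rV[R]_4 * 'rV[R]_4) : Prop :=
  [/\ dot v.1 v.1 = 1, dot v.2 v.2 = 1, dot v.2 v.1 = 0 & dot v.2 (Vfield v.1) = 0].

(** The four scalar products are constant along a solution of the equation. *)
Lemma unitary_Phi s v : unitary_pair v -> unitary_pair (Phi s v).
Proof.
case: v => q e [/= qq ee eq eVq].
have Ve : dot (Vfield e) q = 0 by rewrite dotVl eVq oppr0.
have E : forall a b c d a' b' c' d' : R,
  dot (a *: q + b *: Vfield q + c *: e + d *: Vfield e)
      (a' *: q + b' *: Vfield q + c' *: e + d' *: Vfield e) = a * a' + b * b' + c * c' + d * d'.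
  move=> a b c d a' b' c' d'; rewrite !dotl !dotVV.
  have f1 : dot q e = 0 by rewrite dotC.
  have f2 : dot q (Vfield e) = 0 by rewrite dotC.
  have f3 : dot (Vfield q) e = 0 by rewrite dotC.
  by rewrite !dotV0 !dotV0' qq ee eq eVq Ve f1 f2 f3; ring.
have h1 := cosl_sinl s; have h2 := fC_fS s.
have h3 : (cosl s ^+ 2 + sinl s ^+ 2) * (fC s ^+ 2 + (1 + lam ^+ 2) * fS s ^+ 2) = 1.
  by rewrite h1 h2 mulr1.
rewrite /Phi /geo /dgeo; split => /=.
- by rewrite E -h3 /fal /fbe /fmu /fnu; ring.
- by rewrite E -h3 /fk1 /fk2 /fmu /fnu; ring.
- by rewrite E /fal /fbe /fk1 /fk2 /fmu /fnu; ring.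
- have -> : Vfield (fal s *: q + fbe s *: Vfield q + fmu s *: e + fnu s *: Vfield e)
     = - fbe s *: q + fal s *: Vfield q + (- fnu s) *: e + fmu s *: Vfield e.
    by rewrite !Vl; apply: rv4P; rewrite !crdE; ring.
  by rewrite E /fal /fbe /fk1 /fk2 /fmu /fnu; ring.
Qed.
End Flow.

(** * Real induction, lines and second derivatives *)

Lemma nbhs_eps (R : realType) (V : normedModType R) (x : V) (P : set V) :
  nbhs x P <-> exists2 e : R, 0 < e & forall y, `|x - y| < e -> P y.
Proof.
split=> [/nbhs_ballP[e e0 h]|[e e0 h]].
  by exists e => // y xy; apply: h; rewrite -ball_normE.
by apply/nbhs_ballP; exists e => // y; rewrite -ball_normE; exact: h.
Qed.

Lemma continuous_eps (R : realType) (V W : normedModType R) (F : V -> W) x :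
  {for x, continuous F} <->
  forall e : R, 0 < e -> exists2 d : R, 0 < d & forall y, `|x - y| < d -> `|F x - F y| < e.
Proof.
split=> [h e e0|h].
  have /nbhs_eps[d d0 H] : nbhs x (fun y => `|F x - F y| < e).
    by apply: (h (fun z => `|F x - z| < e)); apply/nbhs_eps; exists e.
  by exists d.
move=> P /nbhs_eps[e e0 hP]; have [d d0 H] := h e e0.
by apply/nbhs_eps; exists d => // y /H /hP.
Qed.

Section RealInduction.
Variable R : realType.
(** Local form of induction: the property is transported over short intervals around every
    time, so the supremum of the times with the property is reached and is b. *)
Lemma real_induction (A : R -> Prop) (b : R) : 0 <= b -> A 0 ->
  (forall t, 0 <= t <= b -> exists2 e, 0 < e & forall t' t'', 0 <= t' <= b ->
     0 <= t'' <= b -> `|t - t'| < e -> `|t - t''| < e -> t' <= t'' -> A t' -> A t'') ->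
  A b.
Proof.
move=> b0 A0 H; pose S := [set t : R | 0 <= t <= b /\ A t].
have S0 : S 0 by split; rewrite ?lexx.
have hs : has_sup S by split; [exists 0|exists b => x [/andP[]]].
have sS t : S t -> t <= sup S by move=> St; apply: ub_le_sup => //; case: hs.
have s0 : 0 <= sup S by exact: sS.
have sb : sup S <= b by apply: ge_sup; [exists 0|move=> x [/andP[]]].
have [e e0 He] := H (sup S) (introT andP (conj s0 sb)).
have [t [t0b At] te] := sup_adherent e0 hs.
have tS : t <= sup S by apply: sS; split.
have tse : `|sup S - t| < e by rewrite ger0_norm ?subr_ge0// ltrBlDl -ltrBlDr.
pose t2 := Num.min b (sup S + e / 2).
have t2b : t2 <= b by rewrite /t2 ge_min lexx.
have st2 : sup S <= t2 by rewrite /t2 le_min sb lerDl divr_ge0 ?ltW.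
have t2e : `|sup S - t2| < e.
  rewrite distrC ger0_norm ?subr_ge0//.
  have : t2 <= sup S + e / 2 by rewrite /t2 ge_min lexx orbT.
  lra.
have At2 : A t2.
  by apply: (He t) => //; [rewrite (le_trans s0 st2)|exact: le_trans tS st2].
have := sS t2; rewrite /S /= (le_trans s0 st2) t2b => /(_ (conj isT At2)).
rewrite /t2 ge_min; case/orP => [bs|]; last by lra.
suff <- : t2 = b by [].
by apply/eqP; rewrite eq_le t2b (le_trans bs st2).
Qed.
End RealInduction.

Section Diff.
Variables (R : realType) (V W : normedModType R).
Lemma diff_eps (F : V -> W) u : differentiable F u -> forall e : R, 0 < e ->
  exists2 d : R, 0 < d & forall h, `|h| < d -> `|F (u + h) - F u - 'd F u h| <= e * `|h|.
Proof.
move=> dF e e0; have := diff_locally dF; set k := 'o _ => Fk.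
have /(littleoP [littleo of k]) /nbhs_ballP[d d0 Hd] := e0.
exists d => // h hd.
have E : F (h + u) = F u + 'd F u h + k h by exact: (congr1 (fun g => g h) Fk).
have -> : F (u + h) - F u - 'd F u h = k h.
  by rewrite (addrC u h) E -addrA -opprD (addrC (F u + _)) addrK.
by apply: Hd; rewrite -ball_normE /= sub0r normrN.
Qed.

Lemma is_derive_line (F : V -> W) (u h : V) (t : R) : differentiable F (u + t *: h) ->
  is_derive t 1 (fun s : R => F (u + s *: h)) ('d F (u + t *: h) h).
Proof.
move=> dF; have dh : derivable F (u + t *: h) h by exact: diff_derivable.
have E : (fun r : R => r^-1 *: (((fun s : R => F (u + s *: h)) \o shift t) (r *: (1 : R)) -
    F (u + t *: h))) = (fun r => r^-1 *: ((F \o shift (u + t *: h)) (r *: h) - F (u + t *: h))).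
  apply/funext => r /=; congr (_ *: (F _ - _)).
  have -> : r *: (1 : R) = r by exact: mulr1.
  by rewrite scalerDl addrCA.
split; first by rewrite /derivable E.
by rewrite -deriveE// /derive E.
Qed.
End Diff.

Lemma MVT_derive (R : realType) (f df : R -> R) (a b : R) : a < b ->
  (forall x, a <= x <= b -> is_derive x 1 f (df x)) ->
  exists2 c, a < c < b & f b - f a = df c * (b - a).
Proof.
move=> ab h; have [||c] := @MVT R f df a b ab.
- by move=> x; rewrite in_itv /= => /andP[ax xb]; apply: h; rewrite !ltW.
- apply: derivable_within_continuous => x; rewrite in_itv /= => /h.
  by case.
by rewrite in_itv /=; exists c.
Qed.

Section Schwarz.
Variables (R : realType) (V : normedModType R).
Implicit Types (g : V -> R) (u a b : V).

Let second_difference g u a b (r : R) : 0 < r ->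
  (forall s t, 0 <= s <= r -> 0 <= t <= r ->
     differentiable g (u + s *: a + t *: b) /\ differentiable ('D_a g) (u + s *: a + t *: b)) ->
  exists s t, [/\ 0 <= s <= r, 0 <= t <= r &
    g (u + r *: a + r *: b) - g (u + r *: a) - g (u + r *: b) + g u
     = r ^+ 2 * 'D_b ('D_a g) (u + s *: a + t *: b)].
Proof.
move=> r0 H.
have r00 : 0 <= r <= r by rewrite lexx ltW.
have r01 : 0 <= (0 : R) <= r by rewrite lexx ltW.
pose phi (x : R) := g ((u + r *: b) + x *: a) - g (u + x *: a).
pose dphi (x : R) := 'D_a g ((u + r *: b) + x *: a) - 'D_a g (u + x *: a).
have [x xr|c /andP[c0 cr] E1] := @MVT_derive R phi dphi 0 r r0.
  apply: is_deriveB.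
    have [d1 _] := H x r xr r00.
    have d1' : differentiable g (u + r *: b + x *: a) by rewrite addrAC.
    by rewrite deriveE//; exact: is_derive_line.
  have [d1 _] := H x 0 xr r01.
  have d1' : differentiable g (u + x *: a) by rewrite scale0r addr0 in d1.
  by rewrite deriveE//; exact: is_derive_line.
have cr' : 0 <= c <= r by rewrite !ltW.
pose G := 'D_a g.
have [y yr|e /andP[e0 er] E2] := @MVT_derive R (fun y : R => G ((u + c *: a) + y *: b))
   (fun y : R => 'D_b G ((u + c *: a) + y *: b)) 0 r r0.
  have [_ d2] := H c y cr' yr.
  by rewrite deriveE//; exact: is_derive_line.
have er' : 0 <= e <= r by rewrite !ltW.
exists c, e; split => //.
move: E1 E2; rewrite /phi /dphi /G !scale0r !addr0 !subr0.
rewrite !(addrAC u (r *: b)) => E1 E2.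
rewrite expr2 -mulrA [r * 'D_b _ _]mulrC -E2 mulrC -E1; lra.
Qed.

(** Schwarz: the second difference of g at u, computed by the mean value theorem in both
    orders, is close to either mixed derivative. *)
Lemma derive_commute g u a b :
  (\forall x \near u, differentiable g x) ->
  (\forall x \near u, differentiable ('D_a g) x) ->
  (\forall x \near u, differentiable ('D_b g) x) ->
  {for u, continuous ('D_b ('D_a g))} -> {for u, continuous ('D_a ('D_b g))} ->
  'D_b ('D_a g) u = 'D_a ('D_b g) u.
Proof.
move=> /nbhs_eps[e1 e10 H1] /nbhs_eps[e2 e20 H2] /nbhs_eps[e3 e30 H3] /continuous_eps C1 /continuous_eps C2.
apply/eqP/negPn/negP => ne.
pose d := `|'D_b ('D_a g) u - 'D_a ('D_b g) u|.
have d0 : 0 < d / 2 by rewrite divr_gt0// normr_gt0 subr_eq0.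
have [k1 k10 K1] := C1 _ d0; have [k2 k20 K2] := C2 _ d0.
pose m := Num.min (Num.min e1 e2) (Num.min e3 (Num.min k1 k2)).
have m0 : 0 < m by rewrite !lt_min e10 e20 e30 k10.
have me1 : m <= e1 by rewrite /m !ge_min lexx.
have me2 : m <= e2 by rewrite /m !ge_min lexx !orbT.
have me3 : m <= e3 by rewrite /m !ge_min lexx !orbT.
have mk1 : m <= k1 by rewrite /m !ge_min lexx !orbT.
have mk2 : m <= k2 by rewrite /m !ge_min lexx !orbT.
pose c := `|a| + `|b| + 1.
have c0 : 0 < c by rewrite ltr_wpDl// addr_ge0.
pose r := m / (2 * c).
have r0 : 0 < r by rewrite divr_gt0// mulr_gt0.
have rc : r * c = m / 2 by rewrite /r; field; rewrite gt_eqF.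
have near s t v w : `|v| + `|w| + 1 = c -> 0 <= s <= r -> 0 <= t <= r ->
    `|u - (u + s *: v + t *: w)| < m.
  move=> vw /andP[s0 sr] /andP[t0 tr].
  rewrite -addrA opprD addrA subrr add0r normrN.
  apply: (le_lt_trans (ler_normD _ _)); rewrite !normrZ !ger0_norm//.
  apply: (@le_lt_trans _ _ (r * `|v| + r * `|w|)); first by rewrite lerD// ler_wpM2r.
  apply: (@le_lt_trans _ _ (r * c)); first by rewrite -mulrDr ler_pM2l// -vw lerDl.
  by rewrite rc ltr_pdivrMr// ltr_pMr// ltr1n.
have vab : `|a| + `|b| + 1 = c by [].
have vba : `|b| + `|a| + 1 = c by rewrite (addrC `|b|).
have [s [t [sr tr E]]] := @second_difference g u a b r r0 (fun s t hs ht =>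
  conj (H1 _ (lt_le_trans (near s t a b vab hs ht) me1))
       (H2 _ (lt_le_trans (near s t a b vab hs ht) me2))).
have [s' [t' [sr' tr' E']]] := @second_difference g u b a r r0 (fun s t hs ht =>
  conj (H1 _ (lt_le_trans (near s t b a vba hs ht) me1))
       (H3 _ (lt_le_trans (near s t b a vba hs ht) me3))).
have E3 : 'D_b ('D_a g) (u + s *: a + t *: b) = 'D_a ('D_b g) (u + s' *: b + t' *: a).
  have r2 : r ^+ 2 != 0 by rewrite expf_neq0// gt_eqF.
  apply: (mulfI r2); refine (etrans (esym E) (etrans _ E')).
  rewrite (addrAC u (r *: a)); congr (_ + _).
  by rewrite -(addrA (g _)) (addrC (- _) (- _)) addrA.
have h1 := K1 _ (lt_le_trans (near s t a b vab sr tr) mk1).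
have h2 := K2 _ (lt_le_trans (near s' t' b a vba sr' tr') mk2).
rewrite E3 in h1; rewrite distrC in h2.
have := ltrD h1 h2; rewrite -splitr ltNge; apply/negP; rewrite negbK.
exact: (ler_distD ('D_a ('D_b g) (u + s' *: b + t' *: a))).
Qed.
End Schwarz.

(** * Immersions of the plane and traps *)

Section Planar.
Variable R : realType.
Implicit Types (u v h : 'rV[R]_2) (F : 'rV[R]_2 -> 'rV[R]_4).

Definition b0 : 'rV[R]_2 := delta_mx ord0 ord0.
Definition b1 : 'rV[R]_2 := delta_mx ord0 (lift ord0 ord0).
Definition c0 h : R := h ord0 ord0.
Definition c1 h : R := h ord0 (lift ord0 ord0).

Lemma rv2E h : h = c0 h *: b0 + c1 h *: b1.
Proof.
rewrite {1}(row_sum_delta h) big_ord_recl big_ord1.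
by congr (_ + _).
Qed.
Lemma c0E x y : c0 (x *: b0 + y *: b1) = x.
Proof. by rewrite /c0 /b0 /b1 !mxE /= mulr1 mulr0 addr0. Qed.
Lemma c1E x y : c1 (x *: b0 + y *: b1) = y.
Proof. by rewrite /c1 /b0 /b1 !mxE /= mulr1 mulr0 add0r. Qed.

Lemma diff_rv2 (W : normedModType R) (F : 'rV[R]_2 -> W) u h : differentiable F u ->
  'd F u h = c0 h *: 'D_b0 F u + c1 h *: 'D_b1 F u.
Proof. by move=> dF; rewrite {1}(rv2E h) linearD !linearZ -!deriveE. Qed.

Lemma quadratic_pos (a b c x y : R) : 0 < a -> b ^+ 2 < 4 * a * c ->
  a * x ^+ 2 + b * x * y + c * y ^+ 2 = 0 -> x = 0 /\ y = 0.
Proof.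
move=> a0 bac E.
have E2 : (2 * a * x + b * y) ^+ 2 + (4 * a * c - b ^+ 2) * y ^+ 2 = 0.
  have -> : (2 * a * x + b * y) ^+ 2 + (4 * a * c - b ^+ 2) * y ^+ 2
     = 4 * a * (a * x ^+ 2 + b * x * y + c * y ^+ 2) by ring.
  by rewrite E mulr0.
have D0 : 0 < 4 * a * c - b ^+ 2 by rewrite subr_gt0.
have y0 : y = 0.
  apply/eqP; rewrite -sqrf_eq0 eq_le sqr_ge0 andbT -(pmulr_rle0 _ D0).
  by rewrite -E2 lerDr sqr_ge0.
split => //; move: E; rewrite y0 expr0n /= !mulr0 !addr0 => /eqP.
by rewrite mulf_eq0 gt_eqF//= sqrf_eq0 => /eqP.
Qed.

(** Strict Cauchy-Schwarz inequality for independent vectors; the mixed product is written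
    twice because the form to which it is applied is not symmetric. *)
Lemma gram_pos (D0 D1 : 'rV[R]_4) : D1 != 0 ->
  (forall x y, x *: D0 + y *: D1 = 0 -> x = 0 /\ y = 0) ->
  (dot D0 D1 + dot D1 D0) ^+ 2 < 4 * dot D0 D0 * dot D1 D1.
Proof.
move=> D10 indep; have g1 : 0 < dot D1 D1 by exact: dot_gt0.
have : 0 < dot (dot D1 D1 *: D0 + - dot D0 D1 *: D1) (dot D1 D1 *: D0 + - dot D0 D1 *: D1).
  by apply: dot_gt0; apply/eqP => /indep[/eqP]; rewrite gt_eqF.
rewrite !dotl (dotC D1 D0) => h.
have : 0 < dot D1 D1 * (dot D0 D0 * dot D1 D1 - dot D0 D1 ^+ 2) by move: h; congr (_ < _); ring.
rewrite pmulr_rgt0// subr_gt0 => h'.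
have -> : (dot D0 D1 + dot D0 D1) ^+ 2 = 4 * dot D0 D1 ^+ 2 by ring.
by rewrite -mulrA ltr_pM2l.
Qed.

Lemma dot_lincomb (x y a b : R) (u v w z : 'rV[R]_4) :
  dot (x *: u + y *: v) (a *: w + b *: z) =
  x * a * dot u w + x * b * dot u z + y * a * dot v w + y * b * dot v z.
Proof. by rewrite !dotl; ring. Qed.

(** An immersion separates points near [u0]: if it took the same value at two
    points, the mean value theorem applied to the component of F along the image
    of their difference would give a null vector of a form close to the first
    fundamental form at [u0], which is positive definite. *)
Lemma immersion_locally_injective F u0 :
  (\forall u \near u0, differentiable F u) ->
  {for u0, continuous ('D_b0 F)} -> {for u0, continuous ('D_b1 F)} ->
  injective ('d F u0) ->
  exists2 r : R, 0 < r & forall u v, `|u0 - u| < r -> `|u0 - v| < r -> F u = F v -> u = v.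
Proof.
move=> dF C0 C1 inj.
have dF0 : differentiable F u0 by exact: nbhs_singleton dF.
pose D0 := 'D_b0 F u0; pose D1 := 'D_b1 F u0.
have indep x y : x *: D0 + y *: D1 = 0 -> x = 0 /\ y = 0.
  move=> E; have : x *: b0 + y *: b1 = 0.
    by apply: inj; rewrite diff_rv2// c0E c1E linear0.
  move=> E'; have := congr1 c0 E'; have := congr1 c1 E'; rewrite c0E c1E.
  by rewrite /c0 /c1 !mxE.
have D10 : D1 != 0.
  apply/eqP => D10; have [|_ /eqP] := indep 0 1; last by rewrite oner_eq0.
  by rewrite D10 scaler0 scale0r addr0.
have D00 : D0 != 0.
  apply/eqP => D00; have [|/eqP + _] := indep 1 0; last by rewrite oner_eq0.
  by rewrite D00 scaler0 scale0r addr0.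
have g0 : 0 < dot D0 D0 by exact: dot_gt0.
have gd := gram_pos D10 indep.
(* The second argument is frozen at u0, as [w] is in the mean value theorem below. *)
pose m00 u := dot ('D_b0 F u) D0; pose m01 u := dot ('D_b0 F u) D1.
pose m10 u := dot ('D_b1 F u) D0; pose m11 u := dot ('D_b1 F u) D1.
have E0 a : dot ('D_b0 F u) a @[u --> u0] --> dot D0 a.
  by apply: (@cvg_dot _ _ (nbhs u0) _ (fun u => 'D_b0 F u) (fun=> a)); [exact: C0|exact: cvg_cst].
have E1 a : dot ('D_b1 F u) a @[u --> u0] --> dot D1 a.
  by apply: (@cvg_dot _ _ (nbhs u0) _ (fun u => 'D_b1 F u) (fun=> a)); [exact: C1|exact: cvg_cst].
have n0 : \forall u \near u0, 0 < m00 u.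
  exact: (@cvgr_gt _ _ _ _ _ _ (E0 D0) 0 g0).
have n1 : \forall u \near u0, 0 < 4 * m00 u * m11 u - (m01 u + m10 u) ^+ 2.
  have L : (4 * m00 u * m11 u - (m01 u + m10 u) ^+ 2) @[u --> u0] -->
         (4 * m00 u0 * m11 u0 - (m01 u0 + m10 u0) ^+ 2).
    under eq_fun do rewrite expr2; rewrite expr2.
    have S : (m01 u + m10 u) @[u --> u0] --> m01 u0 + m10 u0 by exact (cvgD (E0 D1) (E1 D0)).
    exact (cvgB (cvgM (cvgM (cvg_cst (4 : R)) (E0 D0)) (E1 D1)) (cvgM S S)).
  by apply: (@cvgr_gt _ _ _ _ _ _ L 0); rewrite subr_gt0.
have [r r0 Hr] := (nbhs_eps _ _).1 (filterI dF (filterI n0 n1)).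
exists r => // u v ur vr Fuv.
pose h := u - v; pose w := 'd F u0 h.
pose g (t : R) := dot (F (v + t *: h)) w.
have seg (t : R) : 0 <= t <= 1 -> `|u0 - (v + t *: h)| < r.
  move=> /andP[t0 t1].
  have -> : u0 - (v + t *: h) = (1 - t) *: (u0 - v) + t *: (u0 - u).
    by rewrite /h; apply/rowP => i; rewrite !mxE; ring.
  apply: (le_lt_trans (ler_normD _ _)); rewrite !normrZ (ger0_norm t0) ger0_norm ?subr_ge0//.
  have [t00|t00] := eqVneq t 0; first by rewrite t00 subr0 mul1r mul0r addr0.
  have -> : r = (1 - t) * r + t * r by ring.
  have tp : 0 < t by rewrite lt_neqAle eq_sym t00.
  apply: ler_ltD; last by rewrite ltr_pM2l.
  by apply: ler_wpM2l; [rewrite subr_ge0|exact: ltW].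
have [x x01|t /andP[t0 t1] E] := @MVT_derive R g (fun t => dot ('d F (v + t *: h) h) w) 0 1 ltr01.
  have [dFx _] := Hr _ (seg x x01).
  apply: (is_derive_eq (is_derive_dot (is_derive_line dFx) (is_derive_cst w x 1))).
  by rewrite dot0r addr0.
have t01 : 0 <= t <= 1 by rewrite !ltW.
have [dFt [m0 m1]] := Hr _ (seg t t01).
have vh : v + h = u by rewrite /h addrC subrK.
move: E; rewrite /g scale1r scale0r addr0 vh Fuv subrr subr0 mulr1 => /esym E.
suff [e0 e1] : c0 h = 0 /\ c1 h = 0.
  by apply/eqP; rewrite -subr_eq0 -/h (rv2E h) e0 e1 !scale0r addr0.
have EQ : c0 h * c0 h * m00 (v + t *: h) + c0 h * c1 h * m01 (v + t *: h)
   + c1 h * c0 h * m10 (v + t *: h) + c1 h * c1 h * m11 (v + t *: h) = 0.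
  exact (etrans (esym (dot_lincomb _ _ _ _ _ _ _ _))
    (etrans (esym (congr2 (@dot R 4) (diff_rv2 h dFt) (diff_rv2 h dF0))) E)).
move: m0 m1 EQ; move: (m00 _) (m01 _) (m10 _) (m11 _) (c0 h) (c1 h).
move=> a b c d x y a0; rewrite subr_gt0 => lt EQ.
apply: (quadratic_pos a0 lt); refine (etrans _ EQ); ring.
Qed.
End Planar.
Arguments b0 {R}. Arguments b1 {R}.

Section CompactLemmas.
Variables (R : realType) (T : topologicalType).
(** The distance to q has a minimum on K. *)
Lemma compact_avoid (g : T -> 'rV[R]_4) (K : set T) q : compact K ->
  (forall y, K y -> {for y, continuous g}) -> ~ (g @` K) q ->
  exists2 e : R, 0 < e & forall y, K y -> e <= `|g y - q|.
Proof.
move=> cK cg nq; have [K0|/nonemptyPn K0] := pselect (K !=set0); last first.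
  by exists 1 => // y; rewrite K0.
have cn : {within K, continuous (fun y => `|g y - q|)}.
  apply: continuous_in_subspaceT => y; rewrite inE => Ky.
  apply: cvg_norm; apply: cvgB; [exact: cg|exact: cvg_cst].
have [c + H] := compact_EVT_min K0 cK cn; rewrite inE => Kc.
exists `|g c - q|; last by move=> y Ky; apply: H; rewrite inE.
by rewrite normr_gt0 subr_eq0; apply/eqP => E; apply: nq; exists c.
Qed.
End CompactLemmas.

Section Trap.
Variables (R : realType) (M : topologicalType) (f : M -> 'rV[R]_4).
Hypotheses (hM : hausdorff_space M) (fc : continuous f).

(** A compact piece of surface on which [f] is injective, and which a connected
    set can leave only where [f] is at distance [eta] from [f x]. *)
Definition trap x K (eta : R) := [/\ compact K,
  forall y z, K y -> K z -> f y = f z -> y = z, K x, 0 < eta &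
  forall y, K y -> `|f y - f x| < eta -> nbhs y K].

(** The part of D in K is closed in D as K is compact, and open as D stays at distance
    less than eta. *)
Lemma trap_connected x K eta D : trap x K eta -> connected D ->
  (forall y, D y -> `|f y - f x| < eta) -> (exists2 y, D y & K y) -> D `<=` K.
Proof.
move=> [cK _ _ _ hn] cD hD [y0 Dy0 Ky0].
have E : D `&` K = D.
  apply: cD; first by exists y0.
  - exists (interior K); first exact: open_interior.
    apply/seteqP; split => y [Dy Ky]; split => //; first by apply: hn => //; exact: hD.
    exact: interior_subset.
  - by exists K => //; exact: compact_closed.
by rewrite -E => y [].
Qed.

(** On the compact part of K outside the interior of W, f avoids its value at x. *)
Lemma compact_inverse_continuous K x W : compact K ->
  (forall y z, K y -> K z -> f y = f z -> y = z) -> K x -> nbhs x W ->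
  exists2 d : R, 0 < d & forall y, K y -> `|f y - f x| < d -> W y.
Proof.
move=> cK inj Kx Wx.
have cKW : compact (K `&` ~` interior W).
  by apply: compact_closedI => //; apply: open_closedC; exact: open_interior.
have [y _|[y [Ky nW] /inj yx]|d d0 H] := @compact_avoid _ _ f _ (f x) cKW.
- exact: fc.
- by apply: nW; rewrite (yx Ky Kx).
- exists d => // y Ky yd; apply: interior_subset; apply: contrapT => nW.
  by have := H y (conj Ky nW); rewrite leNgt yd.
Qed.
End Trap.

(** * Vector product and differentiability *)

Section Cross.
Variable R : realType.
Implicit Types x y z w v : 'rV[R]_4.

(** The vector product of three vectors of the four-dimensional space: its
    scalar product with [w] is the determinant of x, y, z, w. *)
Definition cross x y z : 'rV[R]_4 :=
  let m a b c := crd x a * (crd y b * crd z c - crd y c * crd z b)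
               - crd x b * (crd y a * crd z c - crd y c * crd z a)
               + crd x c * (crd y a * crd z b - crd y b * crd z a) in
  quat (- m 1%N 2%N 3%N) (m 0%N 2%N 3%N) (- m 0%N 1%N 3%N) (m 0%N 1%N 2%N).

Lemma cross_perp x y z : [/\ dot (cross x y z) x = 0, dot (cross x y z) y = 0 &
  dot (cross x y z) z = 0].
Proof. by split; rewrite !dotE /cross !crdq; ring. Qed.

(** Cramer rule: each coefficient is the determinant with one of the vectors replaced by v. *)
Lemma cramer x y z w v : dot (cross x y z) w *: v =
  - dot (cross v y z) w *: - x + dot (cross x v z) w *: y + dot (cross x y v) w *: z
  + dot (cross x y z) v *: w.
Proof. by rewrite !dotE /cross; apply: rv4P; rewrite !crdE; ring. Qed.

Lemma cross_sqr x y z : dot (cross x y z) (cross x y z) =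
  dot x x * (dot y y * dot z z - dot y z ^+ 2) - dot x y * (dot x y * dot z z - dot y z * dot x z)
  + dot x z * (dot x y * dot y z - dot y y * dot x z).
Proof. by rewrite !dotE /cross !crdq; ring. Qed.

Lemma perp3 x y z v : cross x y z != 0 -> dot v x = 0 -> dot v y = 0 -> dot v z = 0 ->
  v = (dot v (cross x y z) / dot (cross x y z) (cross x y z)) *: cross x y z.
Proof.
set n := cross x y z => n0 vx vy vz.
have nn : dot n n != 0 by rewrite gt_eqF// dot_gt0.
have [nx ny nz] := cross_perp x y z.
set k := _ / _; pose r := v - k *: n.
have rx : dot r x = 0 by rewrite /r !dotl vx nx; ring.
have ry : dot r y = 0 by rewrite /r !dotl vy ny; ring.
have rz : dot r z = 0 by rewrite /r !dotl vz nz; ring.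
have rn : dot r n = 0 by rewrite /r !dotl /k divfK// subrr.
have rE : r = v - k *: n by []; clearbody r.
have := congr1 (dot r) (cramer x y z n r); rewrite -/n; clearbody n.
rewrite !dotl rx ry rz rn => E.
have rr : dot r r = 0.
  apply/eqP; have /eqP : dot n n * dot r r = 0 by rewrite E; ring.
  by rewrite mulf_eq0 (negbTE nn).
by apply/eqP; rewrite -subr_eq0 -rE (dot_eq0 rr).
Qed.
End Cross.

Section DiffTools.
Variables (R : realType).

Lemma differentiable_epsP (V W : normedModType R) (F : V -> W) u (L : {linear V -> W}) :
  continuous L ->
  (forall e : R, 0 < e -> exists2 d : R, 0 < d &
     forall h, `|h| < d -> `|F (u + h) - F u - L h| <= e * `|h|) ->
  differentiable F u /\ 'd F u = L :> (V -> W).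
Proof.
move=> cL H.
have E : F \o shift u = cst (F u) + L +o_ 0 id.
  apply/eqaddoP => e e0; have [d d0 Hd] := H e e0.
  apply/nbhs_eps; exists d => // h; rewrite sub0r normrN => hd.
  by have := Hd h hd; rewrite (addrC u) -addrA -opprD.
have dE := @diff_unique _ _ _ _ L u cL E.
by split => //; apply/diff_locallyP; rewrite dE.
Qed.

Lemma differentiable_near_eq (V W : normedModType R) (F G : V -> W) u :
  (\forall v \near u, F v = G v) -> differentiable G u ->
  differentiable F u /\ 'd F u = 'd G u :> (V -> W).
Proof.
move=> nE dG; apply: differentiable_epsP; first exact: diff_continuous.
move=> e e0; have [d d0 Hd] := diff_eps dG e0.
have [d' d'0 Hd'] := (nbhs_eps _ _).1 nE.
exists (Num.min d d'); first by rewrite lt_min d0.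
move=> h; rewrite lt_min => /andP[hd hd'].
rewrite Hd' ?(nbhs_singleton nE); first exact: Hd.
by rewrite opprD addrA subrr sub0r normrN.
Qed.

Lemma differentiable_sqrt (V : normedModType R) (g : V -> R) u : 0 < g u ->
  differentiable g u -> differentiable (fun v => Num.sqrt (g v)) u.
Proof.
move=> g0 dg; apply: (@differentiable_comp _ _ _ _ g Num.sqrt) => //.
by apply/derivable1_diffP; case: (is_derive1_sqrt g0).
Qed.

Lemma differentiable_enorm (V : normedModType R) (F : V -> 'rV[R]_4) u : F u != 0 ->
  differentiable F u -> differentiable (fun v => enorm (F v)) u.
Proof.
move=> F0 dF; apply: differentiable_sqrt; first exact: dot_gt0.
exact: differentiable_dot.
Qed.

Lemma differentiable_unit (V : normedModType R) (F : V -> 'rV[R]_4) u : F u != 0 ->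
  differentiable F u -> differentiable (fun v => (enorm (F v))^-1 *: F v) u.
Proof.
move=> F0 dF; apply: differentiable_scale => //.
apply: (@differentiableV _ _ (fun v => enorm (F v))); first exact: differentiable_enorm.
by rewrite gt_eqF// enorm_gt0.
Qed.

Lemma differentiable_cross (V : normedModType R) (F G H : V -> 'rV[R]_4) u :
  differentiable F u -> differentiable G u -> differentiable H u ->
  differentiable (fun v => cross (F v) (G v) (H v)) u.
Proof.
move=> dF dG dH.
pose a k := fun v => crd (F v) k; pose b k := fun v => crd (G v) k; pose c k := fun v => crd (H v) k.
have da k : differentiable (a k) u by exact: differentiable_crd.
have db k : differentiable (b k) u by exact: differentiable_crd.
have dc k : differentiable (c k) u by exact: differentiable_crd.
have dm i j k : differentiable (a i * (b j * c k - b k * c j) - a j * (b i * c k - b k * c i)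
    + a k * (b i * c j - b j * c i)) u.
  by apply: differentiableD; [apply: differentiableB|]; apply: differentiableM => //;
    apply: differentiableB; apply: differentiableM.
apply: differentiable_rv4 => -[|[|[|[|//]]]] _; rewrite /cross; under eq_fun do rewrite crdq.
- exact: (differentiableN (dm 1%N 2%N 3%N)).
- exact: (dm 0%N 2%N 3%N).
- exact: (differentiableN (dm 0%N 1%N 3%N)).
- exact: (dm 0%N 1%N 2%N).
Qed.
End DiffTools.

(** * The immersed surface and its normal *)

Lemma near_cst_is_derive (R : realType) (V W : normedModType R) (g : V -> W) (k d : W) u a :
  (\forall v \near u, g v = k) -> is_derive u a g d -> d = 0.
Proof.
move=> nE dg; have [d1 d2] := differentiable_near_eq nE (differentiable_cst k u).
rewrite -(@derive_val _ _ _ _ _ _ _ dg) deriveE// d2.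
by have -> : 'd (fun=> k) u = 0 :> (V -> W) by exact: diff_cst.
Qed.

Section Surface.
Variables (R : realType) (M : topologicalType) (A : set (chart R M)) (f N : M -> 'rV[R]_4).
Hypotheses (hM : C2_surface A) (hf : C2_immersion_S3 A f) (hN : unit_normal A f N).

Lemma surface_hausdorff : hausdorff_space M. Proof. by case: hM. Qed.

Lemma chart_at x : exists c u, [/\ A c, cdom c u & param c u = x].
Proof. by case: hM => _ _ [_ /(_ x)[c Ac [u cu ux]] _]; exists c, u. Qed.

Section Chart.
Variables (c : chart R M) (Ac : A c).
Local Notation F := (f \o param c).

Lemma chart_ok : chart_homeo c. Proof. by case: hM => _ _ [/(_ c Ac)]. Qed.
Lemma cdom_near u : cdom c u -> \forall v \near u, cdom c v.
Proof. by case: chart_ok => o _ _ _ _ cu; exact: open_nbhs_nbhs. Qed.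
Lemma param_continuous u : cdom c u -> {for u, continuous (param c)}.
Proof. by case: chart_ok => _ _ _ + _; apply. Qed.
Lemma chart_diff u : cdom c u -> differentiable F u.
Proof. by case: hf => _ /(_ c Ac)[[+ _] _]; apply. Qed.
Lemma chart_diff2 u a : cdom c u -> differentiable ('D_a F) u.
Proof. by case: hf => _ /(_ c Ac)[[_ /(_ a)[+ _]] _]; apply. Qed.
Lemma chart_cont2 u a b : cdom c u -> {for u, continuous ('D_b ('D_a F))}.
Proof. by move=> cu; case: hf => _ /(_ c Ac)[[_ /(_ a)[_ /(_ b) h]] _]; exact: (h u cu). Qed.
Lemma chart_inj u : cdom c u -> injective ('d F u).
Proof. by move=> cu; case: hf => _ /(_ c Ac)[_ /(_ u cu)]. Qed.

Lemma near_param u (P : 'rV[R]_2 -> Prop) : cdom c u -> (\forall v \near u, P v) ->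
  \forall y \near param c u, [/\ cdom c (Defs.coord c y), P (Defs.coord c y) & param c (Defs.coord c y) = y].
Proof.
case: chart_ok => oc oi ck _ cc cu nP.
have iu : cimage c (param c u) by exists u.
have n1 : \forall y \near param c u, cimage c y by exact: open_nbhs_nbhs.
have n2 : \forall y \near param c u, P (Defs.coord c y).
  by have := cc _ iu P; rewrite ck//; apply.
apply: filterS2 n1 n2 => y [v cv <-] Pv; rewrite ck// in Pv *.
Qed.
End Chart.

Lemma immersion_continuous : continuous f.
Proof.
move=> x; have [c [u [Ac cu <-]]] := chart_at x => P nP.
have nP' : \forall v \near u, P (f (param c v)).
  exact: (differentiable_continuous (chart_diff Ac cu) nP).
apply: filterS (near_param Ac cu nP') => y [_ Py yE].
by rewrite /= yE in Py.
Qed.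

Lemma sphere x : dot (f x) (f x) = 1. Proof. by case: hf => /(_ x). Qed.
Lemma normal_unit x : dot (N x) (N x) = 1. Proof. by case: hN => _ /(_ x)[]. Qed.
Lemma normal_tangent x : dot (N x) (f x) = 0. Proof. by case: hN => _ /(_ x)[]. Qed.

Lemma diff_perp_normal c u a : A c -> cdom c u ->
  dot ('d (f \o param c) u a) (N (param c u)) = 0.
Proof.
by move=> Ac cu; case: hN => _ /(_ (param c u))[_ _ h]; rewrite dotC; apply: h; exists c, u, a.
Qed.

Lemma diff_perp_sphere c u a : A c -> cdom c u ->
  dot ('d (f \o param c) u a) (f (param c u)) = 0.
Proof.
move=> Ac cu; have dF := chart_diff Ac cu.
have H : is_derive u a (f \o param c) ('d (f \o param c) u a).
  by rewrite -deriveE//; exact/derivableP/diff_derivable.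
have nE : \forall v \near u, dot ((f \o param c) v) ((f \o param c) v) = 1.
  exact: (@filterE _ (nbhs u) _ _ (fun v => sphere _)).
have := near_cst_is_derive nE (is_derive_dot H H).
rewrite (dotC (f (param c u))) => h; lra.
Qed.

Section Frame.
Variables (c : chart R M) (u : 'rV[R]_2).
Hypotheses (Ac : A c) (cu : cdom c u).
Local Notation F := (f \o param c).
Local Notation D0 := ('D_b0 F u).
Local Notation D1 := ('D_b1 F u).

Lemma chart_indep x y : x *: D0 + y *: D1 = 0 -> x = 0 /\ y = 0.
Proof.
move=> E; have E' : x *: b0 + y *: b1 = 0.
  apply: (chart_inj Ac cu); rewrite linear0; refine (etrans (diff_rv2 _ (chart_diff Ac cu)) _).
  by rewrite c0E c1E.
have := congr1 (@c0 R) E'; have := congr1 (@c1 R) E'; rewrite c0E c1E.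
by rewrite /c0 /c1 !mxE.
Qed.

Lemma chart_cross_neq0 : cross (f (param c u)) D0 D1 != 0.
Proof.
have D10 : D1 != 0.
  apply/eqP => D10; have [|_ /eqP] := chart_indep (x := 0) (y := 1); last by rewrite oner_eq0.
  by rewrite D10 scaler0 scale0r addr0.
have gd := gram_pos D10 chart_indep.
have p0 : dot D0 (f (param c u)) = 0.
  by rewrite deriveE; [exact: diff_perp_sphere|exact: chart_diff].
have p1 : dot D1 (f (param c u)) = 0.
  by rewrite deriveE; [exact: diff_perp_sphere|exact: chart_diff].
have ff := sphere (param c u).
move: gd p0 p1 ff; move: ('D_b0 F u) ('D_b1 F u) (f (param c u)) => a b p gd ap bp pp.
apply/eqP => n0; have := cross_sqr p a b; rewrite n0 dot0l pp (dotC p a) (dotC p b) ap bp.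
rewrite (dotC b a) in gd => E; have : 0 < (4 * dot a a * dot b b - (dot a b + dot a b) ^+ 2) by rewrite subr_gt0.
have -> : 4 * dot a a * dot b b - (dot a b + dot a b) ^+ 2 =
  4 * (1 * (dot a a * dot b b - dot a b ^+ 2)) by ring.
move: E; rewrite !mul0r subr0 addr0 => <-; rewrite mulr0 ltxx//.
Qed.

Lemma perp_D0 v : (forall a, dot ('d F u a) v = 0) -> dot v D0 = 0 /\ dot v D1 = 0.
Proof. by move=> h; have dF := chart_diff Ac cu; rewrite !deriveE// !(dotC v) !h. Qed.

(** The normal is orthogonal to the position and to the coordinate vectors, a line spanned by
    their vector product. *)
Lemma normal_cross : N (param c u) =
  (dot (N (param c u)) (cross (f (param c u)) D0 D1)
   / dot (cross (f (param c u)) D0 D1) (cross (f (param c u)) D0 D1))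
   *: cross (f (param c u)) D0 D1.
Proof.
have [h0 h1] := perp_D0 (fun a => diff_perp_normal a Ac cu).
exact: (perp3 chart_cross_neq0 (normal_tangent _) h0 h1).
Qed.

(** The differential of the immersion maps the plane onto the orthogonal of f and N: the vector
    product of f and the coordinate vectors is a multiple of N. *)
Lemma tangent_surj w : dot w (f (param c u)) = 0 -> dot w (N (param c u)) = 0 ->
  exists a, 'd F u a = w.
Proof.
move=> wf wN.
have n0 := chart_cross_neq0; have NE := normal_cross.
have NN := normal_unit (param c u); have Nf := normal_tangent (param c u).
have SS := sphere (param c u).
have [h0 h1] := perp_D0 (fun a => diff_perp_normal a Ac cu).
have [g0 g1] := perp_D0 (fun a => diff_perp_sphere a Ac cu).
suff [x [y E]] : exists x y, w = x *: D0 + y *: D1.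
  exists (x *: b0 + y *: b1); refine (etrans (diff_rv2 _ (chart_diff Ac cu)) _).
  by rewrite c0E c1E E.
move: n0 NE NN Nf SS h0 h1 g0 g1 wf wN; move: D0 D1 (f (param c u)) (N (param c u)).
move=> a b p n n0 nE nn np ff na nb pa pb wp wn.
have k0 : dot (cross p a b) n != 0.
  apply/eqP => E; move: nE; rewrite dotC in E; rewrite E mul0r scale0r => n00.
  by move: nn; rewrite n00 dot0l => /esym/eqP; rewrite oner_eq0.
have C := cramer p a b n w.
have [w0 _ _] := cross_perp w a b.
have Cp := congr1 (dot p) C; have Cn := congr1 (dot n) C; move: Cp Cn.
rewrite !dotl (dotC p w) wp pa pb (dotC p n) np na nb nn (dotC n w) wn (dotC (cross p a b) w).
rewrite !(mulr0, addr0, add0r) => Cp Cn.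
have z0 : dot w (cross p a b) = 0 by lra.
have pp : dot (cross w a b) n *: p = 0.
  have -> : dot (cross w a b) n = 0 by move: Cp; rewrite ff => Cp; lra.
  by rewrite scale0r.
move: C; rewrite scalerN scaleNr opprK pp add0r dotC (dotC (cross p a b) w) z0 scale0r addr0 => C.
exists (dot (cross p w b) n / dot n (cross p a b)), (dot (cross p a w) n / dot n (cross p a b)).
rewrite dotC in k0.
by rewrite ![_ / dot n _]mulrC -!scalerA -scalerDr -C scalerA mulVf// scale1r.
Qed.
End Frame.

Lemma tangentSpaceE x : tangentSpace A f x = [set w | dot w (f x) = 0 /\ dot w (N x) = 0].
Proof.
apply/seteqP; split => w.
  by move=> [c [u [a [Ac cu <- ->]]]]; split; [exact: diff_perp_sphere|exact: diff_perp_normal].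
move=> /= [wf wN]; have [c [u [Ac cu xE]]] := chart_at x.
have [||a aE] := @tangent_surj c u Ac cu w; rewrite ?xE//.
by exists c, u, a.
Qed.

(** The tangent plane is the orthogonal of f and N, the horizontal plane the orthogonal of f and i f. *)
Lemma singularP x : singular_set A f x <-> Nh f N x = 0.
Proof.
rewrite /singular_set /= tangentSpaceE; split=> [E|E].
  have h w : dot w (f x) = 0 -> dot w (Vfield (f x)) = 0 -> dot w (N x) = 0.
    move=> w1 w2; have : horizontal (f x) w by apply/horizontalP => //; exact: sphere.
    by rewrite -E => -[].
  have := frame_expand (f x) (N x); rewrite sphere scale1r normal_tangent scale0r add0r.
  rewrite (dotC (N x) (E1 _)) (dotC (N x) (E2 _)) !h ?dotE1p ?dotE2p ?dotE1V ?dotE2V//.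
  by rewrite !scale0r !addr0 /Nh => {1}->; rewrite subrr.
have NE : N x = dot (N x) (Vfield (f x)) *: Vfield (f x).
  by apply/eqP; rewrite -subr_eq0 -/(Nh f N x) E.
have k0 : dot (N x) (Vfield (f x)) != 0.
  apply/eqP => k; move: NE; rewrite k scale0r => n0.
  by have := normal_unit x; rewrite n0 dot0l => /esym/eqP; rewrite oner_eq0.
apply/seteqP; split => w.
  move=> [wf wN]; apply/horizontalP; first exact: sphere.
  split=> //; move: wN; rewrite NE dotZr => /eqP; rewrite mulf_eq0 (negbTE k0) => /eqP//.
move=> /horizontalP => /(_ (sphere x))[wf wV]; split => //.
by rewrite NE dotZr wV mulr0.
Qed.

(** Near a point of a chart, the normal is a fixed multiple +1 or -1 of the
    normalized vector product of the position and the coordinate vectors. *)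
Lemma normal_differentiable c u : A c -> cdom c u -> differentiable (N \o param c) u.
Proof.
move=> Ac cu.
pose n v := cross (f (param c v)) ('D_b0 (f \o param c) v) ('D_b1 (f \o param c) v).
have dn : differentiable n u.
  by apply: differentiable_cross; [exact: chart_diff|exact: chart_diff2|exact: chart_diff2].
have n0 v : cdom c v -> n v != 0 by exact: chart_cross_neq0.
have Nn v : cdom c v -> N (param c v) = (dot (N (param c v)) (n v) / dot (n v) (n v)) *: n v.
  by move=> cv; exact: normal_cross.
pose k v := dot (N (param c v)) (n v).
have k0 v : cdom c v -> k v != 0.
  move=> cv; apply/eqP => E; have := normal_unit (param c v).
  by rewrite Nn// -/(k v) E mul0r scale0r dot0l => /esym/eqP; rewrite oner_eq0.
have ck : {for u, continuous k}.
  apply: continuous_dot; last exact: differentiable_continuous.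
  apply: (@continuous_comp _ _ _ (param c) N); first exact: param_continuous.
  by case: hN => cN _; exact: cN.
have kE v : cdom c v -> k v ^+ 2 = dot (n v) (n v).
  move=> cv; have := normal_unit (param c v); rewrite {1 2}Nn// !dotl -/(k v).
  have nn : dot (n v) (n v) != 0 by rewrite gt_eqF// dot_gt0// n0.
  move: nn; move: (dot (n v) (n v)) (k v) => x y x0 E.
  rewrite -[RHS]mulr1 -E; field; exact: x0.
pose s : R := Num.sg (k u).
have nE : \forall v \near u, (N \o param c) v = s *: ((enorm (n v))^-1 *: n v).
  have ns : \forall v \near u, 0 < s * k v.
    have cs : {for u, continuous (fun v => s * k v)} by apply: continuousM => //; exact: cst_continuous.
    have s0 : 0 < s * k u by rewrite /s -normrEsg normr_gt0 k0.
    exact: (@cvgr_gt _ _ _ _ _ _ cs 0 s0).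
  have s2 : s ^+ 2 = 1 by rewrite /s sqr_sg k0.
  apply: filterS2 (cdom_near Ac cu) ns => v cv sk.
  have ek : enorm (n v) = s * k v.
    have -> : enorm (n v) = `|s * k v|.
      by rewrite /enorm -kE// sqrtr_sqr normrM /s normr_sg k0// mul1r.
    exact: gtr0_norm.
  rewrite /= {1}Nn// scalerA -/(k v) -kE// ek; congr (_ *: _).
  have kv := k0 v cv; have s0 : s != 0 by rewrite /s sgr_eq0 k0.
  by field; rewrite kv s0.
have dG : differentiable (fun v => s *: ((enorm (n v))^-1 *: n v)) u.
  apply: differentiableZ; apply: differentiable_unit => //; exact: n0.
by have [] := differentiable_near_eq nE dG.
Qed.
End Surface.

(** * Small neighborhoods in the surface *)

Section Balls.
Variable R : realType.
Implicit Types (u v : 'rV[R]_2).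

Lemma dist_continuous u : continuous (fun v => `|u - v| : R).
Proof.
move=> v; apply/continuous_eps => e e0; exists e => // y vy.
apply: (le_lt_trans (ler_dist_dist _ _)).
have -> : u - v - (u - y) = y - v by apply/rowP => i; rewrite !mxE; ring.
by rewrite distrC.
Qed.

Lemma compact_disc u (r : R) : compact [set v : 'rV[R]_2 | `|u - v| <= r].
Proof.
apply: bounded_closed_compact.
  exists (`|u| + r); split; first exact: num_real.
  move=> M hM v /= h; apply: (le_trans _ (ltW hM)).
  by rewrite -[v](subKr u); apply: (le_trans (ler_normB _ _)); rewrite lerD2l.
apply: (@preimage_closed _ _ (fun v => `|u - v|) [set x : R | x <= r]); last exact: closed_le.
by move=> v _; exact: dist_continuous.
Qed.

Lemma compact_circle u (r : R) : compact [set v : 'rV[R]_2 | `|u - v| <= r /\ r <= `|u - v|].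
Proof.
have -> : [set v : 'rV[R]_2 | `|u - v| <= r /\ r <= `|u - v|] =
  [set v : 'rV[R]_2 | `|u - v| <= r] `&` [set v : 'rV[R]_2 | r <= `|u - v|] by [].
apply: compact_closedI; first exact: compact_disc.
apply: (@preimage_closed _ _ (fun v => `|u - v|) [set x : R | r <= x]); last exact: closed_ge.
by move=> v _; exact: dist_continuous.
Qed.

Lemma segment_connected_line u v : connected ((fun t : R => u + t *: (v - u)) @` `[0, 1]).
Proof.
apply: connected_continuous_connected; first exact: segment_connected.
apply: continuous_subspaceT => t; apply: cvgD; first exact: cvg_cst.
exact: scalel_continuous.
Qed.

(** A union of segments with a common end. *)
Lemma star_connected (D : set 'rV[R]_2) u : D u ->
  (forall v, D v -> forall t, 0 <= t <= 1 -> D (u + t *: (v - u))) -> connected D.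
Proof.
move=> Du H; pose seg v := (fun t : R => u + t *: (v - u)) @` `[0, 1].
have -> : D = \bigcup_(v in D) seg v.
  apply/seteqP; split=> [v Dv|w [v Dv [t]]].
    by exists v => //; exists 1; rewrite /= ?in_itv/= ?ler01 ?lexx// scale1r addrC subrK.
  by rewrite /= in_itv /= => t01 <-; exact: H.
apply: bigcup_connected => [|v _]; last exact: segment_connected_line.
by exists u => v _; exists 0; rewrite /= ?in_itv/= ?ler01 ?lexx// scale0r addr0.
Qed.

(** The punctured disc for the sup norm is covered by four convex sets, the open half planes
    limited by the coordinate axes, and consecutive ones meet. *)
Lemma punctured_disc_connected u (r : R) : 0 < r ->
  connected [set v : 'rV[R]_2 | `|u - v| < r /\ v <> u].
Proof.
move=> r0.
pose hp (g : 'rV[R]_2 -> R) := [set v : 'rV[R]_2 | `|u - v| < r /\ 0 < g (v - u)].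
have hpc (g : 'rV[R]_2 -> R) w : (forall a b s t, g (a *: s + b *: t) = a * g s + b * g t) ->
   hp g w -> connected (hp g).
  move=> gl [wr gw]; apply: (@star_connected _ w) => // v [vr gv] t /andP[t0 t1].
  have E : w + t *: (v - w) = (1 - t) *: w + t *: v by apply/rowP => i; rewrite !mxE; ring.
  split.
    have -> : u - (w + t *: (v - w)) = (1 - t) *: (u - w) + t *: (u - v).
      by apply/rowP => i; rewrite !mxE; ring.
    apply: (le_lt_trans (ler_normD _ _)); rewrite !normrZ (ger0_norm t0) ger0_norm ?subr_ge0//.
    have [->|tn0] := eqVneq t 0; first by rewrite subr0 mul1r mul0r addr0.
    have tp : 0 < t by rewrite lt_neqAle eq_sym tn0.
    have -> : r = (1 - t) * r + t * r by ring.
    apply: ler_ltD; last by rewrite ltr_pM2l.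
    by apply: ler_wpM2l; [rewrite subr_ge0|exact: ltW].
  have -> : w + t *: (v - w) - u = (1 - t) *: (w - u) + t *: (v - u).
    by apply/rowP => i; rewrite !mxE; ring.
  rewrite gl; have [->|tn0] := eqVneq t 0; first by rewrite subr0 mul0r mul1r addr0.
  have tp : 0 < t by rewrite lt_neqAle eq_sym tn0.
  by apply: ltr_wpDl; [apply: mulr_ge0; [rewrite subr_ge0|exact: ltW]|exact: mulr_gt0].
have l0 (a b : R) s t : c0 (a *: s + b *: t) = a * c0 s + b * c0 t by rewrite /c0 !mxE.
have l1 (a b : R) s t : c1 (a *: s + b *: t) = a * c1 s + b * c1 t by rewrite /c1 !mxE.
have n0 (a b : R) s t : - c0 (a *: s + b *: t) = a * - c0 s + b * - c0 t by rewrite l0; ring.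
have n1 (a b : R) s t : - c1 (a *: s + b *: t) = a * - c1 s + b * - c1 t by rewrite l1; ring.
have r2 : 0 < r / 2 by rewrite divr_gt0.
have pt (x y : R) : `|x| <= r / 2 -> `|y| <= r / 2 -> `|u - (u + (x *: b0 + y *: b1))| < r.
  move=> hx hy; rewrite opprD addrA subrr sub0r normrN.
  apply: (@le_lt_trans _ _ (r / 2)); last by rewrite ltr_pdivrMr// ltr_pMr// ltr1n.
  rewrite [leLHS]/Num.Def.normr/= mx_normrE; apply: bigmax_le; first exact: ltW.
  move=> [i j] _ /=; rewrite (ord1 i).
  by case: j => -[|[|//]] hj; rewrite /b0 /b1 !mxE /=
    ?(mulr1, mulr0, addr0, add0r).
have cc (x y : R) : u + (x *: b0 + y *: b1) - u = x *: b0 + y *: b1 by rewrite addrC addKr.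
have an : `|- (r / 2)| <= r / 2 by rewrite normrN gtr0_norm.
have ap : `|r / 2| <= r / 2 by rewrite gtr0_norm.
pose P1 := u + (r / 2 *: b0 + r / 2 *: b1); pose P2 := u + (- (r / 2) *: b0 + r / 2 *: b1).
pose P3 := u + (- (r / 2) *: b0 + - (r / 2) *: b1).
have -> : [set v : 'rV[R]_2 | `|u - v| < r /\ v <> u] =
   hp (@c0 R) `|` (hp (@c1 R) `|` (hp (fun h => - c0 h) `|` hp (fun h => - c1 h))).
  apply/seteqP; split=> v.
    move=> [vr vu]; rewrite /setU /hp /=.
    case: (ltrgt0P (c0 (v - u))) => h0; [by left|by right; right; left; rewrite oppr_gt0|].
    case: (ltrgt0P (c1 (v - u))) => h1; [by right; left|by right; right; right; rewrite oppr_gt0|].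
    by exfalso; apply: vu; apply/eqP; rewrite -subr_eq0 (rv2E (v - u)) h0 h1 !scale0r addr0.
  by move=> [|[|[|]]] [vr gv]; split=> // vu; move: gv; rewrite vu subrr /c0 /c1 !mxE ?oppr0 ltxx.
apply: connectedU; last first.
- apply: connectedU; last first.
  + apply: connectedU; last first.
    * by apply: (hpc _ P3) => //; split; [exact: pt|rewrite cc c1E opprK].
    * by apply: (hpc _ P3) => //; split; [exact: pt|rewrite cc c0E opprK].
    * by exists P3; split; (split; [exact: pt|rewrite cc ?c0E ?c1E opprK//]).
  + by apply: (hpc _ P2) => //; split; [exact: pt|rewrite cc c1E].
  + exists P2; split; first by split; [exact: pt|rewrite cc c1E].
    by left; split; [exact: pt|rewrite cc c0E opprK].
- by apply: (hpc _ P1) => //; split; [exact: pt|rewrite cc c0E].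
- exists P1; split; first by split; [exact: pt|rewrite cc c0E].
  by left; split; [exact: pt|rewrite cc c1E].
Qed.
End Balls.

Section Discs.
Variables (R : realType) (M : topologicalType) (A : set (chart R M)) (f N : M -> 'rV[R]_4).
Hypotheses (hM : C2_surface A) (hf : C2_immersion_S3 A f) (hN : unit_normal A f N).

(** A disc of a chart so small that the immersion is injective on it. *)
Lemma chart_disc x W : nbhs x W -> exists c u (r : R), [/\ A c, param c u = x, 0 < r,
  forall v, `|u - v| <= r -> cdom c v /\ W (param c v) &
  forall v w, `|u - v| <= r -> `|u - w| <= r -> f (param c v) = f (param c w) -> v = w].
Proof.
move=> nW; have [c [u [Ac cu xE]]] := chart_at hM x.
have nc := cdom_near hM Ac cu.
have nW' : \forall v \near u, W (param c v).
  have nW0 : nbhs (param c u) W by rewrite xE.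
  exact: (param_continuous hM Ac cu nW0).
have nd : \forall v \near u, differentiable (f \o param c) v.
  by apply: filterS nc => v; exact: (chart_diff hf Ac).
have cD b : {for u, continuous ('D_b (f \o param c))}.
  exact: (differentiable_continuous (chart_diff2 hf Ac b cu)).
have [r1 r10 H1] := immersion_locally_injective nd (cD b0) (cD b1) (chart_inj hf Ac cu).
have [r2 r20 H2] := (nbhs_eps _ _).1 (filterI nc nW').
have m0 : 0 < Num.min r1 r2 by rewrite lt_min r10.
have h v : `|u - v| <= Num.min r1 r2 / 2 -> `|u - v| < r1 /\ `|u - v| < r2.
  move=> hv; have : `|u - v| < Num.min r1 r2.
    by apply: (le_lt_trans hv); rewrite ltr_pdivrMr// ltr_pMr// ltr1n.
  by rewrite lt_min => /andP[].
exists c, u, (Num.min r1 r2 / 2); split => //; first by rewrite divr_gt0.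
- by move=> v /h[_ /H2].
- by move=> v w /h[v1 _] /h[w1 _]; exact: H1.
Qed.

(** On the boundary circle of a small disc the immersion avoids its value at the center. *)
Lemma trap_exists x W : nbhs x W -> exists K eta, trap f x K eta /\ K `<=` W.
Proof.
move=> nW; have [c [u [r [Ac xE r0 hcW hinj]]]] := chart_disc nW.
pose B := [set v : 'rV[R]_2 | `|u - v| <= r].
have cF v : B v -> {for v, continuous (f \o param c)}.
  by move=> /hcW[cv _]; exact: (differentiable_continuous (chart_diff hf Ac cv)).
have Bu : B u by rewrite /B /= subrr normr0 ltW.
have [||e e0 He] := @compact_avoid _ _ (f \o param c) _ (f x) (@compact_circle R u r).
- by move=> y [yr _]; exact: cF.
- move=> [v [v1 v2]]; rewrite -xE => /hinj => /(_ v1 Bu) vu.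
  by move: v2; rewrite vu subrr normr0 leNgt r0.
exists (param c @` B), e; split; last by move=> _ [v /hcW[_ Wv] <-].
split => //.
- apply: continuous_compact; last exact: compact_disc.
  apply: continuous_in_subspaceT => v; rewrite inE => /hcW[cv _].
  exact: (param_continuous hM Ac cv).
- by move=> _ _ [v Bv <-] [w Bw <-] /hinj => /(_ Bv Bw) ->.
- by exists u.
- move=> _ [v Bv <-] ve; have [cv _] := hcW v Bv.
  have vr : `|u - v| < r.
    rewrite ltNge; apply/negP => rv; have := He v (conj Bv rv); rewrite /= leNgt ve//.
  have nv : \forall w \near v, `|u - w| < r.
    apply/nbhs_eps; exists (r - `|u - v|); first by rewrite subr_gt0.
    move=> w vw; rewrite -(subrK v u) -addrA; apply: (le_lt_trans (ler_normD _ _)).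
    by rewrite -ltrBrDl.
  apply: filterS (near_param hM Ac cv nv) => y [_ yr yE].
  by rewrite -yE; exists (Defs.coord c y) => //; exact: ltW.
Qed.

Lemma punctured_nbhd x W : nbhs x W -> exists D : set M, [/\ D `<=` W, nbhs x D &
  connected (D `\ x)].
Proof.
move=> nW; have [c [u [r [Ac xE r0 hcW hinj]]]] := chart_disc nW.
have Bu : `|u - u| <= r by rewrite subrr normr0 ltW.
have [cu _] := hcW u Bu.
exists (param c @` [set v | `|u - v| < r]); split.
- by move=> _ [v /= vr <-]; have [] := hcW v (ltW vr).
- have nv : \forall w \near u, `|u - w| < r by apply/nbhs_eps; exists r.
  have := near_param hM Ac cu nv; rewrite xE; apply: filterS => y [_ yr yE].
  by rewrite -yE; exists (Defs.coord c y).
- have -> : (param c @` [set v | `|u - v| < r]) `\ x =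
     param c @` [set v : 'rV[R]_2 | `|u - v| < r /\ v <> u].
    apply/seteqP; split=> y.
      move=> [[v vr <-] vx]; exists v => //; split => // vu.
      by apply: vx; rewrite vu.
    move=> [v [vr vu] <-]; split; first by exists v.
    by move=> /= E; apply: vu; apply: (hinj v u (ltW vr) Bu); rewrite E xE.
  apply: connected_continuous_connected; first exact: punctured_disc_connected.
  apply: continuous_in_subspaceT => v; rewrite inE => -[vr _].
  have [cv _] := hcW v (ltW vr); exact: (param_continuous hM Ac cv).
Qed.
End Discs.

(** * The characteristic field *)

Section RealInductionClosed.
Variable R : realType.
(** The same principle when the property is only known to be closed and to extend to the right. *)
Lemma real_induction_closed (A : R -> Prop) (b : R) : 0 <= b -> A 0 ->
  (forall t, 0 < t <= b -> (forall s, 0 <= s < t -> A s) -> A t) ->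
  (forall t, 0 <= t < b -> A t -> exists2 e, 0 < e & forall s, t <= s < t + e -> s <= b -> A s) ->
  A b.
Proof.
move=> b0 A0 Hc Ho; pose S := [set t : R | 0 <= t <= b /\ forall s, 0 <= s <= t -> A s].
have S0 : S 0.
  split; first by rewrite lexx b0.
  by move=> s s0; have -> : s = 0 by apply: le_anti; rewrite andbC.
have hs : has_sup S by split; [exists 0|exists b => x [/andP[]]].
have sS t : S t -> t <= sup S by move=> St; apply: ub_le_sup => //; case: hs.
have s0 : 0 <= sup S by exact: sS.
have sb : sup S <= b by apply: ge_sup; [exists 0|move=> x [/andP[]]].
have As s : 0 <= s < sup S -> A s.
  move=> /andP[s00 ss]; have [t [_ Ht] st] := sup_gt (ex_intro _ 0 S0 : S !=set0) ss.
  by apply: Ht; rewrite s00 ltW.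
have At : A (sup S).
  by move: s0; rewrite le_eqVlt => /orP[/eqP <- //|sp]; apply: Hc; rewrite ?sp ?sb.
move: sb; rewrite le_eqVlt => /orP[/eqP <- //|sb].
have [|e e0 He] := Ho (sup S) _ At; first by rewrite s0 sb.
pose t := Num.min b (sup S + e / 2).
have te : t < sup S + e.
  rewrite /t gt_min; apply/orP; right; rewrite ltrD2l; lra.
have st : sup S < t by rewrite /t lt_min sb ltrDl divr_gt0.
have tb : t <= b by rewrite /t ge_min lexx.
have : S t.
  split; first by rewrite tb (le_trans s0 (ltW st)).
  move=> s /andP[s00 s1]; have [ss|ss] := ltP s (sup S); first by apply: As; rewrite s00 ss.
  by apply: He; [rewrite ss (le_lt_trans s1 te)|exact: le_trans s1 tb].
by move=> /sS; rewrite leNgt st.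
Qed.
End RealInductionClosed.

Section FlowContinuity.
Variables (R : realType) (lam : R).
Implicit Types (q e : 'rV[R]_4).

Let dcont (g : R -> R) (dg : R -> R) : (forall s : R, is_derive s 1 g (dg s)) -> continuous g.
Proof. by move=> h s; apply/differentiable_continuous/derivable1_diffP; case: (h s). Qed.

Lemma coefs_continuous : [/\ continuous (fal lam), continuous (fbe lam), continuous (fmu lam),
  continuous (fnu lam) & continuous (fk1 lam) /\ continuous (fk2 lam)].
Proof.
split; [exact: (dcont (is_derive_fal lam))|exact: (dcont (is_derive_fbe lam))
 |exact: (dcont (is_derive_fmu lam))|exact: (dcont (is_derive_fnu lam))|].
by split; [exact: (dcont (is_derive_fk1 lam))|exact: (dcont (is_derive_fk2 lam))].
Qed.

Lemma cvg_flow (T : Type) (Fl : set_system T) {FF : Filter Fl} (q e : T -> 'rV[R]_4)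
    (s : T -> R) q0 e0 s0 : q @ Fl --> q0 -> e @ Fl --> e0 -> s @ Fl --> s0 ->
  (fun y => geo lam (q y) (e y) (s y)) @ Fl --> geo lam q0 e0 s0 /\
  (fun y => dgeo lam (q y) (e y) (s y)) @ Fl --> dgeo lam q0 e0 s0.
Proof.
move=> hq he hs; have [ca cb cm cn [ck1 ck2]] := coefs_continuous.
have cc (g : R -> R) : continuous g -> (fun y => g (s y)) @ Fl --> g s0.
  by move=> cg; apply: (cvg_comp s g hs); exact: cg.
have hq' : (fun y => Vfield (q y)) @ Fl --> Vfield q0 by exact: cvg_V.
have he' : (fun y => Vfield (e y)) @ Fl --> Vfield e0 by exact: cvg_V.
by split; [exact (cvgD (cvgD (cvgD (cvgZ (cc _ ca) hq) (cvgZ (cc _ cb) hq')) (cvgZ (cc _ cm) he))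
    (cvgZ (cc _ cn) he'))|exact (cvgD (cvgD (cvgD (cvgZ (cvgN (cc _ cm)) hq)
    (cvgZ (cvgN (cc _ cn)) hq')) (cvgZ (cc _ ck1) he)) (cvgZ (cc _ ck2) he'))].
Qed.

Lemma geo_lip q e s t : unitary_pair (q, e) -> `|geo lam q e s - geo lam q e t| <= `|s - t|.
Proof.
move=> U; wlog st : s t / t <= s.
  move=> h; have [/h//|ts] := leP t s.
  by rewrite distrC (distrC s); apply: h; exact: ltW.
rewrite (ger0_norm (x := s - t)) ?subr_ge0//.
move: st; rewrite le_eqVlt => /orP[/eqP ->|st]; first by rewrite !subrr normr0.
apply: (le_trans (norm_le_enorm _)).
pose w := geo lam q e s - geo lam q e t.
have [x xx|c cc E] := @MVT_derive R (fun x => dot (geo lam q e x) w)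
   (fun x => dot (dgeo lam q e x) w) t s st.
  apply: (is_derive_eq (is_derive_dot (is_derive_geo lam q e x) (is_derive_cst w x 1))).
  by rewrite dot0r addr0.
have e1 : enorm (dgeo lam q e c) = 1 by apply: enorm1; case: (unitary_Phi lam c U).
have : enorm w ^+ 2 <= enorm w * (s - t).
  rewrite enorm_sqr {1}/w dotDl dotNl E ler_pM2r ?subr_gt0//.
  by apply: (le_trans (ler_norm _)); rewrite -[leRHS]mul1r -e1 dot_le_enorm.
rewrite -/w expr2; have := enorm_ge0 w; rewrite le_eqVlt => /orP[/eqP <- _|w0].
  by rewrite subr_ge0 ltW.
by rewrite ler_pM2l.
Qed.
End FlowContinuity.

(** The unit tangent horizontal field, whose integral curves are the characteristic curves. *)
Definition char_field (R : realType) (M : topologicalType) (f N : M -> 'rV[R]_4) x :=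
  Vfield (nuh f N x).
(** The lift of the surface to the pairs (point, velocity), on which the flow acts. *)
Definition state (R : realType) (M : topologicalType) (f N : M -> 'rV[R]_4) x :=
  (f x, char_field f N x).

Section Regular.
Variables (R : realType) (M : topologicalType) (A : set (chart R M)) (f N : M -> 'rV[R]_4).
Hypotheses (hM : C2_surface A) (hf : C2_immersion_S3 A f) (hN : unit_normal A f N).
Local Notation Z := (char_field f N).
Local Notation nu := (nuh f N).
Local Notation st := (state f N).
Local Notation reg x := (Nh f N x != 0).

Lemma Nh_perp x : dot (Nh f N x) (f x) = 0 /\ dot (Nh f N x) (Vfield (f x)) = 0.
Proof.
rewrite /Nh; have := normal_tangent hN x; have := sphere hf x.
move: (N x) (f x) => n p pp np; rewrite !dotl dotV0' dotVV pp np; split; ring.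
Qed.

Lemma nuh_scale x : reg x -> Nh f N x = enorm (Nh f N x) *: nu x.
Proof. by move=> rx; rewrite /nuh scalerA divff ?scale1r// gt_eqF// enorm_gt0. Qed.

Lemma nuh_perp x : dot (nu x) (f x) = 0 /\ dot (nu x) (Vfield (f x)) = 0.
Proof. by rewrite /nuh !dotZl; have [-> ->] := Nh_perp x; rewrite mulr0. Qed.

Lemma nuh_unit x : reg x -> dot (nu x) (nu x) = 1.
Proof.
move=> rx; rewrite /nuh dotZl dotZr -enorm_sqr; have := enorm_gt0 rx.
by move: (enorm _) => k k0; field; rewrite gt_eqF.
Qed.

Lemma state_unitary x : reg x -> unitary_pair (st x).
Proof.
move=> rx; have [h1 h2] := nuh_perp x; split => /=.
- exact: (sphere hf).
- by rewrite dotVV nuh_unit.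
- by rewrite dotVl h2 oppr0.
- by rewrite dotVV h1.
Qed.

Lemma char_field_tangent x : dot (Z x) (N x) = 0.
Proof.
have [h1 h2] := nuh_perp x.
have -> : N x = Nh f N x + dot (N x) (Vfield (f x)) *: Vfield (f x) by rewrite /Nh subrK.
rewrite dotDr dotZr /char_field dotVV h1 mulr0 addr0 /nuh VfieldZ dotZl.
by rewrite dotV0' mulr0.
Qed.

Lemma normal_continuous : continuous N. Proof. by case: hN. Qed.

Lemma Nh_continuous : continuous (Nh f N).
Proof.
move=> x; have cf := immersion_continuous hM hf (x := x); have cN := @normal_continuous x.
have cV := continuous_V cf.
exact (cvgB cN (cvgZ (continuous_dot cN cV) cV)).
Qed.

Lemma reg_near x : reg x -> \forall y \near x, reg y.
Proof.
move=> rx; have e0 : 0 < `|Nh f N x| by rewrite normr_gt0.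
have n : nbhs (Nh f N x) (fun z => `|Nh f N x - z| < `|Nh f N x|).
  by apply/nbhs_eps; exists `|Nh f N x|.
have n' : \forall y \near x, `|Nh f N x - Nh f N y| < `|Nh f N x| by exact: (@Nh_continuous x _ n).
by apply: filterS n' => y; apply: contraTneq => ->; rewrite subr0 ltxx.
Qed.

Lemma enorm_continuous (T : topologicalType) (F : T -> 'rV[R]_4) x :
  {for x, continuous F} -> {for x, continuous (fun y => enorm (F y))}.
Proof.
move=> cF; exact: (continuous_comp (continuous_dot cF cF) (@sqrt_continuous R _)).
Qed.

Lemma char_field_continuous x : reg x -> {for x, continuous Z}.
Proof.
move=> rx; apply: continuous_V; have cN := @Nh_continuous x.
have e0 : enorm (Nh f N x) != 0 by rewrite gt_eqF// enorm_gt0.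
exact (cvgZ (cvgV e0 (enorm_continuous cN)) cN).
Qed.

Lemma Nh_differentiable c u : A c -> cdom c u -> differentiable (Nh f N \o param c) u.
Proof.
move=> Ac cu; have dF := chart_diff hf Ac cu; have dN := normal_differentiable hM hf hN Ac cu.
have dV := differentiable_V dF.
have -> : Nh f N \o param c = (N \o param c) - (fun v =>
   dot ((N \o param c) v) (Vfield ((f \o param c) v)) *: Vfield ((f \o param c) v)) by [].
apply: differentiableB => //; apply: differentiable_scale => //; exact: differentiable_dot.
Qed.

Lemma nuh_differentiable c u : A c -> cdom c u -> reg (param c u) ->
  differentiable (nu \o param c) u.
Proof.
move=> Ac cu rx; exact: (differentiable_unit (F := Nh f N \o param c) rx (Nh_differentiable Ac cu)).
Qed.

Lemma is_derive_diff (V W : normedModType R) (F : V -> W) u a :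
  differentiable F u -> is_derive u a F ('d F u a).
Proof. by move=> dF; rewrite -deriveE//; exact/derivableP/diff_derivable. Qed.

(** Constant mean curvature says that the characteristic field is parallel, up
    to the term of curvature H, along itself; the other direction of the
    tangent plane does not contribute to the divergence of the horizontal normal. *)
Lemma char_field_derivative (H : R) c u : A c -> cdom c u -> reg (param c u) ->
  has_mean_curvature A f N (param c u) H ->
  exists2 a, 'd (f \o param c) u a = Z (param c u) &
    'd (Z \o param c) u a = - f (param c u) - (2 * H) *: Vfield (Z (param c u)).
Proof.
move=> Ac cu rx hH; set x := param c u in rx hH *.
have [up1 up2 up3 up4] := state_unitary rx; rewrite /= in up1 up2 up3 up4.
have [a aE] : exists a, 'd (f \o param c) u a = Z x.
  by apply: (tangent_surj hf hN Ac cu) => //; exact: char_field_tangent.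
pose n := dot (N x) (Vfield (f x)); pose h := enorm (Nh f N x).
pose S := n *: nu x - h *: Vfield (f x).
have [np nVp] := nuh_perp x; have nn := nuh_unit rx.
have NE : N x = h *: nu x + n *: Vfield (f x) by rewrite -nuh_scale// /Nh subrK.
have pp := sphere hf x.
have pV : dot (Vfield (f x)) (nu x) = 0 by rewrite dotC.
have hn1 : h ^+ 2 + n ^+ 2 = 1.
  have := normal_unit hN x; rewrite {1 2}NE => <-.
  rewrite dot_lincomb nn nVp pV dotVV pp; ring.
have SS : dot S S = 1.
  rewrite -hn1 /S -scaleNr dot_lincomb nn nVp pV dotVV pp; ring.
have SN : dot S (N x) = 0.
  rewrite NE /S -scaleNr dot_lincomb nn nVp pV dotVV pp; ring.
have Sp : dot S (f x) = 0.
  rewrite /S; move: np; move: (nu x) (f x) => v w vw.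
  by rewrite dotDl dotNl !dotZl vw dotV0' !mulr0 subr0.
have SZ : dot (Z x) S = 0.
  rewrite /S /char_field; move: np; move: (nu x) (f x) => v w vw.
  by rewrite dotDr dotNr !dotZr dotVV dotV0' vw !mulr0 subr0.
have [b bE] : exists b, 'd (f \o param c) u b = S by apply: (tangent_surj hf hN Ac cu).
have dF := chart_diff hf Ac cu; have dW := nuh_differentiable Ac cu rx.
have div : - 2 * H = dot ('d (nu \o param c) u a) (Z x) + dot ('d (nu \o param c) u b) S.
  have Hd ea eb : 'd (f \o param c) u a = ea -> 'd (f \o param c) u b = eb ->
     dot ea ea = 1 -> dot eb eb = 1 -> dot ea eb = 0 ->
     - 2 * H = dot (tproj (f x) ('d (nu \o param c) u a)) ea +
               dot (tproj (f x) ('d (nu \o param c) u b)) eb.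
    by move=> <- <-; exact: (hH c u a b Ac cu erefl).
  have tp w v : dot v (f x) = 0 -> dot (tproj (f x) w) v = dot w v.
    by rewrite /tproj dotC => E; rewrite dotDl dotNl dotZl E mulr0 subr0.
  by rewrite (Hd _ _ aE bE up2 SS SZ) !tp.
have nr : \forall v \near u, reg (param c v).
  exact: (param_continuous hM Ac cu (reg_near rx)).
have E1 w : dot ('d (nu \o param c) u w) (nu x) = 0.
  have D := is_derive_diff w dW.
  have nE : \forall v \near u, dot ((nu \o param c) v) ((nu \o param c) v) = 1.
    by apply: filterS nr => v; exact: nuh_unit.
  have := near_cst_is_derive nE (is_derive_dot D D).
  rewrite (dotC ((nu \o param c) u)) => E; have E' : forall y : R, y + y = 0 -> y = 0 by move=> y; lra.
  exact: E' E.
have E2 w : dot ('d (nu \o param c) u w) (f x) = - dot (nu x) ('d (f \o param c) u w).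
  have nE : \forall v \near u, dot ((nu \o param c) v) ((f \o param c) v) = 0.
    exact: (@filterE _ (nbhs u) _ _ (fun v => (nuh_perp (param c v)).1)).
  have := near_cst_is_derive nE (is_derive_dot (is_derive_diff w dW) (is_derive_diff w dF)).
  by move/eqP; rewrite addr_eq0 => /eqP.
have E3 w : dot ('d (nu \o param c) u w) (Vfield (f x)) =
    - dot (nu x) (Vfield ('d (f \o param c) u w)).
  have nE : \forall v \near u, dot ((nu \o param c) v) (Vfield ((f \o param c) v)) = 0.
    exact: (@filterE _ (nbhs u) _ _ (fun v => (nuh_perp (param c v)).2)).
  have := near_cst_is_derive nE (is_derive_dot (is_derive_diff w dW) (is_derive_V (is_derive_diff w dF))).
  by move/eqP; rewrite addr_eq0 => /eqP.
exists a => //.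
have -> : 'd (Z \o param c) u a = Vfield ('d (nu \o param c) u a).
  have dZ : differentiable (Z \o param c) u by exact: differentiable_V dW.
  exact (etrans (esym (deriveE a dZ))
    (@derive_val _ _ _ _ _ _ _ (is_derive_V (is_derive_diff a dW)))).
have Db : dot ('d (nu \o param c) u b) S = 0.
  have E3b : dot ('d (nu \o param c) u b) (Vfield (f x)) = - dot (nu x) (Vfield S).
    exact (etrans (E3 b) (congr1 (fun w => - dot (nu x) (Vfield w)) bE)).
  have E1b := E1 b; move: np E1b E3b; rewrite /S; clear E1 E2 E3 div.
  move: ('d (nu \o param c) u b) (nu x) (f x) => y v w vw yv.
  move=> yV; rewrite dotDr dotNr !dotZr yv yV VfieldD VfieldN !VfieldZ VfieldK dotDr dotNr !dotZr dotNr vw dotV0.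
  ring.
rewrite Db addr0 in div.
have {E1} E1 := E1 a.
have {E2} E2 := etrans (E2 a) (congr1 (fun w => - dot (nu x) w) aE).
have {E3} E3 := etrans (E3 a) (congr1 (fun w => - dot (nu x) (Vfield w)) aE).
move: div E1 E2 E3; move: ('d (nu \o param c) u a) => w div E1 E2 E3.
rewrite (unitary_expand (Vfield w) up1 up2 up3 up4).
have -> : dot (Vfield w) (f x) = -1.
  by rewrite dotVl E3 /char_field VfieldK dotNr nn opprK.
have -> : dot (Vfield w) (Vfield (f x)) = 0.
  by rewrite dotVV E2 /char_field dotV0 oppr0.
have -> : dot (Vfield w) (Z x) = 0 by rewrite /char_field dotVV.
have -> : dot (Vfield w) (Vfield (Z x)) = - 2 * H by rewrite dotVV.
by rewrite !scale0r !addr0 scaleN1r -scaleNr mulNr.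
Qed.
End Regular.

(** * Invariance of a tangent surface under a flow *)

(** The linear part of the equation is skew-symmetric for this energy. *)
Lemma skew_energy (R : realType) (lam kap : R) (X Y : R -> 'rV[R]_4) :
  is_derive (0 : R) 1 X (kap *: Y 0) ->
  is_derive (0 : R) 1 Y (kap *: (- X 0 - (2 * lam) *: Vfield (Y 0))) ->
  is_derive (0 : R) 1 (fun h => dot (X h) (X h) + dot (Y h) (Y h)) 0.
Proof.
move=> hX hY; apply: (is_derive_eq (is_deriveD (is_derive_dot hX hX) (is_derive_dot hY hY))).
move: (X 0) (Y 0) => x y; rewrite !dotl dotV0 dotV0' (dotC y x); ring.
Qed.

Section Nagumo.
Variables (R : realType) (lam kap : R) (B : set 'rV[R]_2) (F Z : 'rV[R]_2 -> 'rV[R]_4).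
Variables (v0 : 'rV[R]_2) (b d : R).
Hypotheses (cB : compact B) (Bv0 : B v0) (b0 : 0 < b) (d0 : 0 < d).
Hypotheses (cF : forall v, B v -> {for v, continuous F}) (cZ : forall v, B v -> {for v, continuous Z}).
Local Notation G t := (geo lam (F v0) (Z v0) (kap * t)).
Local Notation dG t := (dgeo lam (F v0) (Z v0) (kap * t)).
Hypothesis tangency : forall v t, B v -> 0 <= t <= b -> `|G t - F v| <= d ->
  [/\ nbhs v B, differentiable F v, differentiable Z v &
   exists2 a, 'd F v a = Z v & 'd Z v a = - F v - (2 * lam) *: Vfield (Z v)].

Let sq t v := dot (G t - F v) (G t - F v) + dot (dG t - Z v) (dG t - Z v).

Let sq_cvg (T : Type) (Fl : set_system T) {FF : Filter Fl} (s : T -> R) (w : T -> 'rV[R]_2) t v :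
  B v -> s @ Fl --> t -> w @ Fl --> v -> (fun y => sq (s y) (w y)) @ Fl --> sq t v.
Proof.
move=> Bv hs hw.
have hk : (fun y => kap * s y) @ Fl --> kap * t by exact (cvgM (cvg_cst kap) hs).
have [g1 g2] := @cvg_flow R lam T Fl FF (fun=> F v0) (fun=> Z v0) (fun y => kap * s y)
   (F v0) (Z v0) (kap * t) (cvg_cst _) (cvg_cst _) hk.
have f1 : (fun y => F (w y)) @ Fl --> F v by exact (cvg_comp w F hw (cF Bv)).
have f2 : (fun y => Z (w y)) @ Fl --> Z v by exact (cvg_comp w Z hw (cZ Bv)).
exact (cvgD (cvg_dot (cvgB g1 f1) (cvgB g1 f1)) (cvg_dot (cvgB g2 f2) (cvgB g2 f2))).
Qed.

(** The derivative at h = 0 of the squared distance between the flow line and a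
    curve of the surface with the same velocity field vanishes, since the
    generator of the flow is skew-symmetric. *)
Let sq_move t v a : differentiable F v -> differentiable Z v -> 'd F v a = Z v ->
  'd Z v a = - F v - (2 * lam) *: Vfield (Z v) ->
  is_derive (0 : R) 1 (fun h => sq (t + h) (v + h *: (kap *: a))) 0.
Proof.
move=> dF dZ Fa Za.
have dv (g : 'rV[R]_2 -> 'rV[R]_4) w : differentiable g v -> 'd g v a = w ->
   is_derive (0 : R) 1 (fun h : R => g (v + h *: (kap *: a))) (kap *: w).
  move=> dg <-; have := @is_derive_line R _ _ g v (kap *: a) 0.
  by rewrite scale0r addr0 linearZ => /(_ dg).
have hk : is_derive (0 : R) 1 (fun h : R => kap * (t + h)) kap.
  apply: (is_derive_eq (is_deriveZ kap (is_deriveD (is_derive_cst t (0 : R) 1) (is_derive_id (0 : R) 1)))).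
  by rewrite add0r /GRing.scale/= mulr1.
have comp (g dg : R -> 'rV[R]_4) : (forall s : R, is_derive s 1 g (dg s)) ->
   is_derive (0 : R) 1 (fun h : R => g (kap * (t + h))) (kap *: dg (kap * t)).
  move=> hg; apply: is_derive_rv4 => k _; have hgk := is_derive_crd k (hg (kap * (t + 0))).
  apply: (is_derive_eq (@is_derive1_comp _ (fun y => crd (g y) k) (fun h => kap * (t + h)) _ _ _ hgk hk)).
  by rewrite addr0 crdZ /GRing.scale/= mulrC.
have A1 := comp _ _ (is_derive_geo lam (F v0) (Z v0)).
have A2 := comp _ (fun s => - geo lam (F v0) (Z v0) s - (2 * lam) *: Vfield (dgeo lam (F v0) (Z v0) s))
   (is_derive_dgeo lam (F v0) (Z v0)).
have B1 := is_deriveB A1 (dv F _ dF Fa); have B2 := is_deriveB A2 (dv Z _ dZ Za).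
have t00 : t + 0 = t by rewrite addr0.
have v00 : v + (0 : R) *: (kap *: a) = v by rewrite scale0r addr0.
apply: (@skew_energy R lam kap (fun h => G (t + h) - F (v + h *: (kap *: a))) (fun h => dG (t + h) - Z (v + h *: (kap *: a)))).
  apply: (is_derive_eq B1); cbv beta; rewrite t00 v00.
  by move: (Z v) (dgeo _ _ _ _) => e w; rewrite scalerBr.
apply: (is_derive_eq B2); cbv beta; rewrite t00 v00.
move: (F v) (Z v) (geo _ _ _ _) (dgeo _ _ _ _) => p e q w.
rewrite -scalerBr; congr (_ *: _).
by rewrite !Vl; apply: rv4P; rewrite !crdE; ring.
Qed.

(** Invariance of a surface under a flow to which it is tangent: the set of times
    at which the flow line is within (eta t)^(1/2) of the surface is closed
    and open to the right, for every eta. *)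
Lemma nagumo t : 0 <= t <= b -> exists2 v, B v & F v = G t /\ Z v = dG t.
Proof.
move=> /andP[t0 tb].
have near_t eta s : 0 < eta -> eta * b <= d ^+ 2 -> 0 <= s <= b ->
    exists2 v, B v & sq s v <= eta * s.
  move=> eta0 etab /andP[s0 sb].
  apply: (@real_induction_closed R (fun s => exists2 v, B v & sq s v <= eta * s) s s0).
  - exists v0 => //; rewrite /sq !mulr0 geo0 dgeo0 !subrr dot0l addr0//.
  - move=> x /andP[x0 xs] H; apply: contrapT => nA.
    have pos v : B v -> 0 < sq x v - eta * x.
      by move=> Bv; rewrite subr_gt0 ltNge; apply/negP => h; apply: nA; exists v.
    have nc := (compact_near_coveringP B).1 cB.
    have := nc R (nbhs x) (fun s v => 0 < sq s v - eta * s) _ _.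
    case=> [v Bv|e /= e0 He].
      have L : (fun p : 'rV[R]_2 * R => sq p.2 p.1 - eta * p.2) @ filter_prod (nbhs v) (nbhs x)
          --> sq x v - eta * x.
        have c1 : (fun p : 'rV[R]_2 * R => p.2) @ filter_prod (nbhs v) (nbhs x) --> x by exact: cvg_snd.
        have c2 : (fun p : 'rV[R]_2 * R => p.1) @ filter_prod (nbhs v) (nbhs x) --> v by exact: cvg_fst.
        exact (cvgB (sq_cvg Bv c1 c2) (cvgM (cvg_cst eta) c1)).
      exact: (@cvgr_gt _ _ _ _ _ _ L 0 (pos v Bv)).
    pose y := Num.max 0 (x - e / 2).
    have yx : y < x by rewrite /y gt_max x0 ltrBlDr ltrDl divr_gt0.
    have y0 : 0 <= y by rewrite /y le_max lexx.
    have [v Bv] := H y (introT andP (conj y0 yx)).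
    have xy : `|x - y| < e.
      rewrite gtr0_norm ?subr_gt0// ltrBlDl -ltrBlDr (@lt_le_trans _ _ (x - e / 2))//.
        by rewrite ltrD2l ltrN2 ltr_pdivrMr// ltr_pMr// ltr1n.
      by rewrite /y le_max lexx orbT.
    have /(_ v Bv) := He y xy; rewrite subr_gt0 => h1 h2.
    by have := lt_le_trans h1 h2; rewrite ltxx.
  - move=> x /andP[x0 xs] [v Bv hv].
    have xb : x <= b by rewrite ltW// (lt_le_trans xs).
    have close : `|G x - F v| <= d.
      apply: (le_trans (norm_le_enorm _)).
      have d0' : 0 <= d by exact: ltW.
      rewrite -(@ler_pXn2r _ 2)// ?nnegrE ?enorm_ge0// enorm_sqr.
      apply: (@le_trans _ _ (sq x v)); first by rewrite /sq lerDl dot_ge0.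
      apply: (le_trans hv); apply: le_trans etab.
      by rewrite ler_pM2l// ltW// (lt_le_trans xs).
    have [nB dF dZ [a Fa Za]] := tangency Bv (introT andP (conj x0 xb)) close.
    have D := sq_move x dF dZ Fa Za.
    have D' : differentiable (fun h => sq (x + h) (v + h *: (kap *: a))) (0 : R).
      by apply/derivable1_diffP; case: D.
    have D0 : 'd (fun h => sq (x + h) (v + h *: (kap *: a))) (0 : R) 1 = 0.
      exact (etrans (esym (deriveE _ D')) (@derive_val _ _ _ _ _ _ _ D)).
    have [e1 e10 He1] := diff_eps D' eta0.
    have cv : (fun h : R => v + h *: (kap *: a)) @ (0 : R) --> v.
      rewrite -[X in _ --> X]addr0 -[in X in _ --> X](scale0r (kap *: a)).
      exact (cvgD (cvg_cst v) (@scalel_continuous _ _ (kap *: a) (0 : R))).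
    have n2 : \forall h \near (0 : R), B (v + h *: (kap *: a)) by exact: (cv _ nB).
    have [e2 e20 He2] := (nbhs_eps _ _).1 n2.
    exists (Num.min e1 e2); first by rewrite lt_min e10.
    move=> y /andP[xy ye] ys; pose h := y - x.
    have h0 : 0 <= h by rewrite subr_ge0.
    have : h < Num.min e1 e2 by rewrite ltrBlDl.
    rewrite lt_min => /andP[h1 h2].
    exists (v + h *: (kap *: a)); first by apply: He2; rewrite sub0r normrN ger0_norm.
    have := He1 h; rewrite ger0_norm// => /(_ h1).
    have -> : 'd (fun h => sq (x + h) (v + h *: (kap *: a))) (0 : R) h = 0.
      have hE : h = h *: (1 : R) by rewrite /GRing.scale/= mulr1.
      by rewrite {1}hE linearZ D0; exact: mulr0.
    rewrite subr0 add0r !addr0 scale0r addr0 => /ler_normlW.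
    have -> : x + h = y by rewrite /h addrC subrK.
    rewrite lerBlDr => /le_trans; apply.
    apply: (le_trans (lerD (lexx _) hv)); rewrite -mulrDr /h subrK//.
have tt : 0 <= t <= b by rewrite t0 tb.
have B0 : B !=set0 by exists v0.
have cs : {within B, continuous (sq t)}.
  apply: continuous_in_subspaceT => v; rewrite inE => Bv.
  exact: (sq_cvg Bv (cvg_cst t) (@cvg_id _ (nbhs v))).
have [v + Hv] := compact_EVT_min B0 cB cs; rewrite inE => Bv.
have m0 : sq t v <= 0.
  rewrite leNgt; apply/negP => m0.
  pose eta := Num.min (d ^+ 2 / b) (sq t v / (2 * b)).
  have eta0 : 0 < eta by rewrite /eta lt_min !divr_gt0 ?exprn_gt0// mulr_gt0.
  have etab : eta * b <= d ^+ 2.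
    by rewrite -ler_pdivlMr// /eta ge_min lexx.
  have [w Bw hw] := near_t eta t eta0 etab tt.
  have := Hv w; rewrite inE => /(_ Bw) h1; have h2 := le_trans h1 hw.
  have h3 : eta * t <= sq t v / 2.
    apply: (@le_trans _ _ (eta * b)); first by rewrite ler_pM2l.
    rewrite -ler_pdivlMr// /eta ge_min; apply/orP; right.
    by rewrite le_eqVlt; apply/orP; left; apply/eqP; move: (sq t v) => y; field; rewrite gt_eqF.
  have := le_trans h2 h3; lra.
have := dot_ge0 (G t - F v); have := dot_ge0 (dG t - Z v).
move: m0; rewrite /sq => h1 h2 h3.
exists v => //; split; apply/eqP; rewrite eq_sym -subr_eq0; apply/eqP; apply: dot_eq0; lra.
Qed.
End Nagumo.

(** * Flow boxes *)

Section FlowBox.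
Variables (R : realType) (M : topologicalType) (A : set (chart R M)) (f N : M -> 'rV[R]_4).
Hypotheses (hM : C2_surface A) (hf : C2_immersion_S3 A f) (hN : unit_normal A f N).
Variable H : R.
Local Notation Z := (char_field f N).
Local Notation st := (state f N).
Local Notation reg x := (Nh f N x != 0).
Hypothesis hH : forall x, reg x -> has_mean_curvature A f N x H.

Definition injective_on K := forall y z, K y -> K z -> f y = f z -> y = z.

(** The geodesics have unit speed, so those starting close to x do not reach the boundary of a
    small disc for a uniform time; until then [nagumo] keeps them in the surface. *)
Lemma flow_box x W : reg x -> nbhs x W -> exists (e : R) (K U : set M),
  [/\ 0 < e, compact K /\ injective_on K, forall y, K y -> W y /\ reg y,
   nbhs x U /\ U `<=` K &
   forall y s, U y -> `|s| <= e -> exists2 y', K y' & st y' = Phi H s (st y)].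
Proof.
move=> rx nW.
have nWr : nbhs x (W `&` [set y | reg y]) by exact: filterI nW (reg_near hM hf hN rx).
have [c [u [r [Ac xE r0 hcW hinj]]]] := chart_disc hM hf nWr.
pose B := [set v : 'rV[R]_2 | `|u - v| <= r].
have cF v : B v -> {for v, continuous (f \o param c)}.
  by move=> /hcW[cv _]; exact: (differentiable_continuous (chart_diff hf Ac cv)).
have cZ v : B v -> {for v, continuous (Z \o param c)}.
  move=> /hcW[cv [_ rv]]; exact: (continuous_comp (param_continuous hM Ac cv)
    (char_field_continuous hM hf hN rv)).
have Bu : B u by rewrite /B /= subrr normr0 ltW.
have [||dl dl0 Hdl] := @compact_avoid _ _ (f \o param c) _ (f x) (@compact_circle R u r).
- by move=> y [yr _]; exact: cF.
- move=> [v [v1 v2]]; rewrite -xE => /hinj => /(_ v1 Bu) vu.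
  by move: v2; rewrite vu subrr normr0 leNgt r0.
have d3 : 0 < dl / 3 by rewrite divr_gt0.
have [cu _] := hcW u Bu.
exists (dl / 3), (param c @` B), [set y | exists v, [/\ `|u - v| < r, param c v = y &
   `|f y - f x| < dl / 3]]; split => //.
- split; last by move=> _ _ [v Bv <-] [w Bw <-] /hinj => /(_ Bv Bw) ->.
  apply: continuous_compact; last exact: compact_disc.
  apply: continuous_in_subspaceT => v; rewrite inE => /hcW[cv _].
  exact: (param_continuous hM Ac cv).
- by move=> _ [v /hcW[_ [Wv rv]] <-].
- split; last by move=> _ [v [/ltW vr <- _]]; exists v.
  have nv : \forall w \near u, `|u - w| < r by apply/nbhs_eps; exists r.
  have n1 := near_param hM Ac cu nv; rewrite xE in n1.
  have n2 : \forall y \near x, `|f y - f x| < dl / 3.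
    have nn : nbhs (f x) (fun z => `|z - f x| < dl / 3).
      by apply/nbhs_eps; exists (dl / 3) => // y; rewrite distrC.
    exact: (immersion_continuous hM hf nn).
  by apply: filterS2 n1 n2 => y [_ yr yE] ye; exists (Defs.coord c y).
move=> _ s [v0 [v0r <- v0x]] se.
have [cv0 [_ rv0]] := hcW v0 (ltW v0r).
pose kap : R := Num.sg s.
have ks : kap * `|s| = s by rewrite -numEsg.
have kap1 : `|kap| <= 1 by rewrite /kap normr_sg; case: (s != 0).
have [||v Bv [Fv Zv]] := @nagumo R H kap B (f \o param c) (Z \o param c) v0 (dl / 3) (dl / 3)
   (@compact_disc R u r) (ltW v0r) d3 d3 cF cZ _ `|s|; last first.
- exists (param c v); first by exists v.
  by rewrite /state /Phi /= -[X in geo _ _ _ X]ks -[X in dgeo _ _ _ X]ks; congr pair.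
- by rewrite normr_ge0.
move=> v t Bv /andP[t0 td] Gv.
have [cv [_ rv]] := hcW v Bv.
have U := state_unitary hf hN rv0.
have h1 : `|geo H (f (param c v0)) (Z (param c v0)) (kap * t) - f (param c v0)| <= dl / 3.
  have := geo_lip H (kap * t) 0 U; rewrite geo0 subr0 => /le_trans; apply.
  rewrite normrM; apply: (le_trans _ td).
  by rewrite -[leRHS]mul1r (ger0_norm t0) ler_wpM2r.
have vr : `|u - v| < r.
  rewrite ltNge; apply/negP => rv'; have := Hdl v (conj Bv rv'); rewrite leNgt => /negP; apply.
  move: h1 v0x Gv => /=; move: (f (param c v)) (f x) (f (param c v0)) (geo _ _ _ _) => a b p q h1 h2 h3.
  have -> : a - b = - (q - a) + (q - p) + (p - b).
    by apply/rowP => i; rewrite !mxE; ring.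
  apply: (le_lt_trans (ler_normD _ _)).
  have h4 := ler_normD (- (q - a)) (q - p); rewrite normrN in h4.
  move: h4 h1 h2 h3; move: `|_ + _| `|q - a| `|q - p| `|p - b| => *; lra.
split.
- apply/nbhs_eps; exists (r - `|u - v|); first by rewrite subr_gt0.
  move=> w vw; rewrite /B /= -(subrK v u) -addrA; apply: (le_trans (ler_normD _ _)).
  by apply: ltW; rewrite -ltrBrDl.
- exact: (chart_diff hf Ac cv).
- exact: (differentiable_V (nuh_differentiable hM hf hN Ac cv rv)).
- exact: (char_field_derivative hM hf hN Ac cv rv (hH rv)).
Qed.
End FlowBox.

(** * First order expansion at a singular point *)

Section SingularExpansion.
Variables (R : realType) (M : topologicalType) (A : set (chart R M)) (f N : M -> 'rV[R]_4).
Hypotheses (hM : C2_surface A) (hf : C2_immersion_S3 A f) (hN : unit_normal A f N).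

Lemma derive_dot_cst (V : normedModType R) (F : V -> 'rV[R]_4) (w : 'rV[R]_4) u a :
  differentiable F u -> 'D_a (fun v => dot (F v) w) u = dot ('D_a F u) w.
Proof.
move=> dF; have D : is_derive u a F ('D_a F u) by exact/derivableP/diff_derivable.
have E := @derive_val _ _ _ _ _ _ _ (is_derive_dot D (is_derive_cst w u a)).
by rewrite dot0r addr0 in E.
Qed.

Lemma chart_second_symmetric c u (a b : 'rV[R]_2) (w : 'rV[R]_4) : A c -> cdom c u ->
  dot ('D_b ('D_a (f \o param c)) u) w = dot ('D_a ('D_b (f \o param c)) u) w.
Proof.
move=> Ac cu; pose g v := dot ((f \o param c) v) w.
have nc := cdom_near hM Ac cu.
have D1 x v : cdom c v -> 'D_x g v = dot ('D_x (f \o param c) v) w.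
  by move=> cv; exact: (derive_dot_cst _ _ (chart_diff hf Ac cv)).
have nD1 x v : cdom c v -> \forall z \near v, 'D_x g z = dot ('D_x (f \o param c) z) w.
  by move=> cv; apply: filterS (cdom_near hM Ac cv) => z; exact: D1.
have dot_diff x v : cdom c v -> differentiable (fun z => dot ('D_x (f \o param c) z) w) v.
  by move=> cv; exact: (differentiable_dot (chart_diff2 hf Ac x cv) (differentiable_cst w v)).
have D2 x v : cdom c v -> differentiable ('D_x g) v.
  by move=> cv; have [] := differentiable_near_eq (nD1 x v cv) (dot_diff x v cv).
have D3 x y v : cdom c v -> 'D_y ('D_x g) v = dot ('D_y ('D_x (f \o param c)) v) w.
  move=> cv; have [_ E] := differentiable_near_eq (nD1 x v cv) (dot_diff x v cv).
  have E1 := deriveE y (D2 x v cv); have E2 := deriveE y (dot_diff x v cv).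
  have E3 := derive_dot_cst w y (chart_diff2 hf Ac x cv).
  exact (etrans E1 (etrans (congr1 (fun h => h y) E) (etrans (esym E2) E3))).
have C x y : {for u, continuous ('D_y ('D_x g))}.
  have c2 : {for u, continuous (fun v => dot ('D_y ('D_x (f \o param c)) v) w)}.
    exact (continuous_dot (chart_cont2 hf Ac cu) (@cst_continuous _ _ w u)).
  move=> P nP.
  have nP' : nbhs (dot ('D_y ('D_x (f \o param c)) u) w) P by rewrite -(D3 x y u cu).
  have nn : \forall v \near u, P (dot ('D_y ('D_x (f \o param c)) v) w) by exact: (c2 P nP').
  have : \forall v \near u, P ('D_y ('D_x g) v).
    by apply: filterS2 nc nn => v cv; rewrite (D3 x y v cv).
  by [].
refine (etrans (esym (D3 a b u cu)) (etrans _ (D3 b a u cu))).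
apply: derive_commute.
- apply: filterS nc => v cv.
  exact: (differentiable_dot (chart_diff hf Ac cv) (differentiable_cst w v)).
- by apply: filterS nc => v cv; exact: D2.
- by apply: filterS nc => v cv; exact: D2.
- exact: C.
- exact: C.
Qed.

(** Symmetry of the second fundamental form, from that of the second derivatives. *)
Lemma chart_normal_symmetric c u (a b : 'rV[R]_2) : A c -> cdom c u ->
  dot ('d (N \o param c) u a) ('d (f \o param c) u b) =
  dot ('d (N \o param c) u b) ('d (f \o param c) u a).
Proof.
move=> Ac cu; have dN := normal_differentiable hM hf hN Ac cu.
have h x y : dot ('d (N \o param c) u x) ('d (f \o param c) u y) =
   - dot ('D_x ('D_y (f \o param c)) u) (N (param c u)).
  have nE : \forall v \near u, dot ((N \o param c) v) ('D_y (f \o param c) v) = 0.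
    apply: filterS (cdom_near hM Ac cu) => v cv; have E := deriveE y (chart_diff hf Ac cv).
    rewrite dotC; refine (etrans (congr1 (fun w => dot w _) E) _).
    exact: (diff_perp_normal hN y Ac cv).
  have D2 : is_derive u x ('D_y (f \o param c)) ('D_x ('D_y (f \o param c)) u).
    by exact/derivableP/diff_derivable/(chart_diff2 hf Ac y cu).
  have E := near_cst_is_derive nE (is_derive_dot (is_derive_diff x dN) D2).
  have E1 := deriveE y (chart_diff hf Ac cu).
  move/eqP: E; rewrite addr_eq0 => /eqP E; rewrite (dotC _ (N (param c u))).
  exact (etrans (congr1 (dot _) (esym E1)) E).
exact (etrans (h a b) (etrans (congr1 (fun x => - x)
  (@chart_second_symmetric c u b a _ Ac cu)) (esym (h b a)))).
Qed.

Variable x0 : M.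
Local Notation p := (f x0).
Local Notation Y x := (Vfield (Nh f N x)).
Hypothesis Nx0 : N x0 = Vfield p.

Lemma dot_sum0 (x y z q q' : 'rV[R]_4) : dot x q + dot y z = 0 -> y = 0 -> q = q' -> dot x q' = 0.
Proof. by move=> + y0 <-; rewrite y0 dot0l addr0. Qed.

(** The operator w |-> w + i n(w), where n is symmetric, has trace 2 in the plane of E1 and E2. *)
Lemma trace_alg (y1 y2 n1 n2 q : 'rV[R]_4) : y1 = E1 q + Vfield n1 -> y2 = E2 q + Vfield n2 ->
  dot n1 (E2 q) = dot n2 (E1 q) -> dot q q = 1 -> dot y1 (E1 q) + dot y2 (E2 q) = 2.
Proof.
move=> -> -> S qq; rewrite !dotDl dotE1E1 qq E2V !dotVV dotE1E1 qq (dotVl n1) -E2V S.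
by ring.
Qed.

(** Here a is the displacement in the chart and D that of the image; e1 bounds the relative errors
    of the first order expansions, K and k the norms of the inverse of the differential of f and of
    the differential of i N_h. *)
Lemma expansion_arith (a b c D X Yd E T k K e e1 : R) : 0 <= D -> 0 <= a -> 0 <= k -> 0 <= K -> 0 <= e1 ->
  e1 * (2 * K) <= 1 -> e1 * (2 * K * (4 + k * K)) <= e -> a <= X + b -> X <= K * D ->
  b <= K * (e1 * a) -> c <= k * b -> Yd <= e1 * a -> E <= Yd + c ->
  T <= 4 * (e1 * a) -> E <= e * D /\ T <= e * D.
Proof.
move=> D0 a0 k0 K0 e0 h1 h2 h3 h4 h5 h6 h7 h8 h9.
have i1 : K * (e1 * a) <= a / 2.
  have : a * (e1 * (2 * K)) <= a * 1 by rewrite ler_wpM2l.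
  lra.
have i2 : a <= 2 * K * D by lra.
have i3 : E <= e1 * (1 + k * K) * a.
  have : k * b <= k * (K * (e1 * a)) by rewrite ler_wpM2l.
  lra.
have i4 : e1 * (1 + k * K) * a <= e1 * (1 + k * K) * (2 * K * D).
  by rewrite ler_wpM2l// !(mulr_ge0, addr_ge0).
have i5 : e1 * (2 * K * (4 + k * K)) * D <= e * D by rewrite ler_wpM2r.
have i6 : 4 * e1 * a <= 4 * e1 * (2 * K * D) by rewrite ler_wpM2l// mulr_ge0.
have i7 : 0 <= e1 * K * (k * K) * D by rewrite !mulr_ge0.
have i8 : 0 <= e1 * K * D by rewrite !mulr_ge0.
by split; lra.
Qed.

(** The derivative of i N_h at a point where N = i f, in terms of the derivatives n of N and d of f. *)
Lemma horizontal_normal_alg (n d q m : 'rV[R]_4) : m = Vfield q -> dot q q = 1 ->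
  dot n m = 0 -> dot d q = 0 ->
  Vfield (n - ((dot n (Vfield q) + dot m (Vfield d)) *: Vfield q + dot m (Vfield q) *: Vfield d))
  = d + Vfield n.
Proof.
move=> -> qq nq dq; rewrite nq !dotVV (dotC q d) dq qq addr0 scale0r scale1r add0r.
by rewrite VfieldD VfieldN VfieldK opprK addrC.
Qed.

(** At a singular point N_h vanishes, and the derivative of i N_h, read in the tangent plane, is
    the sum of the identity (from the derivative of the vertical field) and of the quarter turn
    of a symmetric operator (the shape operator), which is traceless. The vectors be1 and be2 are the images of E1 and E2. *)
Lemma singular_expansion : exists be1 be2 : 'rV[R]_4,
  [/\ forall e : R, 0 < e -> \forall y \near x0,
       `|Y y - (dot (f y - p) (E1 p) *: be1 + dot (f y - p) (E2 p) *: be2)| <= e * `|f y - p| /\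
       `|dot (f y - p) (Vfield p)| <= e * `|f y - p|,
      forall w, dot w p = 0 -> dot w (Vfield p) = 0 -> exists y : R -> M,
        [/\ {for 0, continuous y}, y 0 = x0 & is_derive (0 : R) 1 (f \o y) w],
      dot be1 p = 0 /\ dot be1 (Vfield p) = 0, dot be2 p = 0 /\ dot be2 (Vfield p) = 0 &
      dot be1 (E1 p) + dot be2 (E2 p) = 2].
Proof.
have [c [u [Ac cu xE]]] := chart_at hM x0.
have pp := sphere hf x0.
have pc : f (param c u) = p by rewrite xE.
have Nc : N (param c u) = Vfield p by rewrite xE.
have dF := chart_diff hf Ac cu; have dN := normal_differentiable hM hf hN Ac cu.
have surj w : dot w p = 0 -> dot w (Vfield p) = 0 -> exists a, 'd (f \o param c) u a = w.
  by move=> wp wV; apply: (tangent_surj hf hN Ac cu); rewrite ?pc ?Nc.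
have [a1 A1] := surj (E1 p) (dotE1p p) (dotE1V p).
have [a2 A2] := surj (E2 p) (dotE2p p) (dotE2V p).
pose P (w : 'rV[R]_4) := dot w (E1 p) *: a1 + dot w (E2 p) *: a2.
pose Yc := (fun v => Vfield ((Nh f N \o param c) v)).
have dNh := Nh_differentiable hM hf hN Ac cu.
have dY : differentiable Yc u by exact: differentiable_V.
pose B w := 'd Yc u (P w).
have Plin a x y : P (a *: x + y) = a *: P x + P y.
  by rewrite /P !dotDl !dotZl; apply/rowP => i; rewrite !mxE; ring.
have PF w : dot w p = 0 -> dot w (Vfield p) = 0 -> 'd (f \o param c) u (P w) = w.
  move=> wp wV; have := frame_expand p w; rewrite pp scale1r wp wV !scale0r !add0r => wE.
  refine (etrans _ (esym wE)); rewrite /P.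
  refine (etrans (linearD _ _ _) _); rewrite !linearZ.
  exact (congr2 (fun x y => _ *: x + _ *: y) A1 A2).
have Fp h : dot ('d (f \o param c) u h) p = 0 /\ dot ('d (f \o param c) u h) (Vfield p) = 0.
  by split; [rewrite -pc; exact: (diff_perp_sphere hf)|rewrite -Nc; exact: (diff_perp_normal hN)].
have PdF h : P ('d (f \o param c) u h) = h.
  by apply: (chart_inj hf Ac cu); apply: PF; have [] := Fp h.
have dYE a : 'd Yc u a = 'd (f \o param c) u a + Vfield ('d (N \o param c) u a).
  have DN := is_derive_diff a dN; have DF := is_derive_diff a dF; have DV := is_derive_V DF.
  have Dk := is_derive_dot DN DV; have DS := is_derive_scale Dk DV.
  have DY := is_derive_V (is_deriveB DN DS).
  have E : 'D_a Yc u = _ := @derive_val _ _ _ _ _ _ _ DY.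
  refine (etrans (esym (deriveE a dY)) (etrans E _)).
  have N0 : dot ('d (N \o param c) u a) (N (param c u)) = 0.
    have nE : \forall v \near u, dot ((N \o param c) v) ((N \o param c) v) = 1.
      exact: (@filterE _ (nbhs u) _ _ (fun v => normal_unit hN _)).
    have := near_cst_is_derive nE (is_derive_dot DN DN); rewrite (dotC ((N \o param c) u)) => h.
    have h' : forall y : R, y + y = 0 -> y = 0 by move=> y; lra.
    exact: h' h.
  have F0 : dot ('d (f \o param c) u a) (f (param c u)) = 0 by exact: (diff_perp_sphere hf).
  have mq : N (param c u) = Vfield (f (param c u)) by rewrite pc.
  exact (horizontal_normal_alg mq (sphere hf _) N0 F0).
have Yperp x : dot (Y x) (f x) = 0 /\ dot (Y x) (Vfield (f x)) = 0.
  have [h1 h2] := Nh_perp hf hN x.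
  by rewrite dotVl h2 oppr0 dotVV h1.
have Y0 : Yc u = 0.
  by rewrite /Yc /= /Nh Nc pc dotVV pp scale1r subrr Vfield0.
have BE w : B w = dot w (E1 p) *: 'd Yc u a1 + dot w (E2 p) *: 'd Yc u a2.
  by rewrite /B /P; refine (etrans (linearD _ _ _) _); rewrite !linearZ.
exists ('d Yc u a1), ('d Yc u a2).
have Bperp a : dot ('d Yc u a) p = 0 /\ dot ('d Yc u a) (Vfield p) = 0.
  have DY := is_derive_diff a dY; have DF := is_derive_diff a dF.
  have nE1 : \forall v \near u, dot (Yc v) ((f \o param c) v) = 0.
    exact: (@filterE _ (nbhs u) _ _ (fun v => (Yperp _).1)).
  have nE2 : \forall v \near u, dot (Yc v) (Vfield ((f \o param c) v)) = 0.
    exact: (@filterE _ (nbhs u) _ _ (fun v => (Yperp _).2)).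
  split.
    exact (dot_sum0 (near_cst_is_derive nE1 (is_derive_dot DY DF)) Y0 pc).
  exact (dot_sum0 (near_cst_is_derive nE2 (is_derive_dot DY (is_derive_V DF))) Y0
    (congr1 (@Vfield R) pc)).
split; [| |exact: Bperp|exact: Bperp|].
- move=> e e0.
  have [k k0 Hk] := linear_lipschitz (diff_continuous (f := Yc) dY).
  pose K : R := 4 * `|E1 p| * `|a1| + 4 * `|E2 p| * `|a2| + 1.
  have K0 : 0 < K by rewrite /K ltr_wpDl// addr_ge0// !mulr_ge0.
  have PK w : `|P w| <= K * `|w|.
    apply: (le_trans (ler_normD _ _)); rewrite !normrZ.
    have h1 : `|dot w (E1 p)| * `|a1| <= 4 * `|w| * `|E1 p| * `|a1|.
      by rewrite ler_wpM2r// dot_le_norm.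
    have h2 : `|dot w (E2 p)| * `|a2| <= 4 * `|w| * `|E2 p| * `|a2|.
      by rewrite ler_wpM2r// dot_le_norm.
    apply: (le_trans (lerD h1 h2)).
    rewrite (_ : K * `|w| = 4 * `|w| * `|E1 p| * `|a1| + 4 * `|w| * `|E2 p| * `|a2| + `|w|).
      by rewrite lerDl.
    by rewrite /K; ring.
  clearbody K; have kK0 : 0 < 1 + k * K by rewrite ltr_pwDl// mulr_ge0// ltW.
  have [e1 [e10 e1a e1b]] : exists e1 : R, [/\ 0 < e1, e1 * (2 * K) <= 1 &
      e1 * (2 * K * (4 + k * K)) <= e].
    have kK4 : 0 < 4 + k * K by rewrite ltr_pwDl// mulr_ge0// ltW.
    exists (Num.min (1 / (2 * K)) (e / (2 * K * (4 + k * K)))); split.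
    - by rewrite lt_min !divr_gt0// !mulr_gt0.
    - by rewrite -ler_pdivlMr ?mulr_gt0// ge_min lexx.
    - by rewrite -ler_pdivlMr ?mulr_gt0// ge_min lexx orbT.
  have [d1 d10 H1] := diff_eps dF e10; have [d2 d20 H2] := diff_eps dY e10.
  have nv : \forall v \near u, `|v - u| < Num.min d1 d2.
    by apply/nbhs_eps; exists (Num.min d1 d2); [rewrite lt_min d10|move=> y; rewrite distrC].
  have := near_param hM Ac cu nv; rewrite xE; apply: filterS => y [cy yd yE].
  move: yd; rewrite lt_min => /andP[hd1 hd2].
  set h := Defs.coord c y - u in hd1 hd2 *.
  have uh : u + h = Defs.coord c y by rewrite /h addrC subrK.
  have {}H1 := H1 h hd1; have {}H2 := H2 h hd2.
  have e1E : (f \o param c) (u + h) - (f \o param c) u = f y - p by rewrite /= uh yE xE.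
  have e2E : Yc (u + h) - Yc u = Y y by rewrite Y0 subr0 /Yc /= uh yE.
  have {}H1 : `|f y - p - 'd (f \o param c) u h| <= e1 * `|h|.
    exact (eq_ind _ (fun z => `|z - 'd (f \o param c) u h| <= e1 * `|h|) H1 _ e1E).
  have {}H2 : `|Y y - 'd Yc u h| <= e1 * `|h|.
    exact (eq_ind _ (fun z => `|z - 'd Yc u h| <= e1 * `|h|) H2 _ e2E).
  pose r1 := f y - p - 'd (f \o param c) u h.
  have PE : P (f y - p) = h + P r1.
    have -> : f y - p = 1 *: 'd (f \o param c) u h + r1 by rewrite scale1r /r1 [RHS]addrC subrK.
    by rewrite Plin scale1r PdF.
  have g1 : `|h| <= `|P (f y - p)| + `|P r1|.
    have -> : h = P (f y - p) - P r1 by rewrite PE addrK.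
    exact: ler_normB.
  have g2 := PK (f y - p).
  have g3 : `|P r1| <= K * (e1 * `|h|) := le_trans (PK r1) (ler_wpM2l (ltW K0) H1).
  have g4 := Hk (P r1).
  have g5 : `|Y y - B (f y - p)| <= `|Y y - 'd Yc u h| + `|'d Yc u (P r1)|.
    have E : B (f y - p) = 'd Yc u h + 'd Yc u (P r1).
      by rewrite /B PE; exact: linearD.
    have -> : Y y - B (f y - p) = (Y y - 'd Yc u h) - 'd Yc u (P r1).
      exact (etrans (congr1 (fun z => Y y - z) E) (etrans (congr1 (fun z => Y y + z) (opprD _ _))
        (addrA _ _ _))).
    exact: ler_normB.
  have g6 : `|dot (f y - p) (Vfield p)| <= 4 * (e1 * `|h|).
    have -> : dot (f y - p) (Vfield p) = dot r1 (Vfield p).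
      by rewrite /r1 [RHS]dotDl dotNl; have [_ ->] := Fp h; rewrite subr0.
    apply: (le_trans (dot_le_norm _ _)).
    have n1 : `|Vfield p| <= 1.
      by apply: (le_trans (norm_le_enorm _)); rewrite enormV enorm1.
    apply: (le_trans (ler_wpM2l _ n1)); first by rewrite mulr_ge0.
    rewrite mulr1; exact (ler_wpM2l (ler0n R 4) H1).
  rewrite -(BE (f y - p)).
  exact (expansion_arith (normr_ge0 (f y - p)) (normr_ge0 h) (ltW k0) (ltW K0) (ltW e10) e1a e1b g1 g2 g3 g4 H2 g5 g6).
- move=> w wp wV; exists (fun t : R => param c (u + t *: P w)); split.
  + have cl : {for (0 : R), continuous (fun t : R => u + t *: P w)}.
      exact (cvgD (cvg_cst u) (@scalel_continuous _ _ (P w) (0 : R))).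
    apply: (continuous_comp cl).
    by rewrite scale0r addr0; exact: (param_continuous hM Ac cu).
  + by rewrite scale0r addr0.
  + have := @is_derive_line R _ _ (f \o param c) u (P w) 0.
    by rewrite scale0r addr0 => /(_ dF); rewrite PF.
- have S := chart_normal_symmetric a1 a2 Ac cu.
  have {}S : dot ('d (N \o param c) u a1) (E2 p) = dot ('d (N \o param c) u a2) (E1 p).
    refine (etrans (congr1 (dot _) (esym A2)) (etrans S (congr1 (dot _) A1))).
  have b1 := etrans (dYE a1) (congr1 (fun x => x + Vfield ('d (N \o param c) u a1)) A1).
  have b2 := etrans (dYE a2) (congr1 (fun x => x + Vfield ('d (N \o param c) u a2)) A2).
  exact (trace_alg b1 b2 S pp).
Qed.
End SingularExpansion.

(** * Flow lines close to the singular point *)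

Section Taylor.
Variables (R : realType) (lam : R).
Implicit Types (q e : 'rV[R]_4).

Lemma curve_lip (g dg : R -> 'rV[R]_4) (L s t : R) : (forall x : R, is_derive x 1 g (dg x)) ->
  (forall x, `|x - t| <= `|s - t| -> enorm (dg x) <= L) -> enorm (g s - g t) <= L * `|s - t|.
Proof.
move=> hg hL.
have key a b : a < b -> (forall x, a <= x <= b -> enorm (dg x) <= L) ->
    enorm (g b - g a) <= L * (b - a).
  move=> ab hab; pose w := g b - g a.
  have [x xx|c /andP[c1 c2] E] := @MVT_derive R (fun x => dot (g x) w) (fun x => dot (dg x) w) a b ab.
    apply: (is_derive_eq (is_derive_dot (hg x) (is_derive_cst w x 1))).
    by rewrite dot0r addr0.
  have : enorm w ^+ 2 <= enorm w * (L * (b - a)).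
    rewrite enorm_sqr {1}/w dotDl dotNl E.
    have : dot (dg c) w <= L * enorm w.
      apply: (le_trans (ler_norm _)); apply: (le_trans (dot_le_enorm _ _)).
      by rewrite ler_wpM2r ?enorm_ge0// hab// !ltW.
    move=> h; rewrite [leRHS]mulrA [enorm w * L]mulrC ler_wpM2r// subr_ge0 ltW//.
  rewrite -/w expr2; have := enorm_ge0 w; rewrite le_eqVlt => /orP[/eqP <- _|w0].
    rewrite mulr_ge0 ?subr_ge0 ?(ltW ab)//; apply: (le_trans (enorm_ge0 (dg a))).
    by apply: hab; rewrite lexx ltW.
  by rewrite ler_pM2l.
case: (ltrgtP s t) => [st|ts|->].
- rewrite -enormN opprB; apply: key => // x /andP[sx xt].
  apply: hL; rewrite distrC (distrC s) !ger0_norm ?subr_ge0 ?(ltW st)//.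
  by rewrite lerD2l lerN2.
- apply: key => // x /andP[tx xs].
  by apply: hL; rewrite !ger0_norm ?subr_ge0 ?(ltW ts)// lerD2r.
- by rewrite subrr mulr0 /enorm dot0l sqrtr0.
Qed.

(** The acceleration x'' = - x - 2 lam i x' of a unit speed geodesic is bounded by this number. *)
Definition flow_acc : R := 1 + 2 * `|lam|.
Lemma flow_acc_gt0 : 0 < flow_acc. Proof. by rewrite /flow_acc ltr_pwDl// mulr_ge0. Qed.

Lemma dgeo_taylor q e s : unitary_pair (q, e) -> enorm (dgeo lam q e s - e) <= flow_acc * `|s|.
Proof.
move=> U; have := @curve_lip _ _ flow_acc s 0 (is_derive_dgeo lam q e).
rewrite dgeo0 subr0; apply => x _; have [q1 e1 _ _] := unitary_Phi lam x U.
apply: (le_trans (enormD _ _)); rewrite !enormN enorm1// /flow_acc lerD2l enormZ enormV enorm1// mulr1.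
by rewrite normrM ger0_norm.
Qed.

Lemma geo_taylor q e s : unitary_pair (q, e) ->
  enorm (geo lam q e s - q - s *: e) <= flow_acc * s ^+ 2.
Proof.
move=> U; pose g x := geo lam q e x - x *: e.
have dg (x : R) : is_derive x 1 g (dgeo lam q e x - e).
  apply: (is_derive_eq (is_deriveB (is_derive_geo lam q e x) (is_derive_scalel e (is_derive_id x 1)))).
  by rewrite scale1r.
have := @curve_lip _ _ (flow_acc * `|s|) s 0 dg.
rewrite /g geo0 scale0r !subr0 -mulrA -normrM -expr2 ger0_norm ?sqr_ge0//.
rewrite addrAC; apply => x xs; apply: (le_trans (dgeo_taylor _ U)).
by apply: ler_wpM2l; [exact: ltW flow_acc_gt0|move: xs; rewrite !subr0].
Qed.

(** A geodesic is close to its tangent for a short time, so it does not come back. *)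
Lemma geo_away q e s : unitary_pair (q, e) -> 4 * flow_acc * `|s| <= 1 ->
  3 / 4 * `|s| <= enorm (geo lam q e s - q).
Proof.
move=> U hs; have := geo_taylor s U; have [_ e1 _ _] := U.
have : enorm (s *: e) <= enorm (geo lam q e s - q) + enorm (geo lam q e s - q - s *: e).
  have E : s *: e = (geo lam q e s - q) - (geo lam q e s - q - s *: e) by rewrite opprB addrC subrK.
  by rewrite {1}E; apply: (le_trans (enormD _ _)); rewrite enormN.
rewrite enormZ enorm1// mulr1 => h1.
have hs' : flow_acc * `|s| <= 1 / 4 by lra.
have := ler_wpM2r (normr_ge0 s) hs'.
have E2 : flow_acc * `|s| * `|s| = flow_acc * s ^+ 2.
  by rewrite -mulrA -expr2 real_normK ?num_real.
rewrite E2 => h2 h3; lra.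
Qed.
End Taylor.

Section TrapFlow.
Variables (R : realType) (M : topologicalType) (A : set (chart R M)) (f N : M -> 'rV[R]_4).
Hypotheses (hM : C2_surface A) (hf : C2_immersion_S3 A f) (hN : unit_normal A f N).
Variable H : R.
Local Notation Z := (char_field f N).
Local Notation st := (state f N).
Local Notation reg x := (Nh f N x != 0).
Hypothesis hH : forall x, reg x -> has_mean_curvature A f N x H.
Variables (K : set M) (x0 : M) (eta : R).
Hypotheses (tK : trap f x0 K eta) (rK : forall y, K y -> y <> x0 -> reg y) (sx0 : Nh f N x0 = 0).

Lemma reg_neq y : reg y -> y <> x0.
Proof. by move=> ry yx; move: ry; rewrite yx sx0 eqxx. Qed.

(** The states over the trap are a closed set away from the singular point. *)
Lemma state_closed w : w.1 <> f x0 ->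
  (forall d : R, 0 < d -> exists y, [/\ K y, y <> x0, `|f y - w.1| < d & `|Z y - w.2| < d]) ->
  exists2 y, K y /\ y <> x0 & st y = w.
Proof.
move=> wx0 hw; have [cK inj Kx e0 nK] := tK; have fc := immersion_continuous hM hf.
have [x Kx' fx] : (f @` K) w.1.
  apply: contrapT => nw; have [d d0 Hd] := compact_avoid cK (fun y _ => fc y) nw.
  have [y [Ky _ yd _]] := hw d d0; by have := Hd y Ky; rewrite leNgt yd.
have xx0 : x <> x0 by move=> E; apply: wx0; rewrite -fx E.
exists x => //; apply/eqP/negPn/negP => ne.
have ne2 : Z x != w.2.
  by apply: contraNneq ne => E; case: (w) fx E => a b /= fx E; rewrite /state fx E.
have d0 : 0 < `|Z x - w.2| / 2 by rewrite divr_gt0// normr_gt0 subr_eq0.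
have nW : nbhs x [set y | `|Z x - Z y| < `|Z x - w.2| / 2].
  have nn : nbhs (Z x) (fun z => `|Z x - z| < `|Z x - w.2| / 2).
    by apply/nbhs_eps; exists (`|Z x - w.2| / 2).
  exact: (char_field_continuous hM hf hN (rK Kx' xx0) nn).
have [d dp Hd] := compact_inverse_continuous fc cK inj Kx' nW.
have mp : 0 < Num.min d (`|Z x - w.2| / 2) by rewrite lt_min dp d0.
have [y [Ky _ + +]] := hw _ mp; rewrite -fx !lt_min => /andP[yd _] /andP[_ yZ].
have := Hd y Ky yd; rewrite /= => h1.
have := ltrD h1 yZ; rewrite -splitr ltNge => /negP; apply.
exact: ler_distD.
Qed.

(** A flow line starting in the trap stays in the surface as long as it does not
    meet the singular point and does not leave the ball of radius [eta]. *)
Lemma orbit_in_trap kap y r : `|kap| <= 1 -> K y -> y <> x0 -> 0 <= r ->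
  (forall t, 0 <= t <= r -> `|geo H (f y) (Z y) (kap * t) - f x0| < eta /\
     geo H (f y) (Z y) (kap * t) <> f x0) ->
  exists2 y', K y' /\ y' <> x0 & st y' = Phi H (kap * r) (st y).
Proof.
move=> k1 Ky yx r0 hr; have [cK inj Kx e0 nK] := tK; have fc := immersion_continuous hM hf.
have ry := rK Ky yx; have U := state_unitary hf hN ry.
apply: (@real_induction R (fun t => exists2 y', K y' /\ y' <> x0 & st y' = Phi H (kap * t) (st y)) r r0).
  by exists y => //; rewrite mulr0 Phi0.
move=> t tr; have [te tx] := hr t tr.
pose G s := geo H (f y) (Z y) (kap * s).
have Glip a b : `|G a - G b| <= `|a - b|.
  apply: (le_trans (geo_lip _ _ _ U)); rewrite -mulrBr normrM.
  by rewrite -[leRHS]mul1r ler_wpM2r.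
have [[x Kx' fx]|nG] := pselect ((f @` K) (G t)); last first.
  have [d d0 Hd] := compact_avoid cK (fun y _ => fc y) nG.
  exists d => // t' t'' _ _ tt' _ _ [y' [Ky' _] E]; exfalso.
  have fy' : f y' = G t' := congr1 fst E.
  by have := Hd y' Ky'; rewrite fy' leNgt (le_lt_trans (Glip t' t))// distrC.
have xx0 : x <> x0 by move=> E; apply: tx; rewrite -/(G t) -fx E.
have nx : nbhs x K by apply: nK => //; rewrite fx.
have [e [K' [V [ep [cK' _] K'K [nV VK'] flow]]]] := flow_box hM hf hN hH (rK Kx' xx0) nx.
have [d dp Hd] := compact_inverse_continuous fc cK inj Kx' nV.
exists (Num.min d (e / 2)); first by rewrite lt_min dp divr_gt0.
move=> t' t'' _ _; rewrite !lt_min => /andP[td _te] /andP[_ te'] tt [y' [Ky' _] E].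
have fy' : f y' = G t' := congr1 fst E.
have Vy' : V y' by apply: Hd => //; rewrite fy' fx (le_lt_trans (Glip _ _))// distrC.
have se : `|kap * (t'' - t')| <= e.
  rewrite normrM; apply: (@le_trans _ _ `|t'' - t'|); first by rewrite -[leRHS]mul1r ler_wpM2r.
  rewrite (splitr e) -(subrK t t'') -addrA; apply: (le_trans (ler_normD _ _)).
  by rewrite lerD// ltW// distrC.
have [y'' Ky'' E''] := flow y' _ Vy' se.
have [K'' r''] := K'K y'' Ky''.
exists y''; first by split => //; exact: reg_neq.
by rewrite E'' E PhiD -mulrDr addrC subrK.
Qed.
End TrapFlow.

(** * The differential of the horizontal normal at an isolated singular point *)

Lemma slope_cvg (R : realType) (W : normedModType R) (g : R -> W) d :
  is_derive (0 : R) 1 g d -> h^-1 *: (g h - g 0) @[h --> (0 : R)^'] --> d.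
Proof.
move=> [/cvg_ex [l hl] hd].
have E : (fun h : R => h^-1 *: ((g \o shift 0) (h *: (1 : R)) - g 0)) = (fun h => h^-1 *: (g h - g 0)).
  apply/funext => h /=; have -> : h *: (1 : R) = h by exact: mulr1.
  by rewrite /shift/= addr0.
have hl' : h^-1 *: (g h - g 0) @[h --> (0 : R)^'] --> l by rewrite -E.
have <- : l = d by rewrite -hd /derive E; apply/esym/cvg_lim.
exact: hl'.
Qed.

Section IsolatedPoint.
Variables (R : realType) (M : topologicalType) (A : set (chart R M)) (f N : M -> 'rV[R]_4).
Hypotheses (hM : C2_surface A) (hf : C2_immersion_S3 A f) (hN : unit_normal A f N).
Variable H : R.
Local Notation Z := (char_field f N).
Local Notation st := (state f N).
Local Notation reg x := (Nh f N x != 0).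
Hypothesis hH : forall x, reg x -> has_mean_curvature A f N x H.
Variables (K : set M) (x0 : M) (eta r : R).
Local Notation p := (f x0).
Hypotheses (tK : trap f x0 K eta) (rK : forall y, K y -> y <> x0 -> reg y).
Hypothesis Nx0 : N x0 = Vfield p.
Local Notation C := (flow_acc H).
Hypotheses (r0 : 0 < r) (rC : 8 * C * r <= 1) (reta : 4 * r <= eta).
Local Notation Y x := (Vfield (Nh f N x)).

Let pp : dot p p = 1. Proof. exact: (sphere hf). Qed.

Lemma singular_Nh : Nh f N x0 = 0.
Proof. by rewrite /Nh Nx0 dotVV pp scale1r subrr. Qed.

(** The bound on r keeps the geodesics almost straight for the times considered. *)
Lemma no_return q e s : unitary_pair (q, e) -> s != 0 -> `|s| <= 2 * r -> geo H q e s <> q.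
Proof.
move=> U s0 hs E.
have h4 : 4 * C * `|s| <= 1.
  have := ler_wpM2l (mulr_ge0 (ler0n R 4) (ltW (flow_acc_gt0 H))) hs; move: rC; lra.
have := geo_away U h4; rewrite E subrr /enorm dot0l sqrtr0.
have : 0 < `|s| by rewrite normr_gt0.
lra.
Qed.

Lemma stay kap y t : reg y -> `|kap| <= 1 -> `|f y - p| < eta / 2 -> 0 <= t <= r ->
  `|geo H (f y) (Z y) (kap * t) - p| < eta.
Proof.
move=> ry k1 fy /andP[t0 tr].
have h1 : `|geo H (f y) (Z y) (kap * t) - f y| <= t.
  have := geo_lip H (kap * t) 0 (state_unitary hf hN ry); rewrite geo0 subr0 => /le_trans; apply.
  by rewrite normrM (ger0_norm t0) -[leRHS]mul1r ler_wpM2r.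
rewrite -(subrK (f y) (geo _ _ _ _)) -addrA; apply: (le_lt_trans (ler_normD _ _)).
move: h1 fy tr reta r0; move: `|_ - _| `|f y - p| => *; lra.
Qed.

(** The field i N_h vanishes at the singular point and is differentiable there, contrary to Z. *)
Lemma Y_scale y : Y y = enorm (Y y) *: Z y.
Proof.
rewrite enormV /char_field -VfieldZ /nuh.
have [->|n0] := eqVneq (Nh f N y) 0; first by rewrite !scaler0.
by rewrite scalerA divff ?scale1r// gt_eqF// enorm_gt0.
Qed.

Lemma Z_scale y : Z y = (enorm (Y y))^-1 *: Y y.
Proof. by rewrite enormV /char_field /nuh VfieldZ. Qed.

(** If states in the trap approach (p, e) and their flow lines in one direction
    avoid the singular point, then the flow line of (p, e) lies in the surface. *)
Lemma limit_orbit kap e t : `|kap| = 1 -> unitary_pair (p, e) -> 0 < t <= r ->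
  (forall d : R, 0 < d -> exists y, [/\ K y, y <> x0, `|f y - p| < d, `|Z y - e| < d &
     forall s, 0 <= s <= r -> geo H (f y) (Z y) (kap * s) <> p]) ->
  exists2 y, K y /\ y <> x0 & st y = Phi H (kap * t) (p, e).
Proof.
move=> k1 U /andP[t0 tr] hd; have k1' : `|kap| <= 1 by rewrite k1.
have sx := singular_Nh.
have kt : `|kap * t| <= 2 * r by rewrite normrM k1 mul1r gtr0_norm//; lra.
have kt0 : kap * t != 0.
  by apply: mulf_neq0; [rewrite -normr_eq0 k1 oner_eq0|rewrite gt_eqF].
apply: (state_closed hM hf hN tK rK); first exact: no_return.
move=> d d0.
have [c1 c2] := @cvg_flow R H ('rV[R]_4 * 'rV[R]_4)%type (filter_prod (nbhs p) (nbhs e)) _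
  fst snd (fun=> kap * t) p e (kap * t) cvg_fst cvg_snd (cvg_cst _).
have nn (l : 'rV[R]_4) : nbhs l (fun z => `|z - l| < d).
  by apply/nbhs_eps; exists d => // z; rewrite distrC.
have m1 : filter_prod (nbhs p) (nbhs e) [set v | `|geo H v.1 v.2 (kap * t) - geo H p e (kap * t)| < d].
  exact: (c1 _ (nn _)).
have m2 : filter_prod (nbhs p) (nbhs e) [set v | `|dgeo H v.1 v.2 (kap * t) - dgeo H p e (kap * t)| < d].
  exact: (c2 _ (nn _)).
have [[P Q] /= [nP nQ] PQ] := filterI m1 m2.
have [d1 d10 HP] := (nbhs_eps _ _).1 nP; have [d2 d20 HQ] := (nbhs_eps _ _).1 nQ.
have dm0 : 0 < Num.min (Num.min d1 d2) (eta / 2).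
  by rewrite !lt_min d10 d20/= divr_gt0//; case: tK.
have [y [Ky yx fy Zy nh]] := hd _ dm0.
move: fy Zy; rewrite !lt_min => /andP[/andP[fy1 _] fy2] /andP[/andP[_ Zy2] _].
have ry := rK Ky yx.
have [|y' [Ky' y'x] E] := orbit_in_trap hM hf hN hH tK rK sx k1' Ky yx (ltW t0).
  move=> s /andP[s0 st]; have sr : 0 <= s <= r by rewrite s0 (le_trans st).
  split; last exact: nh.
  exact: stay.
exists y'; have fE : f y' = geo H (f y) (Z y) (kap * t) := congr1 fst E.
have ZE : Z y' = dgeo H (f y) (Z y) (kap * t) := congr1 snd E.
have [h1 h2] := PQ (f y, Z y) (conj (HP (f y) (ltac:(by rewrite distrC))) (HQ (Z y) (ltac:(by rewrite distrC)))).
by split => //; rewrite ?fE ?ZE.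
Qed.

Variables be1 be2 : 'rV[R]_4.
Hypothesis expansion : forall e : R, 0 < e -> \forall y \near x0,
  `|Y y - (dot (f y - p) (E1 p) *: be1 + dot (f y - p) (E2 p) *: be2)| <= e * `|f y - p| /\
  `|dot (f y - p) (Vfield p)| <= e * `|f y - p|.
Hypothesis curves : forall w, dot w p = 0 -> dot w (Vfield p) = 0 -> exists y : R -> M,
  [/\ {for 0, continuous y}, y 0 = x0 & is_derive (0 : R) 1 (f \o y) w].
Hypotheses (be1H : dot be1 p = 0 /\ dot be1 (Vfield p) = 0)
  (be2H : dot be2 p = 0 /\ dot be2 (Vfield p) = 0)
  (trace2 : dot be1 (E1 p) + dot be2 (E2 p) = 2).

(** The linear map with the values be1 and be2 at E1 and E2: the differential of i N_h. *)
Definition horizontal_operator w := dot w (E1 p) *: be1 + dot w (E2 p) *: be2.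
Local Notation B := horizontal_operator.

Lemma BopP w : dot (B w) p = 0 /\ dot (B w) (Vfield p) = 0.
Proof.
case: be1H be2H => h1 h2 [h3 h4].
by rewrite /B !dotDl !dotZl h1 h2 h3 h4 !mulr0 addr0.
Qed.

Lemma BopZ c w : B (c *: w) = c *: B w.
Proof. by rewrite /B !dotZl -!scalerA -scalerDr. Qed.

Lemma curve_derivative y w : {for (0 : R), continuous y} -> y 0 = x0 ->
  is_derive (0 : R) 1 (f \o y) w -> is_derive (0 : R) 1 (fun t => Y (y t)) (B w).
Proof.
move=> cy y0 D.
have dfy : differentiable (f \o y) (0 : R) by apply/derivable1_diffP; case: D.
pose g t := dot (f (y t) - p) (E1 p) *: be1 + dot (f (y t) - p) (E2 p) *: be2.
have Dp : is_derive (0 : R) 1 (fun t => f (y t) - p) w.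
  apply: (is_derive_eq (is_deriveB D (is_derive_cst p (0 : R) 1))).
  by rewrite subr0.
have Dg : is_derive (0 : R) 1 g (B w).
  have h (E be : 'rV[R]_4) : is_derive (0 : R) 1 (fun t => dot (f (y t) - p) E *: be) (dot w E *: be).
    apply: is_derive_scalel; apply: (is_derive_eq (is_derive_dot Dp (is_derive_cst E (0 : R) 1))).
    by rewrite dot0r addr0.
  exact: (is_deriveD (h _ _) (h _ _)).
have Dh : is_derive (0 : R) 1 (fun t => Y (y t) - g t) 0.
  have [k k0 Hk] : exists2 k : R, 0 < k & \forall t \near (0 : R), `|f (y t) - p| <= k * `|t|.
    exists (`|w| + 1); first by rewrite ltr_wpDl.
    have [d d0 Hd] := diff_eps dfy ltr01.
    apply/nbhs_eps; exists d => // t; rewrite sub0r normrN => td.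
    have := Hd t td; rewrite add0r /= y0 => h.
    have E : 'd (f \o y) (0 : R) t = t *: w.
      have -> : t = t *: (1 : R) by rewrite /GRing.scale/= mulr1.
      rewrite linearZ; congr (_ *: _); first by rewrite /GRing.scale/= mulr1.
      exact (etrans (esym (deriveE _ dfy)) (@derive_val _ _ _ _ _ _ _ D)).
    rewrite -(subrK ('d (f \o y) (0 : R) t) (f (y t) - p)).
    apply: (le_trans (ler_normD _ _)); apply: (le_trans (lerD h (lexx _))).
    by rewrite E normrZ mulrDl !mul1r (mulrC `|w|) addrC.
  have key : forall e : R, 0 < e -> exists2 d : R, 0 < d & forall h : R, `|h| < d ->
     `|(Y (y (0 + h)) - g (0 + h)) - (Y (y 0) - g 0) - (0 : R -> 'rV[R]_4) h| <= e * `|h|.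
    move=> e e0.
    have n1 : \forall t \near (0 : R), `|Y (y t) - g t| <= e / k * `|f (y t) - p|.
      have := expansion (divr_gt0 e0 k0); rewrite -y0 => n.
      have n' : nbhs (y 0) (fun z => `|Y z - (dot (f z - f (y 0)) (E1 (f (y 0))) *: be1 +
          dot (f z - f (y 0)) (E2 (f (y 0))) *: be2)| <= e / k * `|f z - f (y 0)|).
        by apply: filterS n => z [].
      have := cy _ n'; rewrite /= y0; exact.
    have [d d0 Hd] := (nbhs_eps _ _).1 (filterI n1 Hk).
    exists d => // h hd; have [h1 h2] := Hd h (ltac:(by rewrite sub0r normrN)).
    rewrite add0r y0 singular_Nh Vfield0 /g y0 subrr !dot0l !scale0r addr0 !subr0.
    apply: (le_trans h1); rewrite mulrAC.
    apply: (le_trans (ler_wpM2r _ (ler_wpM2l (ltW e0) h2))); first by rewrite invr_ge0 ltW.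
    by rewrite le_eqVlt; apply/orP; left; apply/eqP; field; rewrite gt_eqF.
  have [d1 d2] := @differentiable_epsP R R _ (fun t => Y (y t) - g t) (0 : R) \0
     (fun x => cvg_cst 0) key.
  split; first exact/derivable1_diffP.
  by rewrite deriveE// d2.
have := is_deriveD Dh Dg; rewrite add0r.
by rewrite (_ : _ + g = (fun t => Y (y t)))//; apply/funext => t /=; rewrite addrfctE /= subrK.
Qed.

Let nb (P : R -> Prop) : (\forall t \near (0 : R), P t) -> \forall t \near (0 : R)^'+, P t.
Proof. by move=> h; apply: filterS h => t Pt _. Qed.

Lemma cvg_enorm (T : Type) (Fl : set_system T) {FF : Filter Fl} (g : T -> 'rV[R]_4) l :
  g @ Fl --> l -> (fun t => enorm (g t)) @ Fl --> enorm l.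
Proof.
by move=> h; exact (cvg_comp (fun t => dot (g t) (g t)) Num.sqrt (cvg_dot h h) (@sqrt_continuous R _)).
Qed.

(** A curve reaching the singular point with velocity w; at its points Z is close to B w / |B w|. *)
Definition approach (y : R -> M) w := [/\ \forall t \near (0 : R)^'+, K (y t) /\ y t <> x0,
  f (y t) @[t --> (0 : R)^'+] --> p,
  Z (y t) @[t --> (0 : R)^'+] --> (enorm (B w))^-1 *: B w,
  t^-1 *: (f (y t) - p) @[t --> (0 : R)^'+] --> w &
  t^-1 *: Y (y t) @[t --> (0 : R)^'+] --> B w].

Lemma approach_exists w : dot w w = 1 -> dot w p = 0 -> dot w (Vfield p) = 0 -> B w != 0 ->
  exists y, approach y w.
Proof.
move=> ww wp wV Bw; have [y [cy y0 D]] := curves wp wV; exists y.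
have D2 := curve_derivative cy y0 D.
have L1 : t^-1 *: (f (y t) - p) @[t --> (0 : R)^'+] --> w.
  by apply: cvg_dnbhs_at_right; have := slope_cvg D; rewrite /= y0.
have L2 : t^-1 *: Y (y t) @[t --> (0 : R)^'+] --> B w.
  apply: cvg_dnbhs_at_right; have := slope_cvg D2; rewrite y0 singular_Nh Vfield0.
  by under eq_fun do rewrite subr0.
have nK : nbhs x0 K by case: tK => _ _ Kx e0 nK; apply: nK => //; rewrite subrr normr0.
have nKy : \forall t \near (0 : R), K (y t) by apply: cy; rewrite y0.
have fc := immersion_continuous hM hf.
split => //.
- have w0 : 0 < enorm w by rewrite enorm1.
  have npos : \forall t \near (0 : R)^'+, 0 < enorm (t^-1 *: (f (y t) - p)).
    exact: (@cvgr_gt _ _ _ _ _ _ (cvg_enorm L1) 0 w0).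
  apply: filterS2 (nb nKy) npos => t Kt et; split => // yx; move: et.
  by rewrite yx subrr scaler0 /enorm dot0l sqrtr0 ltxx.
- have cfy : {for (0 : R), continuous (f \o y)} by exact: (continuous_comp cy (fc _)).
  have h : f (y t) @[t --> (0 : R)] --> f (y 0) := cfy.
  rewrite y0 in h; move=> P nP; exact: nb (h P nP).
- have k0 : enorm (B w) != 0 by rewrite gt_eqF// enorm_gt0.
  have L3 : (enorm (t^-1 *: Y (y t)))^-1 *: (t^-1 *: Y (y t)) @[t --> (0 : R)^'+] -->
     (enorm (B w))^-1 *: B w by exact (cvgZ (cvgV k0 (cvg_enorm L2)) L2).
  have nE : \forall t \near (0 : R)^'+, (enorm (t^-1 *: Y (y t)))^-1 *: (t^-1 *: Y (y t)) = Z (y t).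
    have npos : \forall t \near (0 : R)^'+, 0 < t by exact: nbhs_right_gt.
    apply: filterS npos => t t0; rewrite Z_scale enormZ gtr0_norm ?invr_gt0// scalerA.
    by rewrite invfM invrK mulrAC divff ?mul1r// gt_eqF.
  apply: cvg_trans L3; apply: near_eq_cvg; exact: nE.
Qed.

(** If the flow line of y meets p, then p - f y is s Z up to a term of order s^2, and s is of
    the order of |f y - p|. *)
Lemma hit_bound y s : reg y -> `|s| <= 2 * r -> geo H (f y) (Z y) s = p ->
  `|dot (f y - p) (Vfield (Y y))| <= 2 * C * (enorm (f y - p) * enorm (f y - p)) * enorm (Y y).
Proof.
move=> ry hs E; have U := state_unitary hf hN ry.
have h4 : 4 * C * `|s| <= 1.
  have := ler_wpM2l (mulr_ge0 (ler0n R 4) (ltW (flow_acc_gt0 H))) hs; move: rC; lra.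
have := geo_away U h4; have := geo_taylor H s U; rewrite E -enormN opprB => h1.
rewrite -enormN opprB => h2.
have YE : Y y = enorm (Y y) *: Z y := Y_scale y.
have -> : dot (f y - p) (Vfield (Y y)) = - dot (p - f y - s *: Z y) (Vfield (Y y)).
  move: YE; move: (enorm _) => k; move: (Y y) (Z y) (f y) p => a z v q ->.
  by rewrite !VfieldZ !dotZr !dotDl !dotNl dotZl dotV0; ring.
rewrite normrN; apply: (le_trans (dot_le_enorm _ _)); rewrite enormV.
apply: ler_wpM2r; first exact: enorm_ge0.
rewrite -enormN opprB; apply: (le_trans h1).
have : s ^+ 2 <= 2 * (enorm (f y - p) * enorm (f y - p)).
  have h3 : (3 / 4 * `|s|) * (3 / 4 * `|s|) <= enorm (f y - p) * enorm (f y - p).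
    by apply: ler_pM => //; rewrite mulr_ge0.
  have E2 : `|s| * `|s| = s ^+ 2 by rewrite -expr2 real_normK ?num_real.
  have := sqr_ge0 s; lra.
move=> h3; have := ler_wpM2l (ltW (flow_acc_gt0 H)) h3; lra.
Qed.

(** A flow line through a point close to the singular point is almost straight, so
    it can meet the singular point only if it starts in the radial direction. *)
Lemma approach_no_hit y w : dot w (Vfield (B w)) != 0 -> approach y w ->
  \forall t \near (0 : R)^'+, forall s, `|s| <= 2 * r -> geo H (f (y t)) (Z (y t)) s <> p.
Proof.
move=> m0 [nK cf cZ cw cB].
pose a t := t^-1 *: (f (y t) - p); pose b t := t^-1 *: Y (y t).
have Lt : t @[t --> (0 : R)^'+] --> (0 : R) by move=> P nP; exact: nb.
have Lq : (`|dot (a t) (Vfield (b t))| - 2 * C * t * (enorm (a t) * enorm (a t) * enorm (b t)))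
   @[t --> (0 : R)^'+] -->
   `|dot w (Vfield (B w))| - 2 * C * 0 * (enorm w * enorm w * enorm (B w)).
  have q1 : dot (a t) (Vfield (b t)) @[t --> (0 : R)^'+] --> dot w (Vfield (B w)).
    exact (cvg_dot cw (cvg_V cB)).
  have e1 : enorm (a t) @[t --> (0 : R)^'+] --> enorm w by exact: cvg_enorm.
  have e2 : enorm (b t) @[t --> (0 : R)^'+] --> enorm (B w) by exact: cvg_enorm.
  exact (cvgB (cvg_norm q1) (cvgM (cvgM (cvg_cst (2 * C)) Lt) (cvgM (cvgM e1 e1) e2))).
have pos : 0 < `|dot w (Vfield (B w))| - 2 * C * 0 * (enorm w * enorm w * enorm (B w)).
  by rewrite mulr0 mul0r subr0 normr_gt0.
have n1 : \forall t \near (0 : R)^'+, 0 < `|dot (a t) (Vfield (b t))|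
    - 2 * C * t * (enorm (a t) * enorm (a t) * enorm (b t)).
  exact: (@cvgr_gt _ _ _ _ _ _ Lq 0 pos).
have n2 : \forall t \near (0 : R)^'+, 0 < t by exact: nbhs_right_gt.
apply: filterS3 n1 n2 nK => t; rewrite subr_gt0 => h t0 [Ky yx] s hs E.
have ry := rK Ky yx; have hb := hit_bound ry hs E.
have av : f (y t) - p = t *: a t by rewrite /a scalerA divff ?scale1r// gt_eqF.
have bv : Y (y t) = t *: b t by rewrite /b scalerA divff ?scale1r// gt_eqF.
have e1 : enorm (f (y t) - p) = t * enorm (a t) by rewrite av enormZ gtr0_norm.
have e2 : enorm (Y (y t)) = t * enorm (b t) by rewrite bv enormZ gtr0_norm.
have e3 : dot (f (y t) - p) (Vfield (Y (y t))) = t * (t * dot (a t) (Vfield (b t))).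
  by rewrite av bv VfieldZ dotZl dotZr.
rewrite e1 e2 e3 !normrM !(gtr0_norm t0) in hb.
move: h hb; move: `|dot _ _| (enorm (a t)) (enorm (b t)) (C) => q x z k h.
have -> : 2 * k * (t * x * (t * x)) * (t * z) = t * (t * (2 * k * t * (x * x * z))) by ring.
by rewrite !ler_pM2l// leNgt h.
Qed.

(** With w = (a, c): if B B w = 0 then 2 B w = (det B) w by Cayley-Hamilton, the trace being 2,
    so that B w is parallel to w. *)
Lemma trace_algebra (a c b11 b12 b21 b22 : R) : b11 + b22 = 2 ->
  (a * b11 + c * b12) * b11 + (a * b21 + c * b22) * b12 = 0 ->
  (a * b11 + c * b12) * b21 + (a * b21 + c * b22) * b22 = 0 ->
  c * (a * b11 + c * b12) - a * (a * b21 + c * b22) = 0.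
Proof.
move=> tr; have -> : b22 = 2 - b11 by rewrite -tr addrC addKr.
set x := a * b11 + c * b12; set y := a * b21 + c * (2 - b11) => e1 e2.
have h1 : 2 * x = a * (b11 * (2 - b11) - b12 * b21).
  have -> : 2 * x = (x * b11 + y * b12) + (x * (2 - b11) - y * b12) by ring.
  by rewrite e1 /x /y; ring.
have h2 : 2 * y = c * (b11 * (2 - b11) - b12 * b21).
  have -> : 2 * y = (x * b21 + y * (2 - b11)) + (y * b11 - x * b21) by ring.
  by rewrite e2 /x /y; ring.
have : 2 * (c * x - a * y) = 0.
  have -> : 2 * (c * x - a * y) = c * (2 * x) - a * (2 * y) by ring.
  by rewrite h1 h2; ring.
move: (c * x - a * y) => z; lra.
Qed.

Lemma horizontal_basis w : dot w p = 0 -> dot w (Vfield p) = 0 ->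
  w = dot w (E1 p) *: E1 p + dot w (E2 p) *: E2 p.
Proof.
by move=> wp wV; have := frame_expand p w; rewrite pp scale1r wp wV !scale0r !add0r.
Qed.

Lemma frame_dots : [/\ dot (E1 p) (E1 p) = 1, dot (E2 p) (E2 p) = 1, dot (E1 p) (E2 p) = 0 &
  dot (E2 p) (E1 p) = 0].
Proof. by rewrite E2V dotVV dotV0 dotV0' dotE1E1 pp. Qed.

(** Otherwise the flow lines through points approaching in the direction w would converge to a
    full flow line through the singular point, along which the characteristic field is continuous;
    but i N_h is a positive multiple of it on both sides, so its derivative B e is both a nonnegative
    and a nonpositive multiple of e, hence 0; this is excluded by the trace. *)
Lemma operator_eigen w : dot w w = 1 -> dot w p = 0 -> dot w (Vfield p) = 0 ->
  dot w (Vfield (B w)) = 0.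
Proof.
move=> ww wp wV; apply/eqP/negPn/negP => m0.
have Bw0 : B w != 0 by apply: contraNneq m0 => ->; rewrite Vfield0 dot0r.
have [y ay] := approach_exists ww wp wV Bw0.
have nh := approach_no_hit m0 ay; have [nK cf cZ _ _] := ay.
set e := (enorm (B w))^-1 *: B w in cZ.
have [Bp BV] := BopP w.
have U : unitary_pair (p, e).
  split => //=; rewrite /e.
  - rewrite dotZl dotZr -enorm_sqr; have := enorm_gt0 Bw0.
    by move: (enorm _) => k k0; field; rewrite gt_eqF.
  - by rewrite dotZl Bp mulr0.
  - by rewrite dotZl BV mulr0.
have lim s : 0 < `|s| <= r -> exists x, [/\ K x, x <> x0 & st x = Phi H s (p, e)].
  move=> /andP[s0 sr]; pose kap : R := Num.sg s.
  have k1 : `|kap| = 1 by rewrite /kap normr_sg -normr_gt0 s0.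
  have sE : s = kap * `|s| by rewrite -numEsg.
  have [||x [Kx xx] E] := @limit_orbit kap e `|s| k1 U; first by rewrite s0.
    move=> d d0.
    have nn (l : 'rV[R]_4) : nbhs l (fun z => `|z - l| < d).
      by apply/nbhs_eps; exists d => // z; rewrite distrC.
    have m1 : \forall t \near (0 : R)^'+, `|f (y t) - p| < d by exact: (cf _ (nn _)).
    have m2 : \forall t \near (0 : R)^'+, `|Z (y t) - e| < d by exact: (cZ _ (nn _)).
    have n3 : \forall t \near (0 : R)^'+,
        ((K (y t) /\ y t <> x0) /\ `|f (y t) - p| < d) /\ (`|Z (y t) - e| < d /\
        forall s, `|s| <= 2 * r -> geo H (f (y t)) (Z (y t)) s <> p).
      exact (filterI (filterI nK m1) (filterI m2 nh)).
    have [t [[[Ky yx] h1] [h2 h3]]] := @filter_ex _ _ (at_right_proper_filter 0) _ n3.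
    exists (y t); split => // t' /andP[t'0 t'r]; apply: h3.
    rewrite normrM k1 mul1r ger0_norm//; lra.
  by exists x; split => //; rewrite sE.
pose P s := [set x | [/\ K x, x <> x0 & st x = Phi H s (p, e)]].
pose k s := xget x0 (P s).
have [cK inj Kx e0 nK'] := tK.
have k0 : k 0 = x0.
  apply: xgetPN => x [Kx1 xx]; rewrite Phi0 => -[fx _]; apply: xx; exact: inj.
have kP s : 0 < `|s| <= r -> P s (k s) by move=> hs; apply: xgetPex; exact: lim.
have fk s : `|s| <= r -> f (k s) = geo H p e s /\ K (k s).
  move=> sr; have [->|s0] := eqVneq s 0; first by rewrite k0 geo0.
  by have [|Kk _ [-> _]] := kP s; first by rewrite normr_gt0 s0.
have nr : \forall s \near (0 : R), `|s| <= r.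
  by apply/nbhs_eps; exists r => // s; rewrite sub0r normrN => /ltW.
have dgeo_c (s : R) : is_derive s 1 (geo H p e) (dgeo H p e s) := is_derive_geo H p e s.
have ck : {for (0 : R), continuous k}.
  move=> W; rewrite k0 => nW.
  have [d d0 Hd] := compact_inverse_continuous (immersion_continuous hM hf) cK inj Kx nW.
  have n1 : \forall s \near (0 : R), `|s| < d.
    by apply/nbhs_eps; exists d => // s; rewrite sub0r normrN.
  have : \forall s \near (0 : R), W (k s).
    apply: filterS2 nr n1 => s sr sd; have [fE Kk] := fk s sr.
    apply: Hd => //; rewrite fE; apply: le_lt_trans sd.
    by have := geo_lip H s 0 U; rewrite geo0 subr0.
  by [].
have Dk : is_derive (0 : R) 1 (f \o k) e.
  have nE : \forall s \near (0 : R), geo H p e s = (f \o k) s.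
    by apply: filterS nr => s sr; exact (esym (fk s sr).1).
  have dg : is_derive (0 : R) 1 (geo H p e) e by rewrite -{2}(dgeo0 H p e); exact: dgeo_c.
  exact: (near_eq_is_derive nE dg).
have DY := curve_derivative ck k0 Dk.
have S := slope_cvg DY; rewrite k0 singular_Nh Vfield0 in S.
have S' : s^-1 *: Y (k s) @[s --> (0 : R)^'] --> B e by move: S; under eq_fun do rewrite subr0.
have cdg : dgeo H p e s @[s --> (0 : R)^'] --> e.
  have [_ h] := @cvg_flow R H R (nbhs (0 : R)) _ (fun=> p) (fun=> e) id p e 0 (cvg_cst _) (cvg_cst _) cvg_id.
  by rewrite dgeo0 in h; move=> Q nQ; exact: (@filterS _ (nbhs (0 : R)) _ _ (fun s => s != 0 -> Q (dgeo H p e s)) (fun s Qs _ => Qs) (h Q nQ)).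
have YE s : 0 < `|s| <= r -> Y (k s) = enorm (Y (k s)) *: dgeo H p e s.
  by move=> hs; have [_ _ [_ <-]] := kP s hs; exact: Y_scale.
have R1 : B e = enorm (B e) *: e.
  have c1 := cvg_dnbhs_at_right S'; have c2 := cvg_dnbhs_at_right cdg.
  have c3 : enorm (s^-1 *: Y (k s)) *: dgeo H p e s @[s --> (0 : R)^'+] --> enorm (B e) *: e.
    exact (cvgZ (cvg_enorm c1) c2).
  apply: (cvg_unique _ c1); first exact: norm_hausdorff.
  apply: cvg_trans c3; apply: near_eq_cvg.
  have n2 : \forall t \near (0 : R)^'+, 0 < t by exact: nbhs_right_gt.
  apply: filterS2 (nb nr) n2 => s sr s0.
  by rewrite [in RHS]YE ?normr_gt0 ?gt_eqF// enormZ gtr0_norm ?invr_gt0// scalerA.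
have R2 : B e = - enorm (B e) *: e.
  have c1 := cvg_dnbhs_at_left S'; have c2 := cvg_dnbhs_at_left cdg.
  have c3 : - enorm (s^-1 *: Y (k s)) *: dgeo H p e s @[s --> (0 : R)^'-] --> - enorm (B e) *: e.
    exact (cvgZ (cvgN (cvg_enorm c1)) c2).
  apply: (cvg_unique _ c1); first exact: norm_hausdorff.
  apply: cvg_trans c3; apply: near_eq_cvg.
  have n2 : \forall t \near (0 : R)^'-, t < 0 by exact: nbhs_left_lt.
  have nr' : \forall s \near (0 : R)^'-, `|s| <= r by apply: filterS nr => s sr _.
  apply: filterS2 nr' n2 => s sr s0.
  rewrite [in RHS]YE ?normr_gt0 ?lt_eqF// enormZ ltr0_norm ?invr_lt0// scalerA.
  by rewrite mulNr opprK.
have Be0 : B e = 0.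
  move: R1 R2; move: (enorm (B e)) => c R1 R2.
  have : B e + B e = 0 by rewrite {1}R1 R2 scaleNr addrN.
  by rewrite -mulr2n -scaler_nat => /eqP; rewrite scaler_eq0 pnatr_eq0 /= => /eqP.
have BBw : B (B w) = 0.
  have : B w = enorm (B w) *: e by rewrite /e scalerA divff ?scale1r// gt_eqF// enorm_gt0.
  move: (enorm _) => c E; exact (etrans (congr1 _ E) (etrans (BopZ c e) (etrans (congr1 _ Be0) (scaler0 _ _)))).
have [f11 f22 f12 f21] := frame_dots.
case: be1H be2H => p1 V1 [p2 V2].
have wE := horizontal_basis wp wV.
have bE1 := horizontal_basis p1 V1; have bE2 := horizontal_basis p2 V2.
move/eqP: m0; apply.
have := congr1 (fun z => dot z (E1 p)) BBw; have := congr1 (fun z => dot z (E2 p)) BBw.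
have V12 : Vfield (E1 p) = E2 p by rewrite E2V.
have V21 : Vfield (E2 p) = - E1 p by rewrite E2V VfieldK.
have -> : dot w (Vfield (B w)) = dot w (E2 p) * dot (B w) (E1 p) - dot w (E1 p) * dot (B w) (E2 p).
  rewrite {1}(horizontal_basis Bp BV) VfieldD !VfieldZ V12 V21 dotDr !dotZr dotNr; ring.
rewrite /B !dotDl !dotZl !dot0l.
have := trace_algebra (a := dot w (E1 p)) (c := dot w (E2 p)) trace2.
move: (dot w (E1 p)) (dot w (E2 p)) (dot be1 (E1 p)) (dot be1 (E2 p)) (dot be2 (E1 p)) (dot be2 (E2 p)).
move=> a c b11 b21 b12 b22 h e2 e1.
have := h b12 b21 e1 e2; lra.
Qed.

(** All the horizontal vectors are eigenvectors, and the trace is 2. Three directions suffice. *)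
Lemma operator_id : be1 = E1 p /\ be2 = E2 p.
Proof.
have [f11 f22 f12 f21] := frame_dots.
case: be1H be2H => p1 V1 [p2 V2].
have bE1 := horizontal_basis p1 V1; have bE2 := horizontal_basis p2 V2.
have V12 : Vfield (E1 p) = E2 p by rewrite E2V.
have V21 : Vfield (E2 p) = - E1 p by rewrite E2V VfieldK.
have key (a c : R) : a ^+ 2 + c ^+ 2 = 1 ->
   c * (a * dot be1 (E1 p) + c * dot be2 (E1 p)) - a * (a * dot be1 (E2 p) + c * dot be2 (E2 p)) = 0.
  move=> ac; pose w := a *: E1 p + c *: E2 p.
  have ww : dot w w = 1 by rewrite -ac dot_lincomb f11 f22 f12 f21; ring.
  have wp : dot w p = 0 by rewrite /w dotDl !dotZl dotE1p dotE2p; ring.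
  have wV : dot w (Vfield p) = 0 by rewrite /w dotDl !dotZl dotE1V dotE2V; ring.
  have w1 : dot w (E1 p) = a by rewrite /w dotDl !dotZl f11 f21; ring.
  have w2 : dot w (E2 p) = c by rewrite /w dotDl !dotZl f22 f12; ring.
  rewrite -(operator_eigen ww wp wV) /B w1 w2.
  rewrite bE1 bE2 !VfieldD !VfieldZ !VfieldD !VfieldZ V12 V21.
  rewrite !dotDr !dotZr !dotDr !dotZr !dotNr w1 w2 !dotDl !dotZl f11 f22 f12 f21; ring.
(* A rational point of the circle off the axes. *)
have k1 := key 1 0; have k2 := key 0 1; have k3 := key (3 / 5) (4 / 5).
have b21 : dot be1 (E2 p) = 0 by have := k1 (ltac:(ring)); lra.
have b12 : dot be2 (E1 p) = 0 by have := k2 (ltac:(ring)); lra.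
have b11 : dot be1 (E1 p) = dot be2 (E2 p).
  have := k3 (ltac:(field)); rewrite b21 b12; lra.
have t1 : dot be1 (E1 p) = 1 by move: trace2; rewrite b11; lra.
split; first by rewrite bE1 t1 b21 scale1r scale0r addr0.
by rewrite bE2 -b11 t1 b12 scale1r scale0r add0r.
Qed.
End IsolatedPoint.

(** * The disc around an isolated singular point *)

(** With v = q - p: the component of v on p is - |v|^2 / 2, at most |v| / 10, and the errors
    1 / 15, 1 / 30 and 1 / 10 add up to 1 / 5. *)
Lemma radial_estimate (R : realType) (p q y : 'rV[R]_4) : dot p p = 1 -> dot q q = 1 ->
  enorm (q - p) <= 1 / 5 ->
  enorm (y - (dot (q - p) (E1 p) *: E1 p + dot (q - p) (E2 p) *: E2 p)) <= 1 / 15 * enorm (q - p) ->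
  `|dot (q - p) (Vfield p)| <= 1 / 30 * enorm (q - p) ->
  4 / 5 * (enorm (q - p) * enorm (q - p)) <= dot (q - p) y /\ enorm y <= 6 / 5 * enorm (q - p).
Proof.
move=> pp qq; set v := q - p; set h := _ *: _ + _ *: _; set rho := enorm v => r5 h1 h2.
have rr : dot v v = rho * rho by rewrite -expr2 enorm_sqr.
have vp : dot v p = - (rho * rho) / 2.
  have : dot v v = 2 - 2 * dot q p.
    by rewrite /v !dotDl !dotDr !dotNl !dotNr pp qq (dotC p q); ring.
  by rewrite rr /v dotDl dotNl pp => ->; field.
have E : v = dot v p *: p + dot v (Vfield p) *: Vfield p + h.
  by have := frame_expand p v; rewrite pp scale1r addrA.
pose w := y - v.
have hw : enorm w <= 1 / 5 * rho.
  have -> : w = (y - h) - dot v p *: p - dot v (Vfield p) *: Vfield p.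
    have aux (a b c d : 'rV[R]_4) : d - (a + b + c) = d - c - a - b.
      by apply: rv4P; rewrite !crdE; ring.
    by rewrite /w {1}E aux.
  apply: (le_trans (enormD _ _)); rewrite enormN enormZ enormV (enorm1 pp) mulr1.
  have := enormD (y - h) (- (dot v p *: p)); rewrite enormN enormZ (enorm1 pp) mulr1.
  have r0 : 0 <= rho by exact: enorm_ge0.
  have -> : `|dot v p| = rho * rho / 2.
    by rewrite vp mulNr normrN ger0_norm// divr_ge0// mulr_ge0.
  have := ler_wpM2r r0 r5; move: h1 h2; rewrite -/rho.
  move: (enorm (y - h)) (`|_|) (rho * rho) (enorm _) (enorm _) => *; lra.
have yE : y = v + w by rewrite /w addrC subrK.
split.
  rewrite yE dotDr rr.
  have : `|dot v w| <= rho * (1 / 5 * rho).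
    apply: (le_trans (dot_le_enorm _ _)); apply: ler_wpM2l => //; exact: enorm_ge0.
  have -> : rho * (1 / 5 * rho) = 1 / 5 * (rho * rho) by ring.
  rewrite ler_norml => /andP[+ _]; move: (dot v w) (rho * rho) => *; lra.
by rewrite yE; apply: (le_trans (enormD _ _)); rewrite -/rho; move: hw; move: (enorm w) => *; lra.
Qed.

Section Rays.
Variables (R : realType) (M : topologicalType) (A : set (chart R M)) (f N : M -> 'rV[R]_4).
Hypotheses (hM : C2_surface A) (hf : C2_immersion_S3 A f) (hN : unit_normal A f N).
Variable H : R.
Local Notation Z := (char_field f N).
Local Notation st := (state f N).
Local Notation reg x := (Nh f N x != 0).
Hypothesis hH : forall x, reg x -> has_mean_curvature A f N x H.
Variable x0 : M.
Local Notation p := (f x0).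
Hypothesis Nx0 : N x0 = Vfield p.
Local Notation C := (flow_acc H).
Local Notation Y x := (Vfield (Nh f N x)).
Hypothesis expansion : forall e : R, 0 < e -> \forall y \near x0,
  `|Y y - (dot (f y - p) (E1 p) *: E1 p + dot (f y - p) (E2 p) *: E2 p)| <= e * `|f y - p| /\
  `|dot (f y - p) (Vfield p)| <= e * `|f y - p|.
Hypothesis curves : forall w, dot w p = 0 -> dot w (Vfield p) = 0 -> exists y : R -> M,
  [/\ {for 0, continuous y}, y 0 = x0 & is_derive (0 : R) 1 (f \o y) w].

Let pp : dot p p = 1. Proof. exact: (sphere hf). Qed.

Lemma cvg_enorm_near (d : R) : 0 < d -> \forall y \near x0, enorm (f y - p) < d.
Proof.
move=> d0; have fc := immersion_continuous hM hf.
have : \forall y \near x0, `|f y - p| < d / 2.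
  have n : nbhs p (fun z => `|z - p| < d / 2).
    by apply/nbhs_eps; exists (d / 2); [rewrite divr_gt0|move=> z; rewrite distrC].
  exact: (fc x0 _ n).
by apply: filterS => y h; apply: (le_lt_trans (enorm_le_norm _)); move: h; move: `|_| => *; lra.
Qed.

(** The operator being the identity, the characteristic field is almost radial. *)
Lemma char_field_radial : \forall y \near x0, reg y ->
  1 / 2 * enorm (f y - p) <= dot (f y - p) (Z y).
Proof.
have e30 : (0 : R) < 1 / 30 by lra.
have e5 : (0 : R) < 1 / 5 by lra.
apply: filterS2 (expansion e30) (cvg_enorm_near e5) => y [h1 h2] h3 ry.
have hn := norm_le_enorm (f y - p).
have [||h4 h5] := @radial_estimate R p (f y) (Y y) pp (sphere hf y) (ltW h3).
- apply: (le_trans (enorm_le_norm _)); move: h1 hn.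
  by move: `|_| `|f y - p| (enorm _) => *; lra.
- by apply: (le_trans h2); move: hn; move: `|_| (enorm _) => *; lra.
have y0 : 0 < enorm (Y y) by rewrite enormV enorm_gt0.
rewrite Z_scale dotZr -(ler_pM2l y0) mulVKf ?gt_eqF//.
apply: le_trans h4.
have := ler_wpM2r (enorm_ge0 (f y - p)) h5.
move: (enorm (f y - p)) (enorm (Y y)) => a b h.
have := sqr_ge0 a; rewrite expr2.
have -> : b * (1 / 2 * a) = 1 / 2 * (b * a) by ring.
have E : 6 / 5 * a * a = 6 / 5 * (a * a) by ring.
rewrite E in h; move: (a * a) (b * a) h => *; lra.
Qed.

Variables (K : set M) (eta r : R).
Hypotheses (tK : trap f x0 K eta) (rK : forall y, K y -> y <> x0 -> reg y).
Hypotheses (r0 : 0 < r) (rC : 8 * C * r <= 1) (reta : 4 * r <= eta).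
Hypothesis radK : forall y, K y -> y <> x0 -> 1 / 2 * enorm (f y - p) <= dot (f y - p) (Z y).

(** Close to the singular point the distance to it decreases at unit rate, up to a
    factor, along backward flow lines; so these reach it in finite time. *)
Lemma ray_through y : K y -> y <> x0 -> enorm (f y - p) < r / 3 ->
  exists e t, [/\ unitary_pair (p, e), 0 < t <= 3 * enorm (f y - p) & st y = Phi H t (p, e)].
Proof.
move=> Ky yx hr; have ry := rK Ky yx; have U := state_unitary hf hN ry.
have [cK inj Kx eta0 nK] := tK.
have rho0 : 0 < enorm (f y - p).
  by apply: enorm_gt0; rewrite subr_eq0; apply/eqP => E; apply: yx; exact: inj.
(* At a rate of at least 1 / 2 the distance would be negative at this time. *)
pose T := 3 * enorm (f y - p).
have T0 : 0 < T by rewrite /T mulr_gt0.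
have Tr : T <= r by rewrite /T; lra.
have [[t [/andP[t0 tT] ht]]|nh] := pselect (exists t, 0 <= t <= T /\ geo H (f y) (Z y) (- t) = p).
  have tn : t != 0.
    by apply/eqP => te; apply: yx; apply: inj => //; rewrite -ht te oppr0 geo0.
  exists (dgeo H (f y) (Z y) (- t)), t; split.
  - by have := unitary_Phi H (- t) U; rewrite /Phi /= ht.
  - by rewrite lt_neqAle eq_sym tn t0.
  - by rewrite -[in RHS]ht; have := PhiK H (- t) (st y); rewrite opprK.
have fy : `|f y - p| < eta / 2.
  by apply: (le_lt_trans (norm_le_enorm _)); apply: (lt_le_trans hr); move: reta r0; lra.
have st_y t : 0 <= t <= T -> exists2 y', K y' /\ y' <> x0 & st y' = Phi H (- t) (st y).
  move=> /andP[t0 tT]; rewrite -mulN1r.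
  apply: (orbit_in_trap hM hf hN hH tK rK (singular_Nh hf Nx0)) => //; first by rewrite normrN normr1.
  move=> s /andP[s0 sT]; split; last by rewrite mulN1r => E; apply: nh; exists s; rewrite s0 (le_trans sT).
  by apply: (stay hf hN H r0 reta) => //; rewrite ?normrN ?normr1// s0 (le_trans sT)// (le_trans tT).
pose g t := dot (geo H (f y) (Z y) (- t) - p) (geo H (f y) (Z y) (- t) - p).
pose dg t := - 2 * dot (geo H (f y) (Z y) (- t) - p) (dgeo H (f y) (Z y) (- t)).
have Dg (t : R) : is_derive t 1 g (dg t).
  have Dn : is_derive t 1 (fun t : R => - t) (- 1) by exact: (is_deriveN (is_derive_id t 1)).
  pose g0 s := dot (geo H (f y) (Z y) s - p) (geo H (f y) (Z y) s - p).
  have D1 : is_derive (- t) 1 g0 (2 * dot (geo H (f y) (Z y) (- t) - p) (dgeo H (f y) (Z y) (- t))).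
    have D2 := is_deriveB (is_derive_geo H (f y) (Z y) (- t)) (is_derive_cst p (- t) 1).
    apply: (is_derive_eq (is_derive_dot D2 D2)); rewrite subr0 /=.
    by rewrite (dotC (dgeo _ _ _ _)); ring.
  apply: (is_derive_eq (is_derive1_comp D1 Dn)); rewrite /dg /GRing.scale/=; ring.
have gpos t : 0 <= t <= T -> 0 < g t.
  move=> ht; rewrite /g dot_gt0// subr_eq0; apply/eqP => E; apply: nh; by exists t.
have slope t : 0 <= t <= T -> dg t <= - enorm (geo H (f y) (Z y) (- t) - p).
  move=> ht; have [y' [Ky' y'x] E] := st_y t ht.
  have := radK Ky' y'x; have := congr1 fst E; have := congr1 snd E => /= -> ->.
  rewrite /dg; move: (dot _ _) (enorm _) => *; lra.
have Ds (t : R) : 0 <= t <= T -> is_derive t 1 (fun t => Num.sqrt (g t)) (dg t * (2 * Num.sqrt (g t))^-1).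
  move=> ht; apply: (is_derive_eq (is_derive1_comp (is_derive1_sqrt (gpos t ht)) (Dg t))).
  by rewrite /GRing.scale/= mulrC.
have [c /andP[c0 cT] E] := MVT_derive T0 Ds.
have hc : 0 <= c <= T by rewrite !ltW.
have s0 : 0 < Num.sqrt (g c) by rewrite sqrtr_gt0 gpos.
have : dg c * (2 * Num.sqrt (g c))^-1 <= - (1 / 2).
  rewrite ler_pdivrMr ?mulr_gt0//; have := slope c hc; rewrite -/(enorm _) /enorm -/(g c).
  by move: (dg c) (Num.sqrt (g c)) => *; lra.
move=> h; rewrite subr0 in E; have := ler_wpM2r (ltW T0) h; rewrite -E.
have -> : Num.sqrt (g 0) = enorm (f y - p) by rewrite /g oppr0 geo0.
move: (sqrtr_ge0 (g T)) rho0; rewrite {3}/T; move: (Num.sqrt (g T)) => a.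
by move: (enorm (f y - p)) => b; lra.
Qed.

(** Every direction at the singular point is taken by a flow line in the surface. *)
Lemma ray_exists e t : unitary_pair (p, e) -> 0 < t <= r ->
  exists2 y, K y /\ y <> x0 & st y = Phi H t (p, e).
Proof.
move=> U tr; have [_ ee ep eV] := U; rewrite /= in ee ep eV.
rewrite -[t]mul1r; apply: (limit_orbit hM hf hN hH tK rK Nx0 r0 rC reta) => //; first exact: normr1.
move=> d d0.
have Be : horizontal_operator f x0 (E1 p) (E2 p) e = e.
  by rewrite /horizontal_operator -(horizontal_basis hf).
have [|y [nK cf cZ _ _]] := approach_exists hM hf tK Nx0 expansion curves ee ep eV.
  by rewrite Be; apply/eqP => e0; move: ee; rewrite e0 dot0l => /eqP; rewrite eq_sym oner_eq0.
rewrite Be enorm1// invr1 scale1r in cZ.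
have nn (l : 'rV[R]_4) (k : R) : 0 < k -> nbhs l (fun z => `|z - l| < k).
  by move=> k0; apply/nbhs_eps; exists k => // z; rewrite distrC.
have r6 : 0 < r / 6 by lra.
have m1 : \forall t \near (0 : R)^'+, `|f (y t) - p| < d by exact: (cf _ (nn _ d d0)).
have m2 : \forall t \near (0 : R)^'+, `|Z (y t) - e| < d by exact: (cZ _ (nn _ d d0)).
have m3 : \forall t \near (0 : R)^'+, `|f (y t) - p| < r / 6 by exact: (cf _ (nn _ _ r6)).
have n3 : \forall t \near (0 : R)^'+, ((K (y t) /\ y t <> x0) /\ `|f (y t) - p| < d) /\
    (`|Z (y t) - e| < d /\ `|f (y t) - p| < r / 6) by exact (filterI (filterI nK m1) (filterI m2 m3)).
have [u [[[Ky yx] h1] [h2 h3]]] := @filter_ex _ _ (at_right_proper_filter 0) _ n3.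
exists (y u); split => // s /andP[s0 sr].
have h4 : enorm (f (y u) - p) < r / 3.
  by apply: (le_lt_trans (enorm_le_norm _)); move: h3; move: `|_| => *; lra.
have [e' [t' [U' /andP[t'0 t'r] E]]] := ray_through Ky yx h4.
have {}t'r : t' <= r by apply: (le_trans t'r); move: h4; move: (enorm _) => *; lra.
rewrite mul1r; have -> : geo H (f (y u)) (Z (y u)) s = (Phi H s (st (y u))).1 by [].
rewrite E PhiD /=; apply: (no_return rC U'); first by rewrite gt_eqF// ltr_pwDl.
by rewrite ger0_norm; lra.
Qed.
End Rays.

(** Around an isolated singular point, with upward normal, the surface is the union
    of the flow lines issuing from it in all the horizontal directions. *)
Lemma isolated_structure (R : realType) (M : topologicalType) (A : set (chart R M))
    (f N : M -> 'rV[R]_4) (H : R) (x0 : M) (W : set M) :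
  C2_surface A -> C2_immersion_S3 A f -> unit_normal A f N ->
  (forall x, Nh f N x != 0 -> has_mean_curvature A f N x H) ->
  N x0 = Vfield (f x0) -> nbhs x0 W -> (forall y, W y -> y <> x0 -> Nh f N y != 0) ->
  exists (K : set M) (r : R), [/\ [/\ compact K, injective_on f K & nbhs x0 K], forall y, K y -> y <> x0 -> Nh f N y != 0, 0 < r,
    forall e t, unitary_pair (f x0, e) -> 0 < t <= r ->
      exists2 y, K y /\ y <> x0 & state f N y = Phi H t (f x0, e) &
    \forall y \near x0, y <> x0 -> exists e t,
      [/\ unitary_pair (f x0, e), 0 < t <= 3 * enorm (f y - f x0) & state f N y = Phi H t (f x0, e)]].
Proof.
move=> hM hf hN hH Nx0 nW WR.
have [be1 [be2 [ex cu b1 b2 tr]]] := singular_expansion hM hf hN Nx0.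
have rmin (eta : R) : 0 < eta -> exists2 r : R, 0 < r & 8 * flow_acc H * r <= 1 /\ 4 * r <= eta.
  move=> e0; have C0 := flow_acc_gt0 H; exists (Num.min (1 / (8 * flow_acc H)) (eta / 4)).
    by rewrite lt_min !divr_gt0// mulr_gt0.
  split; last first.
    have : Num.min (1 / (8 * flow_acc H)) (eta / 4) <= eta / 4 by rewrite ge_min lexx orbT.
    by move: (Num.min _ _) => *; lra.
  have : Num.min (1 / (8 * flow_acc H)) (eta / 4) <= 1 / (8 * flow_acc H) by rewrite ge_min lexx.
  by rewrite ler_pdivlMr ?mulr_gt0// mulrC.
have [K0 [eta0 [tK0 K0W]]] := trap_exists hM hf nW.
have rK0 y : K0 y -> y <> x0 -> Nh f N y != 0 by move=> /K0W; exact: WR.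
have [r1 r10 [rC1 re1]] := rmin eta0 (ltac:(by case: tK0)).
have [E1p E2p] := operator_id hM hf hN hH tK0 rK0 Nx0 r10 rC1 re1 ex cu b1 b2 tr.
rewrite {}E1p {}E2p in ex.
have rad := char_field_radial hM hf ex.
have [K [eta [tK KW]]] := trap_exists hM hf (filterI nW rad).
have rK y : K y -> y <> x0 -> Nh f N y != 0 by move=> /KW[+ _]; exact: WR.
have radK y : K y -> y <> x0 -> 1 / 2 * enorm (f y - f x0) <= dot (f y - f x0) (char_field f N y).
  by move=> Ky yx; have [_] := KW y Ky; apply; exact: rK.
have [cK inj Kx e0 nK] := tK.
have [r r0 [rC re]] := rmin eta e0.
have nKx : nbhs x0 K by apply: nK => //; rewrite subrr normr0.
exists K, r; split => //.
  by move=> e t U tr'; exact: (ray_exists hM hf hN hH Nx0 ex cu tK rK r0 rC re radK U tr').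
have r3 : 0 < r / 3 by lra.
have n3 : \forall y \near x0, enorm (f y - f x0) < r / 3 by exact: (cvg_enorm_near hM hf).
have nK' : \forall y \near x0, K y by exact: nKx.
apply: filterS2 nK' n3 => y Ky hy yx.
exact: (ray_through hM hf hN hH Nx0 tK rK r0 re radK Ky yx hy).
Qed.

(** * Lifts of curves through an immersion *)

Lemma is_derive_eps (R : realType) (W : normedModType R) (g : R -> W) (t : R) a :
  (forall e : R, 0 < e -> exists2 d : R, 0 < d & forall h : R, `|h| < d ->
    `|g (t + h) - g t - h *: a| <= e * `|h|) -> is_derive t 1 g a.
Proof.
move=> H.
have lim : h^-1 *: ((g \o shift t) (h *: (1 : R)) - g t) @[h --> (0 : R)^'] --> a.
  move=> W' /nbhs_eps[e e0 He].
  have [d d0 Hd] := H (e / 2) (divr_gt0 e0 (ltr0n R 2)).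
  have n : \forall h \near (0 : R), h != 0 -> W' (h^-1 *: ((g \o shift t) (h *: (1 : R)) - g t)).
    apply/nbhs_eps; exists d => // h; rewrite sub0r normrN => hd h0; apply: He.
    have := Hd h hd; have -> : h *: (1 : R) = h by exact: mulr1.
    rewrite /= (addrC h) => hh.
    have -> : a - h^-1 *: (g (t + h) - g t) = - (h^-1 *: (g (t + h) - g t - h *: a)).
      by rewrite [in RHS]scalerBr scalerA mulVf// scale1r opprB.
    rewrite normrN normrZ normfV ltr_pdivrMl ?normr_gt0//.
    apply: (le_lt_trans hh); rewrite mulrC ltr_pM2l ?normr_gt0//; lra.
  exact: n.
split; first by apply/cvg_ex; exists a.
exact: cvg_lim lim.
Qed.

Section LeftInverse.
Variable R : realType.
Implicit Types (D E w : 'rV[R]_4).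

(** The determinant of the first fundamental form; the dual vectors below give the coordinates
    of a tangent vector by formulas that are visibly continuous in the frame. *)
Definition gram (D0 D1 : 'rV[R]_4) : R := dot D0 D0 * dot D1 D1 - dot D0 D1 * dot D0 D1.
Definition dual0 (D0 D1 : 'rV[R]_4) := (gram D0 D1)^-1 *: (dot D1 D1 *: D0 - dot D0 D1 *: D1).
Definition dual1 (D0 D1 : 'rV[R]_4) := (gram D0 D1)^-1 *: (dot D0 D0 *: D1 - dot D0 D1 *: D0).
Definition dual_coords (D0 D1 w : 'rV[R]_4) : 'rV[R]_2 :=
  dot w (dual0 D0 D1) *: b0 + dot w (dual1 D0 D1) *: b1.

Lemma gram_neq0 D0 D1 : (forall x y : R, x *: D0 + y *: D1 = 0 -> x = 0 /\ y = 0) ->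
  gram D0 D1 != 0.
Proof.
move=> indep; have D10 : D1 != 0.
  apply/eqP => z; have [|_ /eqP] := indep 0 1; first by rewrite z scaler0 scale0r addr0.
  by rewrite oner_eq0.
have := gram_pos D10 indep; rewrite (dotC D1 D0) /gram => h; rewrite gt_eqF// subr_gt0.
have E : (dot D0 D1 + dot D0 D1) ^+ 2 = 4 * (dot D0 D1 * dot D0 D1) by ring.
by move: h; rewrite E -mulrA ltr_pM2l.
Qed.

Lemma dual_coordsK D0 D1 (x y : R) : gram D0 D1 != 0 ->
  dual_coords D0 D1 (x *: D0 + y *: D1) = x *: b0 + y *: b1.
Proof.
move=> g0; rewrite /dual_coords /dual0 /dual1 !dotZr !dotDr !dotNr !dotZr !dotDl !dotZl (dotC D1 D0).
move: g0; rewrite /gram; move: (dot D0 D0) (dot D0 D1) (dot D1 D1) => a b c g0.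
by congr (_ *: _ + _ *: _); field; rewrite subr_eq0 in g0 *.
Qed.

Lemma dual_coords_lin D0 D1 (k : R) w v :
  dual_coords D0 D1 (w - k *: v) = dual_coords D0 D1 w - k *: dual_coords D0 D1 v.
Proof.
rewrite /dual_coords !dotDl !dotNl !dotZl; move: (dot _ _) (dot _ _) (dot _ _) (dot _ _) => a b c d.
by apply/rowP => i; rewrite !mxE; ring.
Qed.

Lemma dual_coords_bound D0 D1 : exists2 k : R, 0 < k & forall w, `|dual_coords D0 D1 w| <= k * `|w|.
Proof.
pose b : R := `|dual0 D0 D1|; pose c : R := `|dual1 D0 D1|.
pose x : R := `|b0 : 'rV[R]_2|; pose y : R := `|b1 : 'rV[R]_2|.
have k0 : 0 <= 4 * b * x + 4 * c * y by rewrite addr_ge0// !mulr_ge0// normr_ge0.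
exists (1 + (4 * b * x + 4 * c * y)); first by rewrite ltr_pwDl.
move=> w; rewrite /dual_coords; apply: (le_trans (ler_normD _ _)); rewrite !normrZ.
have h0 : `|dot w (dual0 D0 D1)| * x <= 4 * `|w| * b * x.
  exact: (ler_wpM2r (normr_ge0 _) (dot_le_norm w (dual0 D0 D1))).
have h1 : `|dot w (dual1 D0 D1)| * y <= 4 * `|w| * c * y.
  exact: (ler_wpM2r (normr_ge0 _) (dot_le_norm w (dual1 D0 D1))).
apply: (le_trans (lerD h0 h1)); have a0 : 0 <= `|w| by [].
have -> : 4 * `|w| * b * x + 4 * `|w| * c * y = (4 * b * x + 4 * c * y) * `|w| by ring.
by apply: ler_wpM2r => //; rewrite lerDr.
Qed.

Lemma cvg_dual_coords (T : Type) (Fl : set_system T) {FF : Filter Fl} (d0 d1 w : T -> 'rV[R]_4) D0 D1 v :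
  gram D0 D1 != 0 -> d0 @ Fl --> D0 -> d1 @ Fl --> D1 -> w @ Fl --> v ->
  dual_coords (d0 t) (d1 t) (w t) @[t --> Fl] --> dual_coords D0 D1 v.
Proof.
move=> g0 h0 h1 hw.
have c00 : dot (d0 t) (d0 t) @[t --> Fl] --> dot D0 D0 by exact (cvg_dot h0 h0).
have c01 : dot (d0 t) (d1 t) @[t --> Fl] --> dot D0 D1 by exact (cvg_dot h0 h1).
have c11 : dot (d1 t) (d1 t) @[t --> Fl] --> dot D1 D1 by exact (cvg_dot h1 h1).
have cg : (gram (d0 t) (d1 t))^-1 @[t --> Fl] --> (gram D0 D1)^-1.
  exact (cvgV g0 (cvgB (cvgM c00 c11) (cvgM c01 c01))).
have e0 : dual0 (d0 t) (d1 t) @[t --> Fl] --> dual0 D0 D1.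
  exact (cvgZ cg (cvgB (cvgZ c11 h0) (cvgZ c01 h1))).
have e1 : dual1 (d0 t) (d1 t) @[t --> Fl] --> dual1 D0 D1.
  exact (cvgZ cg (cvgB (cvgZ c00 h1) (cvgZ c01 h0))).
exact (cvgD (cvgZ (cvg_dot hw e0) (cvg_cst b0)) (cvgZ (cvg_dot hw e1) (cvg_cst b1))).
Qed.

(** A continuous lift of a differentiable curve through an immersion is
    differentiable: the left inverse of the differential recovers its velocity. *)
Lemma lift_derive (F : 'rV[R]_2 -> 'rV[R]_4) (u : R -> 'rV[R]_2) (t : R) v :
  differentiable F (u t) -> gram ('D_b0 F (u t)) ('D_b1 F (u t)) != 0 ->
  {for t, continuous u} -> is_derive t 1 (F \o u) v ->
  is_derive t 1 u (dual_coords ('D_b0 F (u t)) ('D_b1 F (u t)) v).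
Proof.
move=> dF g0 cu D.
pose L := dual_coords ('D_b0 F (u t)) ('D_b1 F (u t)); rewrite -/(L v).
have LK h : L ('d F (u t) h) = h by rewrite diff_rv2// /L dual_coordsK// -rv2E.
have LB (w v' : 'rV[R]_4) (k : R) : L (w - k *: v') = L w - k *: L v' by exact: dual_coords_lin.
have [k k0 Lk] : exists2 k : R, 0 < k & forall w, `|L w| <= k * `|w| by exact: dual_coords_bound.
have dFu : differentiable (F \o u) t by apply/derivable1_diffP; case: D.
have Ev (h : R) : 'd (F \o u) t h = h *: v.
  have -> : h = h *: (1 : R) by rewrite /GRing.scale/= mulr1.
  rewrite linearZ; congr (_ *: _); first by rewrite /GRing.scale/= mulr1.
  exact (etrans (esym (deriveE _ dFu)) (@derive_val _ _ _ _ _ _ _ D)).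
have main : forall e : R, 0 < e -> exists2 d : R, 0 < d & forall h : R, `|h| < d ->
    `|u (t + h) - u t - ( *:%R^~ (L v)) h| <= e * `|h|.
  move=> e e0.
  (* [e2] is small enough for the term in [a] to be absorbed, so that [a] is at most
     [B * h], and then for its contribution to be at most [e / 2]. *)
  pose B := 2 * k * (`|v| + 1).
  have B0 : 0 < B by rewrite /B !mulr_gt0// ltr_wpDl.
  pose e2 := Num.min (1 / (2 * k)) (e / (2 * k * B)).
  have e20 : 0 < e2 by rewrite lt_min !divr_gt0// !mulr_gt0.
  pose e1 := Num.min 1 (e / (2 * k)).
  have e10 : 0 < e1 by rewrite lt_min ltr01 divr_gt0// mulr_gt0.
  have [d1 d10 H1] := diff_eps dFu e10; have [d2 d20 H2] := diff_eps dF e20.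
  have [d3 d30 H3] : exists2 d : R, 0 < d & forall s : R, `|t - s| < d -> `|u t - u s| < d2.
    by have [d d0 Hd] := (continuous_eps _ _).1 cu _ d20; exists d.
  exists (Num.min d1 d3); first by rewrite lt_min d10.
  move=> h; rewrite lt_min => /andP[hd1 hd3].
  pose a := u (t + h) - u t.
  have ha : `|a| < d2 by rewrite /a distrC H3// opprD addrA subrr sub0r normrN.
  have E1 := H1 h hd1; have E2 := H2 a ha.
  have aE : u t + a = u (t + h) by rewrite /a addrC subrK.
  rewrite aE in E2; rewrite /= Ev in E1.
  set x := F (u (t + h)) - F (u t) in E1 E2.
  have key : `|a - h *: L v| <= k * (e1 * `|h| + e2 * `|a|).
    rewrite -{1}(LK a) -LB; apply: (le_trans (Lk _)); rewrite ler_pM2l//.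
    move: E2; move: ('d F (u t) a) => w E2.
    have -> : w - h *: v = (x - h *: v) - (x - w).
      by apply/rowP => i; rewrite !mxE; ring.
    apply: (le_trans (ler_normB _ _)); exact: lerD.
  have ke2 : k * e2 <= 1 / 2.
    have : e2 <= 1 / (2 * k) by rewrite /e2 ge_min lexx.
    move=> h'; have := ler_wpM2l (ltW k0) h'.
    by have -> : k * (1 / (2 * k)) = 1 / 2 by field; rewrite gt_eqF.
  have ke2B : k * e2 * B <= e / 2.
    have : e2 <= e / (2 * k * B) by rewrite /e2 ge_min lexx orbT.
    move=> h'; have := ler_wpM2l (ltW (mulr_gt0 k0 B0)) h'.
    have -> : k * B * (e / (2 * k * B)) = e / 2 by field; rewrite !gt_eqF.
    by rewrite mulrAC.
  have ke1 : k * e1 <= e / 2.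
    have : e1 <= e / (2 * k) by rewrite /e1 ge_min lexx orbT.
    move=> h'; have := ler_wpM2l (ltW k0) h'.
    by have -> : k * (e / (2 * k)) = e / 2 by field; rewrite gt_eqF.
  have e11 : e1 <= 1 by rewrite /e1 ge_min lexx.
  have aB : `|a| <= B * `|h|.
    have h1 : `|a| <= `|h| * (k * `|v|) + k * (e1 * `|h| + e2 * `|a|).
      have aE2 : a = h *: L v + (a - h *: L v) by rewrite addrC subrK.
      rewrite [in leLHS]aE2; apply: (le_trans (ler_normD _ _)); apply: lerD => //.
      by rewrite normrZ; apply: ler_wpM2l.
    have h2 := ler_wpM2r (normr_ge0 a) ke2.
    have h3 := ler_wpM2r (normr_ge0 h) (ler_wpM2l (ltW k0) e11).
    move: h1 h2 h3; rewrite /B; move: `|a| `|h| `|v| => y z w.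
    have -> : z * (k * w) + k * (e1 * z + e2 * y) = z * (k * w) + k * e1 * z + k * e2 * y by ring.
    have -> : 2 * k * (w + 1) * z = 2 * (z * (k * w)) + 2 * (k * 1 * z) by ring.
    move: (z * (k * w)) (k * e1 * z) (k * e2 * y) (k * 1 * z) => *; lra.
  rewrite /= -/a; apply: (le_trans key); rewrite mulrDr !mulrA.
  have h1 := ler_wpM2r (normr_ge0 h) ke1.
  have h2 := ler_wpM2l (ltW (mulr_gt0 k0 e20)) aB.
  have h3 := ler_wpM2r (normr_ge0 h) ke2B.
  rewrite mulrA in h2; apply: (le_trans (lerD h1 (le_trans h2 h3))).
  by rewrite -mulrDl -splitr.
exact: is_derive_eps main.
Qed.
End LeftInverse.

(** * The intrinsic distance *)

Section SurfaceMetric.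
Variables (R : realType) (M : topologicalType) (A : set (chart R M)) (f : M -> 'rV[R]_4).
Hypotheses (hM : C2_surface A) (hf : C2_immersion_S3 A f).
Local Notation F c := (f \o param c).

Lemma chart_gram c u : A c -> cdom c u -> gram ('D_b0 (F c) u) ('D_b1 (F c) u) != 0.
Proof. by move=> Ac cu; apply: gram_neq0 => x y; exact: (chart_indep hf Ac cu). Qed.

Lemma curve_in_chart c (gam : R -> M) t : A c -> continuous gam -> cimage c (gam t) ->
  [/\ cdom c (Defs.coord c (gam t)), {for t, continuous (Defs.coord c \o gam)},
    \forall s \near t, cimage c (gam s) & forall s, cimage c (gam s) -> f (gam s) = F c (Defs.coord c (gam s))].
Proof.
move=> Ac cg; have [oc oi h1 h2 h3] := chart_ok hM Ac.
have key x : cimage c x -> cdom c (Defs.coord c x) /\ param c (Defs.coord c x) = x.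
  by move=> [u cu <-]; rewrite h1.
move=> it; split.
- by have [] := key _ it.
- exact: (continuous_comp (cg t) (h3 _ it)).
- exact: (cg t _ (open_nbhs_nbhs (conj oi it))).
- by move=> s /key[_ /= ->].
Qed.

(** The coordinates of the curve are recovered from its image by a continuous left inverse of the
    differential of the immersion. *)
Lemma C1_curve_of_image (gam : R -> M) (v : R -> 'rV[R]_4) : continuous gam ->
  (forall t : R, is_derive t 1 (f \o gam) (v t)) -> continuous v -> C1_curve A gam.
Proof.
move=> cg D cv; split => // c Ac.
pose u := Defs.coord c \o gam.
have Du (t : R) : cimage c (gam t) ->
    is_derive t 1 u (dual_coords ('D_b0 (F c) (u t)) ('D_b1 (F c) (u t)) (v t)).
  move=> it; have [cu cont nc E] := curve_in_chart Ac cg it.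
  apply: (lift_derive (chart_diff hf Ac cu) (chart_gram Ac cu) cont).
  apply: near_eq_is_derive (D t); apply: filterS nc => s /E; exact.
split=> [t it|w t it]; first by apply/derivable1_diffP; case: (Du t it).
have [cu cont nc E] := curve_in_chart Ac cg it.
have Dw (s : R) : cimage c (gam s) ->
    'D_w u s = w *: dual_coords ('D_b0 (F c) (u s)) ('D_b1 (F c) (u s)) (v s).
  move=> gs; have D1 := Du s gs; have du : differentiable u s by apply/derivable1_diffP; case: D1.
  have e1 : 'D_w u s = 'd u s w := deriveE _ du.
  have e2 : 'D_1 u s = 'd u s 1 := deriveE _ du.
  have e3 : w = w *: (1 : R) by rewrite /GRing.scale/= mulr1.
  have e4 : 'd u s w = w *: 'd u s (1 : R) by rewrite {1}e3; exact: linearZ.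
  exact (etrans e1 (etrans e4 (congr1 (fun z => w *: z) (etrans (esym e2) (@derive_val _ _ _ _ _ _ _ D1))))).
have L : w *: dual_coords ('D_b0 (F c) (u s)) ('D_b1 (F c) (u s)) (v s) @[s --> t] -->
    w *: dual_coords ('D_b0 (F c) (u t)) ('D_b1 (F c) (u t)) (v t).
  have cD b : 'D_b (F c) (u s) @[s --> t] --> 'D_b (F c) (u t).
    exact: (continuous_comp cont (differentiable_continuous (chart_diff2 hf Ac b cu))).
  exact (cvgZ (cvg_cst w) (cvg_dual_coords (chart_gram Ac cu) (cD b0) (cD b1) (cv t))).
have Et := Dw t it.
have L' : 'D_w u s @[s --> t] --> w *: dual_coords ('D_b0 (F c) (u t)) ('D_b1 (F c) (u t)) (v t).
  apply: cvg_trans L; apply: near_eq_cvg; apply: filterS nc => s gs; exact: esym (Dw s gs).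
have : 'D_w u s @[s --> t] --> 'D_w u t by rewrite Et.
exact.
Qed.

Lemma C1_curve_velocity (gam : R -> M) : C1_curve A gam -> forall t : R,
  derivable (f \o gam) t 1 /\ {for t, continuous (fun s => 'D_1 (f \o gam) s)}.
Proof.
move=> [cg hC] t; have [c [u0 [Ac cu0 u0t]]] := chart_at hM (gam t).
have it : cimage c (gam t) by exists u0.
have [dC cC] := hC c Ac; pose u := Defs.coord c \o gam.
have Dv (s : R) : cimage c (gam s) ->
    is_derive s 1 (f \o gam) (c0 ('D_1 u s) *: 'D_b0 (F c) (u s) + c1 ('D_1 u s) *: 'D_b1 (F c) (u s)).
  move=> gs; have [cu cont nc E] := curve_in_chart Ac cg gs.
  have dF := chart_diff hf Ac cu; have du : differentiable u s := dC s gs.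
  have nE : \forall x \near s, (F c \o u) x = (f \o gam) x.
    by apply: filterS nc => x /E /esym; exact.
  apply: near_eq_is_derive nE _.
  have dFu : differentiable (F c \o u) s := differentiable_comp du dF.
  split; first exact/derivable1_diffP.
  have e1 : 'D_1 (F c \o u) s = 'd (F c \o u) s 1 := deriveE _ dFu.
  have e2 : 'd (F c \o u) s (1 : R) = 'd (F c) (u s) ('d u s 1).
    exact (congr1 (fun L => L (1 : R)) (diff_comp du dF)).
  have e3 : 'D_1 u s = 'd u s 1 := deriveE _ du.
  apply: (etrans e1 (etrans e2 _)); rewrite -e3; exact: diff_rv2.
split; first by case: (Dv t it).
have [cu cont nc E] := curve_in_chart Ac cg it.
have cD b : 'D_b (F c) (u s) @[s --> t] --> 'D_b (F c) (u t).
  exact: (continuous_comp cont (differentiable_continuous (chart_diff2 hf Ac b cu))).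
have cu1 : 'D_1 u s @[s --> t] --> 'D_1 u t := cC 1 t it.
have cc0 : c0 ('D_1 u s) @[s --> t] --> c0 ('D_1 u t).
  exact: (cvg_comp _ _ cu1 (@coord_continuous _ _ _ _ _ _)).
have cc1 : c1 ('D_1 u s) @[s --> t] --> c1 ('D_1 u t).
  exact: (cvg_comp _ _ cu1 (@coord_continuous _ _ _ _ _ _)).
have L : c0 ('D_1 u s) *: 'D_b0 (F c) (u s) + c1 ('D_1 u s) *: 'D_b1 (F c) (u s) @[s --> t] -->
    c0 ('D_1 u t) *: 'D_b0 (F c) (u t) + c1 ('D_1 u t) *: 'D_b1 (F c) (u t).
  exact (cvgD (cvgZ cc0 (cD b0)) (cvgZ cc1 (cD b1))).
have Et : 'D_1 (f \o gam) t = _ := @derive_val _ _ _ _ _ _ _ (Dv t it).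
have : 'D_1 (f \o gam) s @[s --> t] --> 'D_1 (f \o gam) t.
  rewrite Et; apply: cvg_trans L; apply: near_eq_cvg; apply: filterS nc => s gs.
  exact: esym (@derive_val _ _ _ _ _ _ _ (Dv s gs)).
exact.
Qed.

Lemma speed_continuous (gam : R -> M) : C1_curve A gam ->
  continuous (fun t : R => enorm (derive1 (f \o gam) t)).
Proof.
move=> hC t; have [_ c] := C1_curve_velocity hC t.
have h : derive1 (f \o gam) s @[s --> t] --> derive1 (f \o gam) t.
  by under eq_fun do rewrite derive1E; rewrite derive1E.
exact (cvg_comp (fun s => dot (derive1 (f \o gam) s) (derive1 (f \o gam) s)) Num.sqrt
  (cvg_dot h h) (@sqrt_continuous R _)).
Qed.

Lemma curve_length_le (gam : R -> M) (B : R) : C1_curve A gam -> 0 <= B ->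
  (forall t, 0 <= t <= 1 -> enorm (derive1 (f \o gam) t) <= B) ->
  (curve_length f gam <= B%:E)%E.
Proof.
move=> hC B0 hB; rewrite /curve_length.
have cs := speed_continuous hC.
apply: (@le_trans _ _ (\int[lebesgue_measure]_(t in `[0%R, 1%R]) (cst B%:E t))%E).
  apply: ge0_le_integral => //.
  - by move=> t _; rewrite lee_fin enorm_ge0.
  - apply/measurable_realfun.measurable_EFinP; apply: (measurable_funS measurableT) => //.
    exact: measurable_realfun.continuous_measurable_fun.
have m1 : (@lebesgue_measure R) `[0%R, 1%R]%classic = 1%E.
  by rewrite lebesgue_measure_itv/= lte_fin ltr01 oppr0 adde0.
have E := @integral_cst _ _ R (@lebesgue_measure R) `[0%R, 1%R]%classic (measurable_itv _) B%:E.
rewrite E; have := congr1 (fun x => (B%:E * x)%E) m1; rewrite mule1.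
by move=> h; rewrite le_eqVlt; apply/orP; left; apply/eqP; exact: h.
Qed.

(** The fundamental theorem of calculus for the component along the displacement. *)
Lemma displacement_le_length (gam : R -> M) (s t : R) : C1_curve A gam ->
  0 <= s -> s <= t -> t <= 1 ->
  ((enorm (f (gam t) - f (gam s)))%:E <= curve_length f gam)%E.
Proof.
move=> hC s0 st t1; have cs := speed_continuous hC.
have pos : (0 <= curve_length f gam)%E.
  by apply: integral_ge0 => x _; rewrite lee_fin enorm_ge0.
set w := f (gam t) - f (gam s).
have [w0|w0] := eqVneq w 0; first by rewrite w0 /enorm dot0l sqrtr0.
have {}st : s < t.
  by rewrite lt_neqAle st andbT; apply: contra_neq w0 => e; rewrite /w e subrr.
have k0 := enorm_gt0 w0; pose e := (enorm w)^-1 *: w.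
have e1 : enorm e = 1 by rewrite /e enormZ gtr0_norm ?invr_gt0// mulVf// gt_eqF.
pose G x := dot (f (gam x)) e; pose g x := dot (derive1 (f \o gam) x) e.
have DG (x : R) : is_derive x 1 G (g x).
  have [ds _] := C1_curve_velocity hC x.
  have D : is_derive x 1 (f \o gam) ('D_1 (f \o gam) x) by exact: DeriveDef.
  apply: (is_derive_eq (is_derive_dot D (is_derive_cst e x 1))).
  by rewrite dot0r addr0 /g derive1E.
have cg : continuous g.
  move=> x; have [_ c] := C1_curve_velocity hC x.
  have h : derive1 (f \o gam) y @[y --> x] --> derive1 (f \o gam) x.
    by under eq_fun do rewrite derive1E; rewrite derive1E.
  exact (cvg_dot h (cvg_cst e)).
have cG : continuous G.
  by move=> x; apply: differentiable_continuous; apply/derivable1_diffP; case: (DG x).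
have FTC : (\int[lebesgue_measure]_(x in `[s, t]) (g x)%:E = (G t)%:E - (G s)%:E)%E.
  apply: continuous_FTC2 => //.
  - exact: continuous_subspaceT.
  - split; first by move=> x _; case: (DG x).
    + exact: (cvg_at_right_filter (cG s)).
    + exact: (cvg_at_left_filter (cG t)).
  - by move=> x _; rewrite derive1E; exact: (@derive_val _ _ _ _ _ _ _ (DG x)).
have E : enorm w = G t - G s.
  have -> : G t - G s = dot w e by rewrite /G /w dotDl dotNl.
  by rewrite /e dotZr -enorm_sqr; move: k0; move: (enorm w) => k k0; field; rewrite gt_eqF.
rewrite E EFinB -FTC.
apply: (@le_trans _ _ (\int[lebesgue_measure]_(x in `[s, t]) (enorm (derive1 (f \o gam) x))%:E)%E).
  apply: le_integral => //.
  - apply: continuous_compact_integrable; [exact: segment_compact|exact: continuous_subspaceT].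
  - apply: continuous_compact_integrable; [exact: segment_compact|exact: continuous_subspaceT].
  - move=> x _; rewrite lee_fin /g; apply: (le_trans (ler_norm _)).
    by apply: (le_trans (dot_le_enorm _ _)); rewrite e1 mulr1.
apply: ge0_subset_integral => //.
- apply/measurable_realfun.measurable_EFinP; apply: (measurable_funS measurableT) => //.
  exact: measurable_realfun.continuous_measurable_fun.
- by move=> x _; rewrite lee_fin enorm_ge0.
- by move=> x /=; rewrite !in_itv/= => /andP[sx xt]; rewrite (le_trans s0) ?(le_trans xt).
Qed.

(** The intrinsic distance defines the topology: a short curve cannot leave a trap. *)
Lemma surface_dist_nbhs x W : nbhs x W -> exists2 d : R, 0 < d &
  forall y, (surface_dist A f y x < d%:E)%E -> W y.
Proof.
move=> nW; have [K [eta [tK KW]]] := trap_exists hM hf nW.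
have [_ _ Kx eta0 _] := tK; exists eta => // y.
move=> /ereal_inf_lt[_ [gam [hC g0 g1 ->]]] lt; apply: KW.
have cg := hC.1.
pose D := gam @` `[0, 1].
have DK : D `<=` K.
  apply: (trap_connected (surface_hausdorff hM) tK).
  - apply: connected_continuous_connected; first exact: segment_connected.
    exact: continuous_subspaceT.
  - move=> z [t /= ht <-]; rewrite in_itv/= in ht; have /andP[t0 t1] := ht.
    apply: (le_lt_trans (norm_le_enorm _)); rewrite -lte_fin -enormN opprB.
    by apply: le_lt_trans lt; rewrite -g1; exact: displacement_le_length.
  - by exists x => //; exists 1 => //=; rewrite in_itv/= lexx ler01.
by rewrite -g0; apply: DK; exists 0 => //=; rewrite in_itv/= lexx ler01.
Qed.
End SurfaceMetric.

(** * Flow lines in the surface *)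

Section Reach.
Variables (R : realType) (M : topologicalType) (A : set (chart R M)) (f N : M -> 'rV[R]_4).
Hypotheses (hM : C2_surface A) (hf : C2_immersion_S3 A f) (hN : unit_normal A f N).
Variable H : R.
Local Notation Z := (char_field f N).
Local Notation st := (state f N).
Local Notation reg x := (Nh f N x != 0).
Hypothesis hH : forall x, reg x -> has_mean_curvature A f N x H.

(** An immersion is locally injective, so a curve in the sphere has at most one
    lift to the surface with a given origin. *)
Lemma unique_lift (c c' : R -> M) (s : R) : continuous c -> continuous c' -> c 0 = c' 0 -> 0 <= s ->
  (forall u, 0 <= u <= s -> f (c u) = f (c' u)) -> c s = c' s.
Proof.
move=> cc cc' c0 s0 E.
apply: (@real_induction_closed R (fun t => c t = c' t) s s0 c0).
- move=> t /andP[t0 ts] h; apply: (surface_hausdorff hM) => U V nU nV.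
  have nU' : \forall u \near t, U (c u) by exact: (cc t U nU).
  have nV' : \forall u \near t, V (c' u) by exact: (cc' t V nV).
  have [d d0 Hd] := (nbhs_eps _ _).1 (filterI nU' nV').
  pose u := Num.max 0 (t - d / 2).
  have ut : 0 <= u < t by rewrite le_max lexx gt_max t0 ltrBlDr ltrDl divr_gt0.
  have ud : `|t - u| < d.
    have /andP[_ ut'] := ut; rewrite gtr0_norm ?subr_gt0//.
    have : t - d / 2 <= u by rewrite le_max lexx orbT.
    move: d0; move: (u) => x *; lra.
  have [Uu Vu] := Hd u ud; exists (c u); split => //; by rewrite h.
- move=> t /andP[t0 ts] ct.
  have [K [eta [tK _]]] := trap_exists hM hf (filterT : nbhs (c t) setT).
  have [_ inj Kx e0 nK] := tK.
  have nKx : nbhs (c t) K by apply: nK => //; rewrite subrr normr0.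
  have n1 : \forall u \near t, K (c u) by exact: (cc t K nKx).
  have n2 : \forall u \near t, K (c' u) by apply: (cc' t K); rewrite -ct.
  have [d d0 Hd] := (nbhs_eps _ _).1 (filterI n1 n2).
  exists d => // u /andP[tu ud] us.
  have [|K1 K2] := Hd u; first by rewrite distrC ger0_norm ?subr_ge0// ltrBlDl.
  by apply: inj => //; apply: E; rewrite us (le_trans t0).
Qed.

(** The flow line of y for the time s lies in the surface and ends at z. *)
Definition reach (s : R) (y z : M) := exists c : R -> M, [/\ continuous c, c 0 = y, c s = z &
  forall u, 0 <= u <= s -> reg (c u) /\ st (c u) = Phi H u (st y)].

Lemma reach_refl y : reg y -> reach 0 y y.
Proof.
move=> ry; exists (fun=> y); split => //; first exact: cst_continuous.
by move=> u; rewrite andbC => h; rewrite (le_anti h) Phi0.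
Qed.

Lemma reach_state s y z : 0 <= s -> reach s y z -> [/\ reg y, reg z & st z = Phi H s (st y)].
Proof.
move=> s0 [c [cc c0 cs h]]; have [r0 _] := h 0 (introT andP (conj (lexx _) s0)).
have [r1 e1] := h s (introT andP (conj s0 (lexx _))).
by rewrite -c0 -cs; split; [exact: r0|exact: r1|rewrite e1 c0].
Qed.

Lemma reach_unique s y z z' : 0 <= s -> reach s y z -> reach s y z' -> z = z'.
Proof.
move=> s0 [c [cc c0 <- h]] [c' [cc' c0' <- h']].
apply: unique_lift => //; first by rewrite c0.
by move=> u us; have [_ /(congr1 fst)] := h u us; have [_ /(congr1 fst)] := h' u us => /= -> ->.
Qed.

(** Uniqueness of lifts for the reversed curves. *)
Lemma reach_unique_origin s y y' z : 0 <= s -> reach s y z -> reach s y' z -> y = y'.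
Proof.
move=> s0 r1 r2; have [_ _ e1] := reach_state s0 r1; have [_ _ e2] := reach_state s0 r2.
have E : st y = st y'.
  exact (etrans (esym (PhiK H s (st y))) (etrans (congr1 (Phi H (- s)) (etrans (esym e1) e2)) (PhiK H s (st y')))).
move: r1 r2 => [c [cc c0 cs h]] [c' [cc' c0' cs' h']].
rewrite -c0 -c0' in E *.
have cB : continuous (fun u : R => s - u).
  by move=> u; apply: cvgB; [exact: cvg_cst|exact: cvg_id].
have c1 : continuous (fun u => c (s - u)) by move=> u; exact: (continuous_comp (cB u) (cc _)).
have c1' : continuous (fun u => c' (s - u)) by move=> u; exact: (continuous_comp (cB u) (cc' _)).
have e0 : c (s - 0) = c' (s - 0) by rewrite subr0 cs cs'.
suff h0 : forall u, 0 <= u <= s -> f (c (s - u)) = f (c' (s - u)).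
  by have := unique_lift c1 c1' e0 s0 h0; rewrite subrr.
rewrite -c0 in h; rewrite -c0' in h'.
move=> u /andP[u0 us]; have us' : 0 <= s - u <= s by rewrite subr_ge0 us lerBlDr lerDl.
have [_ /(congr1 fst)] := h _ us'; have [_ /(congr1 fst)] := h' _ us' => /= -> ->.
exact (congr1 (fun v => geo H v.1 v.2 (s - u)) E).
Qed.

Lemma reach_split s a y z : 0 <= a <= s -> reach s y z ->
  exists2 w, reach a y w & reach (s - a) w z.
Proof.
move=> /andP[a0 as_] [c [cc c0 cs h]]; exists (c a).
  exists c; split => // u /andP[u0 ua]; apply: h; by rewrite u0 (le_trans ua).
exists (fun u => c (a + u)); split; rewrite ?addr0 ?subrKC//.
  by move=> u; apply: continuous_comp; [apply: cvgD; [exact: cvg_cst|exact: cvg_id]|exact: cc].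
move=> u /andP[u0 us].
have [ra ea] := h a (introT andP (conj a0 as_)).
have [|ru eu] := h (a + u); first by rewrite addr_ge0//= -lerBrDl.
by split; [exact: ru|rewrite eu ea PhiD].
Qed.

Lemma continuous_glue (c c' : R -> M) (s : R) : continuous c -> continuous c' -> c s = c' s ->
  continuous (fun u => if u <= s then c u else c' u).
Proof.
move=> cc cc' E u W /= nW.
have key : \forall v \near u, (v <= s -> W (c v)) /\ (s < v -> W (c' v)).
  case: (ltrgtP u s) nW => [us|us|us] nW.
  - have n1 : \forall v \near u, W (c v) by exact: (cc u W nW).
    have n2 : \forall v \near u, v < s by exact: lt_nbhsl.
    apply: filterS2 n1 n2 => v Wv vs; split => // sv; by have := lt_trans vs sv; rewrite ltxx.
  - have n1 : \forall v \near u, W (c' v) by exact: (cc' u W nW).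
    have n2 : \forall v \near u, s < v by exact: lt_nbhsr.
    apply: filterS2 n1 n2 => v Wv vs; split => // sv; by have := lt_le_trans vs sv; rewrite ltxx.
  - have n1 : \forall v \near u, W (c v) by exact: (cc u W nW).
    have n2 : \forall v \near u, W (c' v) by apply: (cc' u W); rewrite us -E -us.
    by apply: filterS2 n1 n2.
by apply: filterS key => v [h1 h2] /=; case: (leP v s).
Qed.

Lemma reach_trans s t x y z : 0 <= s -> 0 <= t -> reach s x y -> reach t y z -> reach (s + t) x z.
Proof.
move=> s0 t0 r1 r2; have [_ ry ey] := reach_state s0 r1.
move: r1 r2 => [c [cc c0 cs h]] [c' [cc' c0' ct' h']].
have csh : continuous (fun u => c' (u - s)).
  by move=> u; apply: continuous_comp; [apply: cvgB; [exact: cvg_id|exact: cvg_cst]|exact: cc'].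
exists (fun u => if u <= s then c u else c' (u - s)); split.
- by apply: continuous_glue => //; rewrite subrr c0' cs.
- by rewrite s0.
- case: ifP => [st_|_]; last by rewrite addrC addKr.
  have t00 : t = 0 by apply/eqP; rewrite eq_le t0 andbT; move: st_; rewrite gerDl.
  by rewrite t00 addr0 cs -c0' -ct' t00.
- move=> u /andP[u0 ust]; case: (leP u s) => us; first by apply: h; rewrite u0.
  have [|ru eu] := h' (u - s); first by rewrite subr_ge0 (ltW us) lerBlDl.
  by split; [exact: ru|rewrite eu ey PhiD addrC subrK].
Qed.

(** What is kept of a flow box, with an open U so that it serves for all the points of U. *)
Record box_spec (e : R) (K U : set M) : Prop := BoxSpec {
  box_pos : 0 < e;
  box_compact : compact K;
  box_inj : injective_on f K;
  box_reg : forall y, K y -> reg y;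
  box_open : open U;
  box_sub : U `<=` K;
  box_flow : forall y s, U y -> `|s| <= e -> exists2 z, K z & st z = Phi H s (st y) }.

Lemma box_exists x : reg x -> exists e K U, box_spec e K U /\ U x.
Proof.
move=> rx; have [e [K [U [e0 [cK iK] KW [nU UK] fl]]]] := flow_box hM hf hN hH rx (filterT : nbhs x setT).
exists e, K, U^°; split; last exact: nbhs_singleton (nbhs_interior nU).
split => //; first by move=> y /KW[].
- exact: open_interior.
- by move=> y /interior_subset/UK.
- by move=> y s /interior_subset; exact: fl.
Qed.

Lemma box_cont e K U y s z W : box_spec e K U -> reg y -> K z -> st z = Phi H s (st y) ->
  nbhs z W -> exists2 V, nbhs y V & exists2 d : R, 0 < d & forall w s' z', V w -> `|s - s'| < d ->
    K z' -> st z' = Phi H s' (st w) -> W z'.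
Proof.
move=> B ry Kz E nW.
have [d d0 Hd] := compact_inverse_continuous (immersion_continuous hM hf) (box_compact B)
  (box_inj B) Kz nW.
have cfy : {for y, continuous f} by exact: (immersion_continuous hM hf).
have cZy : {for y, continuous Z} by exact: (char_field_continuous hM hf hN ry).
have cf : f w.1 @[w --> filter_prod (nbhs y) (nbhs s)] --> f y.
  exact (cvg_comp fst f cvg_fst cfy).
have cZ : Z w.1 @[w --> filter_prod (nbhs y) (nbhs s)] --> Z y.
  exact (cvg_comp fst Z cvg_fst cZy).
have [c1 _] := @cvg_flow R H (M * R)%type (filter_prod (nbhs y) (nbhs s)) _
  (f \o fst) (Z \o fst) snd (f y) (Z y) s cf cZ cvg_snd.
have nn : nbhs (geo H (f y) (Z y) s) (fun v => `|v - geo H (f y) (Z y) s| < d).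
  by apply/nbhs_eps; exists d => // v; rewrite distrC.
have [[P Q] /= [nP nQ] PQ] := c1 _ nn.
have [d1 d10 Hd1] := (nbhs_eps _ _).1 nQ.
exists P => //; exists d1 => // w s' z' Pw ss Kz' E'.
apply: Hd => //; have -> : f z' = geo H (f w) (Z w) s' := congr1 fst E'.
have -> : f z = geo H (f y) (Z y) s := congr1 fst E.
by have := PQ (w, s') (conj Pw (Hd1 _ ss)).
Qed.

(** In a box the flow line is a lift of a geodesic to a compact set on which f is injective, so
    it is continuous. The time is truncated to [a, b] to define the curve everywhere. *)
Lemma box_path e K U y a b : box_spec e K U -> U y -> - e <= a -> a <= b -> b <= e ->
  exists c : R -> M, continuous c /\ forall u, 0 <= u <= b - a -> K (c u) /\ st (c u) = Phi H (a + u) (st y).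
Proof.
move=> B Uy ea ab be; have ry := box_reg B (box_sub B Uy).
pose cl u : R := a + Num.max 0 (Num.min u (b - a)).
have cl1 u : a <= cl u <= b.
  by rewrite /cl lerDl le_max lexx -lerBrDl ge_max subr_ge0 ab ge_min lexx orbT.
have cle u : `|cl u| <= e.
  by have /andP[h1 h2] := cl1 u; rewrite ler_norml (le_trans ea)// (le_trans h2).
pose c u := xget y [set z | K z /\ st z = Phi H (cl u) (st y)].
have hc u : K (c u) /\ st (c u) = Phi H (cl u) (st y).
  have [z Kz Ez] := box_flow B Uy (cle u).
  by apply: (@xgetPex _ y [set z | K z /\ st z = Phi H (cl u) (st y)]); exists z.
exists c; split; last first.
  move=> u /andP[u0 ub]; have := hc u; rewrite /cl.
  by rewrite (min_idPl ub) (max_idPr u0).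
move=> u W nW; have [Ku Eu] := hc u.
have [V nV [d d0 Hd]] := box_cont B ry Ku Eu nW.
have ccl : {for u, continuous cl}.
  have c1 : {for u, continuous ((fun u : R => u) \min (fun=> b - a))}.
    by apply: continuous_min; [exact: cvg_id|exact: cvg_cst].
  have c2 : {for u, continuous ((fun=> 0) \max ((fun u : R => u) \min (fun=> b - a)))}.
    by apply: continuous_max => //; exact: cvg_cst.
  exact (cvgD (cvg_cst a) c2).
have [d1 d10 Hd1] := (continuous_eps _ _).1 ccl d d0.
have : \forall v \near u, W (c v).
  apply/nbhs_eps; exists d1 => // v uv; have [Kv Ev] := hc v.
  exact: (Hd y (cl v) (c v) (nbhs_singleton nV) (Hd1 v uv) Kv Ev).
by [].
Qed.

Lemma box_reach e K U y s : box_spec e K U -> U y -> 0 <= s <= e -> exists2 z, K z & reach s y z.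
Proof.
move=> B Uy /andP[s0 se]; have Ky := box_sub B Uy.
have e0 : - e <= 0 by rewrite oppr_le0 ltW// (box_pos B).
have [c [cc hc]] := box_path B Uy e0 s0 se; rewrite subr0 in hc.
have [K0 E0] := hc 0 (introT andP (conj (lexx _) s0)).
have [Ks Es] := hc s (introT andP (conj s0 (lexx _))).
have c0 : c 0 = y.
  by apply: (box_inj B) => //; move: E0; rewrite addr0 Phi0 => /(congr1 fst).
exists (c s) => //; exists c; split => // u us; have [Ku Eu] := hc u us.
by split; [exact: (box_reg B)|rewrite Eu add0r].
Qed.

Lemma box_reach_back e K U y s : box_spec e K U -> U y -> 0 <= s <= e -> exists2 z, K z & reach s z y.
Proof.
move=> B Uy /andP[s0 se]; have Ky := box_sub B Uy.
have e0 : - e <= - s by rewrite lerN2.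
have s0' : - s <= 0 by rewrite oppr_le0.
have [c [cc hc]] := box_path B Uy e0 s0' (ltW (box_pos B)); rewrite sub0r opprK in hc.
have [K0 E0] := hc 0 (introT andP (conj (lexx _) s0)).
have [Ks Es] := hc s (introT andP (conj s0 (lexx _))).
have cs : c s = y.
  by apply: (box_inj B) => //; move: Es; rewrite addNr Phi0 => /(congr1 fst).
exists (c 0); first exact: K0.
exists c; split; [exact: cc|by []|exact: cs|] => u us; have [Ku Eu] := hc u us.
by split; [exact: (box_reg B)|rewrite Eu E0 PhiD addr0].
Qed.

(** The flow is continuous along any flow line in the surface: this is propagated
    from flow boxes by induction on the time. *)
Lemma reach_continuous s y z W : 0 <= s -> reach s y z -> nbhs z W ->
  exists2 V, nbhs y V & forall y', V y' -> exists2 z', W z' & reach s y' z'.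
Proof.
move=> s0 rs; have [ry _ _] := reach_state s0 rs.
have [c [cc c0 <- h]] := rs; move: W.
have part a b : 0 <= a -> a <= b -> b <= s -> reach (b - a) (c a) (c b).
  move=> a0 ab bs; have rb : reach b y (c b).
    by exists c; split => // u /andP[u0 ub]; apply: h; rewrite u0 (le_trans ub).
  have [|w ra rw] := @reach_split b a y (c b) _ rb; first by rewrite a0.
  have ra' : reach a y (c a).
    by exists c; split => // u /andP[u0 ua]; apply: h; rewrite u0 (le_trans ua)// (le_trans ab).
  by rewrite (reach_unique a0 ra' ra).
apply: (@real_induction R (fun t => forall W, nbhs (c t) W ->
  exists2 V, nbhs y V & forall y', V y' -> exists2 z', W z' & reach t y' z') s s0).
- move=> W; rewrite c0 => nW; have nr : nbhs y (fun y => reg y) := reg_near hM hf hN ry.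
  exists (W `&` (fun y => reg y)); first exact: filterI.
  by move=> y' [Wy ry']; exists y' => //; exact: reach_refl.
- move=> t ht; have [rt _] := h t ht; have [e [K [U [B Ut]]]] := box_exists rt.
  have nU : \forall u \near t, U (c u) by apply: cc; exact: open_nbhs_nbhs (conj (box_open B) Ut).
  have [d d0 Hd] := (nbhs_eps _ _).1 nU.
  exists (Num.min d (e / 2)); first by rewrite lt_min d0 divr_gt0// (box_pos B).
  move=> a b /andP[a0 as_] /andP[b0 bs]; rewrite !lt_min => /andP[ta ta'] /andP[tb tb'] ab IH W nW.
  have Ua := Hd a ta; have pe : 0 <= b - a <= e.
    rewrite subr_ge0 ab /=; move: ta' tb'; rewrite !ltr_norml => /andP[] ? ? /andP[] ? ?; lra.
  have [x Kx rx] := box_reach B Ua pe; have /andP[ba0 _] := pe.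
  have zE := reach_unique ba0 rx (part a b a0 ab bs); rewrite -zE in nW.
  have [ra _ Ez] := reach_state ba0 rx.
  have [V1 nV1 [d1 d10 Hd1]] := box_cont B ra Kx Ez nW.
  have nVU : nbhs (c a) (V1 `&` U) by apply: filterI => //; exact: open_nbhs_nbhs (conj (box_open B) Ua).
  have [V nV HV] := IH _ nVU; exists V => // y' /HV[w [V1w Uw] rw].
  have [z' Kz' rz'] := box_reach B Uw pe; have [_ _ Ez'] := reach_state ba0 rz'.
  exists z'; first by apply: (Hd1 w (b - a) z') => //; rewrite subrr normr0.
  by have := reach_trans a0 ba0 rw rz'; rewrite subrKC.
Qed.

(** The same propagation, with the flow run backwards. *)
Lemma reach_continuous_back s y z V : 0 <= s -> reach s y z -> nbhs y V ->
  exists2 W, nbhs z W & forall z', W z' -> exists2 y', V y' & reach s y' z'.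
Proof.
move=> s0 rs; have [ry _ _] := reach_state s0 rs.
have [c [cc c0 <- h]] := rs; move: V.
have part a b : 0 <= a -> a <= b -> b <= s -> reach (b - a) (c a) (c b).
  move=> a0 ab bs; have rb : reach b y (c b).
    by exists c; split => // u /andP[u0 ub]; apply: h; rewrite u0 (le_trans ub).
  have [|w ra rw] := @reach_split b a y (c b) _ rb; first by rewrite a0.
  have ra' : reach a y (c a).
    by exists c; split => // u /andP[u0 ua]; apply: h; rewrite u0 (le_trans ua)// (le_trans ab).
  by rewrite (reach_unique a0 ra' ra).
apply: (@real_induction R (fun t => forall V, nbhs y V ->
  exists2 W, nbhs (c t) W & forall z', W z' -> exists2 y', V y' & reach t y' z') s s0).
- move=> V nV; have nr : nbhs y (fun y => reg y) := reg_near hM hf hN ry.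
  exists (V `&` (fun y => reg y)); first by rewrite c0; exact: filterI.
  by move=> y' [Wy ry']; exists y' => //; exact: reach_refl.
- move=> t ht; have [rt _] := h t ht; have [e [K [U [B Ut]]]] := box_exists rt.
  have nU : \forall u \near t, U (c u) by apply: cc; exact: open_nbhs_nbhs (conj (box_open B) Ut).
  have [d d0 Hd] := (nbhs_eps _ _).1 nU.
  exists (Num.min d (e / 2)); first by rewrite lt_min d0 divr_gt0// (box_pos B).
  move=> a b /andP[a0 as_] /andP[b0 bs]; rewrite !lt_min => /andP[ta ta'] /andP[tb tb'] ab IH V nV.
  have Ub := Hd b tb; have pe : 0 <= b - a <= e.
    rewrite subr_ge0 ab /=; move: ta' tb'; rewrite !ltr_norml => /andP[] ? ? /andP[] ? ?; lra.
  have [W1 nW1 HW1] := IH V nV; have /andP[ba0 _] := pe.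
  have [x Kx rx] := box_reach_back B Ub pe.
  have zE := reach_unique_origin ba0 rx (part a b a0 ab bs); rewrite -zE in nW1.
  have [_ rb Ez] := reach_state ba0 rx.
  have Ez' : st x = Phi H (- (b - a)) (st (c b)) by rewrite Ez PhiK.
  have [V1 nV1 [d1 d10 Hd1]] := box_cont B rb Kx Ez' nW1.
  exists (V1 `&` U); first by apply: filterI => //; exact: open_nbhs_nbhs (conj (box_open B) Ub).
  move=> w [V1w Uw]; have [z' Kz' rz'] := box_reach_back B Uw pe.
  have [_ _ E'] := reach_state ba0 rz'.
  have E2 : st z' = Phi H (- (b - a)) (st w) by rewrite E' PhiK.
  have n0 : `|- (b - a) - - (b - a)| < d1 by rewrite subrr normr0.
  have W1z' : W1 z' := Hd1 w (- (b - a)) z' V1w n0 Kz' E2.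
  have [y' Vy' ry'] := HW1 z' W1z'; exists y' => //.
  by have := reach_trans a0 ba0 ry' rz'; rewrite subrKC.
Qed.
End Reach.

(** * Flow lines issuing from the singular point *)

Lemma is_derive_reparam (R : realType) (g dg : R -> 'rV[R]_4) (a : R -> R) (t da : R) :
  is_derive (a t) 1 g (dg (a t)) -> is_derive t 1 a da ->
  is_derive t 1 (fun x => g (a x)) (da *: dg (a t)).
Proof.
move=> hg ha; apply: is_derive_rv4 => k _.
apply: (is_derive_eq (is_derive1_comp (is_derive_crd k hg) ha)).
by rewrite crdZ mulrC.
Qed.

Section Rays.
Variables (R : realType) (M : topologicalType) (A : set (chart R M)) (f N : M -> 'rV[R]_4).
Hypotheses (hM : C2_surface A) (hf : C2_immersion_S3 A f) (hN : unit_normal A f N).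
Variable H : R.
Local Notation Z := (char_field f N).
Local Notation st := (state f N).
Local Notation reg x := (Nh f N x != 0).
Hypothesis hH : forall x, reg x -> has_mean_curvature A f N x H.
Local Notation reach := (reach f N H).

(** A flow line reparametrized by a smooth function that is stationary at both ends
    is defined for all times, as the curves in the distance have to be. *)
Lemma reach_dist s y z : 0 <= s -> reach s y z ->
  (surface_dist A f y z <= (2 * s)%:E)%E /\ (surface_dist A f z y <= (2 * s)%:E)%E.
Proof.
move=> s0 rs; have [ry _ _] := reach_state s0 rs; have U := state_unitary hf hN ry.
move: rs => [c [cc c0 cs h]].
have key k x x' : `|k| = 1 -> c (s * ((1 - k) / 2)) = x -> c (s * ((1 + k) / 2)) = x' ->
    (surface_dist A f x x' <= (2 * s)%:E)%E.
  move=> k1 cx cx'.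
  (* For k = 1 the curve goes from y to z, for k = - 1 from z to y. *)
  pose a t := s * ((1 - k * cos (pi * t)) / 2).
  pose da t := s * (k * pi * sin (pi * t) / 2).
  have Da (t : R) : is_derive t 1 a (da t).
    have D1 := is_derive_cosM pi t.
    have D2 := is_deriveB (is_derive_cst (s / 2) t 1) (is_deriveZ (s * k / 2) D1).
    have -> : a = (fun x => cst (s / 2) x - (s * k / 2) *: cos (pi * x)).
      by apply/funext => q; rewrite /a /GRing.scale/=; field.
    by apply: (is_derive_eq D2); rewrite /da /GRing.scale/=; field.
  have a01 t : 0 <= a t <= s.
    have : `|k * cos (pi * t)| <= 1 by rewrite normrM k1 mul1r cos_max.
    rewrite ler_norml => /andP[h1 h2]; rewrite /a mulr_ge0//=; last lra.
    by rewrite -[leRHS]mulr1; apply: ler_wpM2l => //; lra.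
  have ca : continuous a.
    by move=> t; apply: differentiable_continuous; apply/derivable1_diffP; case: (Da t).
  pose gam t := c (a t).
  have cg : continuous gam by move=> t; exact: (continuous_comp (ca t) (cc _)).
  have fg : f \o gam = (fun t => geo H (f y) (Z y) (a t)).
    apply/funext => t; have [_ /(congr1 fst)] := h _ (a01 t); exact.
  pose v t := da t *: dgeo H (f y) (Z y) (a t).
  have Dg (t : R) : is_derive t 1 (f \o gam) (v t).
    rewrite fg; exact: is_derive_reparam (is_derive_geo H (f y) (Z y) (a t)) (Da t).
  have cv : continuous v.
    have cda : continuous da.
      have E : da = (fun x => s * k * pi / 2 * sin (pi * x)) by apply/funext => q; rewrite /da; field.
      move=> t; have Dd : is_derive t 1 da (s * k * pi / 2 * (pi * cos (pi * t))).
        by rewrite E; exact: (is_deriveZ (s * k * pi / 2) (is_derive_sinM pi t)).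
      by apply: differentiable_continuous; apply/derivable1_diffP; case: Dd.
    have cd : continuous (dgeo H (f y) (Z y)).
      move=> u; apply: differentiable_continuous; apply/derivable1_diffP.
      by case: (is_derive_dgeo H (f y) (Z y) u).
    by move=> t; exact (cvgZ (cda t) (continuous_comp (ca t) (cd _))).
  have hC : C1_curve A gam := C1_curve_of_image hM hf cg Dg cv.
  apply: (@le_trans _ _ (curve_length f gam)).
    apply: ereal_inf_lbound; exists gam; split=> //.
    - by rewrite /gam /a mulr0 cos0 mulr1.
    - by rewrite /gam /a mulr1 cospi mulrN1 opprK.
  apply: (curve_length_le hM hf hC); first by rewrite mulr_ge0.
  move=> t _; rewrite derive1E (@derive_val _ _ _ _ _ _ _ (Dg t)) /v enormZ.
  have [_ e1 _ _] := unitary_Phi H (a t) U; rewrite enorm1// mulr1 /da !normrM k1 mul1r.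
  rewrite (ger0_norm s0) (ger0_norm (pi_ge0 R)) mulrC.
  apply: ler_wpM2r => //.
  have s1 : pi * `|sin (pi * t)| <= pi.
    by rewrite -[leRHS]mulr1; apply: ler_wpM2l; [exact: pi_ge0|exact: sin_max].
  have -> : `|2^-1 : R| = 2^-1 by rewrite ger0_norm// invr_ge0.
  apply: le_trans (ltW (pihalf_lt2 R)); exact: ler_wpM2r.
split.
- apply: (key 1); first exact: normr1.
    by rewrite subrr mul0r mulr0.
  by have -> : s * ((1 + 1) / 2) = s by field.
- apply: (key (-1)); first by rewrite normrN normr1.
    by have -> : s * ((1 - -1) / 2) = s by field.
  by rewrite subrr mul0r mulr0.
Qed.

Variables (x0 : M) (K : set M) (r : R).
Local Notation p := (f x0).
Local Notation dir e := (unitary_pair (p, e)).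
Hypotheses (Kc : compact K) (Ki : injective_on f K) (nK : nbhs x0 K).
Hypotheses (Kr : forall y, K y -> y <> x0 -> reg y) (r0 : 0 < r).
Hypothesis rays : forall e t, dir e -> 0 < t <= r ->
  exists2 y, K y /\ y <> x0 & st y = Phi H t (p, e).
Hypothesis disc : \forall y \near x0, y <> x0 -> exists e t,
  [/\ dir e, 0 < t <= 3 * enorm (f y - p) & st y = Phi H t (p, e)].
Hypothesis sx0 : ~~ (reg x0).

(** The flow line issuing from the singular point in the direction e lies in the surface up to
    the time s and ends at y. The curve is started at a time a > 0, at the point of K with the
    right state, since the characteristic field is not defined at the singular point. *)
Definition out e s y := exists a w, [/\ 0 < a, a <= r, a <= s, K w /\ st w = Phi H a (p, e) &
  reach (s - a) w y].

Lemma reg_x0 y : reg y -> y <> x0. Proof. by move=> ry yx; move: sx0; rewrite -yx ry. Qed.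

Lemma K_reach e a b w w' : dir e -> 0 < a -> a <= b -> b <= r ->
  K w -> st w = Phi H a (p, e) -> K w' -> st w' = Phi H b (p, e) -> reach (b - a) w w'.
Proof.
move=> U a0 ab br Kw Ew Kw' Ew'.
pose cl u : R := a + Num.max 0 (Num.min u (b - a)).
have cl1 u : a <= cl u <= b.
  by rewrite /cl lerDl le_max lexx -lerBrDl ge_max subr_ge0 ab ge_min lexx orbT.
have cl2 u : 0 < cl u <= r.
  by have /andP[h1 h2] := cl1 u; rewrite (lt_le_trans a0)// (le_trans h2).
pose c u := xget w [set z | [/\ K z, z <> x0 & st z = Phi H (cl u) (p, e)]].
have hc u : [/\ K (c u), c u <> x0 & st (c u) = Phi H (cl u) (p, e)].
  have [z [Kz zx] Ez] := rays U (cl2 u).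
  by apply: (@xgetPex _ w [set z | [/\ K z, z <> x0 & st z = Phi H (cl u) (p, e)]]); exists z.
have clE u : 0 <= u <= b - a -> cl u = a + u.
  by move=> /andP[u0 ub]; rewrite /cl (min_idPl ub) (max_idPr u0).
have ba0 : 0 <= b - a by rewrite subr_ge0.
have l1 : 0 <= (0 : R) <= b - a by rewrite lexx.
have l2 : 0 <= b - a <= b - a by rewrite lexx andbT.
exists c; split.
- move=> u W nW; have [Ku ux Eu] := hc u.
  have [d d0 Hd] := compact_inverse_continuous (immersion_continuous hM hf) Kc Ki Ku nW.
  have c1 : {for u, continuous ((fun u : R => u) \min (fun=> b - a))}.
    by apply: continuous_min; [exact: cvg_id|exact: cvg_cst].
  have c2 : {for u, continuous ((fun=> 0) \max ((fun u : R => u) \min (fun=> b - a)))}.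
    by apply: continuous_max => //; exact: cvg_cst.
  have ccl : {for u, continuous cl} by exact (cvgD (cvg_cst a) c2).
  have [d1 d10 Hd1] := (continuous_eps _ _).1 ccl d d0.
  have : \forall v \near u, W (c v).
    apply/nbhs_eps; exists d1 => // v uv; have [Kv _ Ev] := hc v; apply: Hd => //.
    have -> : f (c v) = geo H p e (cl v) := congr1 fst Ev.
    have -> : f (c u) = geo H p e (cl u) := congr1 fst Eu.
    by apply: (le_lt_trans (geo_lip H _ _ U)); rewrite distrC; exact: Hd1.
  by [].
- have [K0 _ E0] := hc 0; apply: Ki => //.
  by rewrite clE// addr0 in E0; exact (congr1 fst (etrans E0 (esym Ew))).
- have [K0 _ E0] := hc (b - a); apply: Ki => //.
  by rewrite clE// subrKC in E0; exact (congr1 fst (etrans E0 (esym Ew'))).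
- move=> u hu; have [Ku ux Eu] := hc u; split; first exact: Kr.
  by rewrite Eu Ew PhiD clE.
Qed.

Lemma out_state e s y : out e s y -> reg y /\ st y = Phi H s (p, e).
Proof.
move=> [a [w [a0 ar as_ [Kw Ew] rw]]]; have sa0 : 0 <= s - a by rewrite subr_ge0.
have [_ ry E] := reach_state sa0 rw; split; first exact: ry.
by rewrite E Ew PhiD subrKC.
Qed.

Lemma out_small e s : dir e -> 0 < s <= r -> exists2 y, K y & out e s y.
Proof.
move=> U /andP[s0 sr]; have [|y [Ky yx] Ey] := rays U (t := s); first by rewrite s0.
exists y => //; exists s, y; split => //; rewrite subrr; apply: reach_refl; exact: Kr.
Qed.

Lemma out_extend e s t y z : 0 <= t -> out e s y -> reach t y z -> out e (s + t) z.
Proof.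
move=> t0 [a [w [a0 ar as_ hw rw]]] rt; exists a, w; split => //.
  by rewrite (le_trans as_)// lerDl.
have sa0 : 0 <= s - a by rewrite subr_ge0.
by have := reach_trans sa0 t0 rw rt; rewrite addrAC.
Qed.

Lemma out_unique e s y y' : dir e -> out e s y -> out e s y' -> y = y'.
Proof.
move=> U; have key a w a' w' z z' : 0 < a -> a <= a' -> a' <= r -> a' <= s ->
    K w -> st w = Phi H a (p, e) -> K w' -> st w' = Phi H a' (p, e) ->
    reach (s - a) w z -> reach (s - a') w' z' -> z = z'.
  move=> a0 aa ar as_ Kw Ew Kw' Ew' r1 r2.
  have rr := K_reach U a0 aa ar Kw Ew Kw' Ew'.
  have aa0 : 0 <= a' - a by rewrite subr_ge0.
  have sa0 : 0 <= s - a' by rewrite subr_ge0.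
  have := reach_trans aa0 sa0 rr r2; rewrite addrC addrA subrK => r3.
  have sa1 : 0 <= s - a by rewrite subr_ge0 (le_trans aa).
  exact: (reach_unique hM hf sa1 r1 r3).
move=> [a [w [a0 ar as_ [Kw Ew] rw]]] [a' [w' [a0' ar' as_' [Kw' Ew'] rw']]].
case: (leP a a') => aa.
  exact: (key a w a' w' y y').
by apply/esym; apply: (key a' w' a w y' y) => //; exact: ltW.
Qed.

Lemma out_restrict e s t y : dir e -> 0 < t <= s -> out e s y ->
  exists2 w, out e t w & reach (s - t) w y.
Proof.
move=> U /andP[t0 ts] [a [w [a0 ar as_ [Kw Ew] rw]]].
have sa0 : 0 <= s - a by rewrite subr_ge0.
case: (leP a t) => at_.
  have h1 : 0 <= t - a <= s - a by rewrite subr_ge0 at_ lerD2r.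
  have [z rz rzy] := reach_split h1 rw.
  exists z; last by have -> : s - t = s - a - (t - a) by ring.
  by exists a, w; split.
have tr : 0 < t <= r by rewrite t0 (le_trans (ltW at_)).
have [z [Kz zx] Ez] := rays U tr; exists z.
  exists t, z; split => //; first by case/andP: tr.
  by rewrite subrr; apply: reach_refl; exact: Kr.
have rr := K_reach U t0 (ltW at_) ar Kz Ez Kw Ew.
have ta0 : 0 <= a - t by rewrite subr_ge0 ltW.
by have := reach_trans ta0 sa0 rr rw; rewrite addrC addrA subrK.
Qed.

(** The disc of flow lines can be taken short, as the time is bounded by the distance to p. *)
Lemma near_sing (d : R) : 0 < d -> exists V : set M, [/\ open V, V x0, V `<=` K &
  forall y, V y -> y <> x0 -> exists e t, [/\ dir e, 0 < t, t < d & st y = Phi H t (p, e)]].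
Proof.
move=> d0; have d3 : 0 < d / 3 by lra.
have n2 : \forall y \near x0, enorm (f y - p) < d / 3 by exact: (cvg_enorm_near hM hf).
have n : nbhs x0 (K `&` ([set y | y <> x0 -> exists e t,
  [/\ dir e, 0 < t <= 3 * enorm (f y - p) & st y = Phi H t (p, e)]] `&` [set y | enorm (f y - p) < d / 3])).
  exact (filterI nK (filterI disc n2)).
exists (K `&` ([set y | y <> x0 -> exists e t,
  [/\ dir e, 0 < t <= 3 * enorm (f y - p) & st y = Phi H t (p, e)]] `&` [set y | enorm (f y - p) < d / 3]))^°.
split; [exact: open_interior|exact: nbhs_singleton (nbhs_interior n)| |].
  by move=> y /interior_subset[].
move=> y /interior_subset[Ky [h1 h2]] yx; have [e [t [U /andP[t0 t3] E]]] := h1 yx.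
exists e, t; split => //; apply: (le_lt_trans t3); move: h2; rewrite /=; move: (enorm _) => *; lra.
Qed.

(** The flow lines issuing from the singular point fill a neighborhood of each of
    their points: flowing backwards from nearby one falls into the disc around it. *)
Lemma out_near e s y (d : R) : dir e -> 0 < s -> out e s y -> 0 < d ->
  exists2 W, nbhs y W & forall z, W z -> exists e' s', [/\ dir e', 0 < s', s' < s + d & out e' s' z].
Proof.
move=> U s0 oy d0; pose d' := Num.min d r.
have d'0 : 0 < d' by rewrite lt_min d0.
have [V [oV Vx VK HV]] := near_sing d'0.
have Kx0 : K x0 := nbhs_singleton nK.
have [d1 d10 Hd1] := compact_inverse_continuous (immersion_continuous hM hf) Kc Ki Kx0
  (open_nbhs_nbhs (conj oV Vx)).
pose a := Num.min (Num.min s r) (d1 / 2).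
have a0 : 0 < a by rewrite !lt_min s0 r0 divr_gt0.
have as_ : a <= s by rewrite !ge_min lexx.
have ar : a <= r by rewrite !ge_min lexx orbT.
have ad : a < d1.
  have : a <= d1 / 2 by rewrite !ge_min lexx !orbT.
  move: d10; move: (a) => b; lra.
have [|w Kw ow] := @out_small e a U; first by rewrite a0.
have [|w' ow' rw] := @out_restrict e s a y U _ oy; first by rewrite a0.
have {ow'}ww := out_unique U ow' ow; rewrite {}ww in rw.
have [rgw Ew] := out_state ow.
have Vw : V w.
  apply: Hd1 => //; have -> : f w = geo H p e a := congr1 fst Ew.
  by have := geo_lip H a 0 U; rewrite geo0 subr0 gtr0_norm// => /le_lt_trans; apply.
have sa0 : 0 <= s - a by rewrite subr_ge0.
have [W nW HW] := reach_continuous_back hM hf hN hH sa0 rw (open_nbhs_nbhs (conj oV Vw)).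
exists W => // z /HW[v Vv rv]; have [rgv _ _] := reach_state sa0 rv.
have [e' [t [U' t0 td E]]] := HV v Vv (reg_x0 rgv).
have td1 : t < d by apply: (lt_le_trans td); rewrite ge_min lexx.
have td2 : t <= r by apply: (ltW (lt_le_trans td _)); rewrite ge_min lexx orbT.
exists e', (t + (s - a)); split => //.
- by rewrite ltr_pwDl.
- by rewrite addrC -addrA ltrD2l; move: a0 td1; move: (a) => b; lra.
- apply: out_extend rv => //; exists t, v; split => //; first by split => //; exact: VK.
  by rewrite subrr; exact: reach_refl.
Qed.

(** The point at a small time depends continuously on the direction, as in K; then the flow is continuous. *)
Lemma out_cont e s y W : dir e -> 0 < s -> out e s y -> nbhs y W ->
  exists2 d : R, 0 < d & forall e' s', dir e' -> `|e - e'| < d -> `|s - s'| < d ->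
    exists2 z, W z & out e' s' z.
Proof.
move=> U s0 oy nW; pose a := Num.min s r / 2.
have a0 : 0 < a by rewrite divr_gt0// lt_min s0.
have as2 : a <= s / 2 by rewrite ler_pM2r ?invr_gt0// ge_min lexx.
have ar2 : a <= r / 2 by rewrite ler_pM2r ?invr_gt0// ge_min lexx orbT.
have as_ : a <= s by apply: (le_trans as2); lra.
have [|w Kw ow] := @out_small e a U; first by rewrite a0 (le_trans ar2)//; lra.
have [|w' ow' rw] := @out_restrict e s a y U _ oy; first by rewrite a0.
have {ow'}ww := out_unique U ow' ow; rewrite {}ww in rw.
have [rgw Ew] := out_state ow.
have sa0 : 0 <= s - a by rewrite subr_ge0.
have [V nV HV] := reach_continuous hM hf hN hH sa0 rw nW.
have [d1 d10 Hd1] := compact_inverse_continuous (immersion_continuous hM hf) Kc Ki Kw nV.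
have [c1 _] := @cvg_flow R H ('rV[R]_4 * R)%type (filter_prod (nbhs e) (nbhs a)) _
  (fun=> p) fst snd p e a (cvg_cst _) cvg_fst cvg_snd.
have nn : nbhs (geo H p e a) (fun v => `|v - geo H p e a| < d1).
  by apply/nbhs_eps; exists d1 => // v; rewrite distrC.
have [[P Q] /= [nP nQ] PQ] := c1 _ nn.
have [d2 d20 HP] := (nbhs_eps _ _).1 nP; have [d3 d30 HQ] := (nbhs_eps _ _).1 nQ.
exists (Num.min (Num.min d2 d3) a); first by rewrite !lt_min d20 d30.
move=> e' s' U'; rewrite !lt_min => /andP[/andP[ee _] _] /andP[/andP[_ ss] sa].
pose a' := a + (s' - s).
have a'0 : 0 < a' by move: sa; rewrite /a' ltr_norml => /andP[]; lra.
have a'r : a' <= r by move: sa ar2; rewrite /a' ltr_norml => /andP[]; lra.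
have [|v Kv ov] := @out_small e' a' U'; first by rewrite a'0.
have [_ Ev] := out_state ov.
have Vv : V v.
  apply: Hd1 => //; have -> : f v = geo H p e' a' := congr1 fst Ev.
  have -> : f w = geo H p e a := congr1 fst Ew.
  have Qa : Q a' by apply: HQ; rewrite /a' opprD addrA subrr sub0r opprB.
  by have := PQ (e', a') (conj (HP _ ee) Qa).
have [z Wz rz] := HV v Vv; exists z => //.
have E : a' + (s - a) = s' by rewrite /a'; ring.
by have := out_extend sa0 ov rz; rewrite E.
Qed.
End Rays.

(** * Height and moment of the geodesics *)

Lemma is_derive_epsE (R : realType) (W : normedModType R) (g : R -> W) (t : R) a :
  is_derive t 1 g a -> forall e : R, 0 < e -> exists2 d : R, 0 < d & forall h : R, `|h| < d ->
    `|g (t + h) - g t - h *: a| <= e * `|h|.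
Proof.
move=> D e e0; have dg : differentiable g t by apply/derivable1_diffP; case: D.
have [d d0 Hd] := diff_eps dg e0; exists d => // h hd.
have E : 'd g t h = h *: a.
  have -> : h = h *: (1 : R) by rewrite /GRing.scale/= mulr1.
  rewrite linearZ; congr (_ *: _); first by rewrite /GRing.scale/= mulr1.
  exact (etrans (esym (deriveE _ dg)) (@derive_val _ _ _ _ _ _ _ D)).
by rewrite -E; exact: Hd.
Qed.

Section Height.
Variables (R : realType) (lam : R).
Local Notation fal := (fal lam).
Local Notation fbe := (fbe lam).
Local Notation fmu := (fmu lam).
Local Notation fnu := (fnu lam).
Local Notation fS := (fS lam).

(** The first positive zero of [fS]: the time at which the geodesics from a point meet again. *)
Definition period : R := pi / tau lam.
Lemma period_gt0 : 0 < period. Proof. by rewrite divr_gt0// ?pi_gt0// tau_gt0. Qed.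

Lemma geo_dots p e s : unitary_pair (p, e) ->
  [/\ dot (geo lam p e s) p = fal s, dot (geo lam p e s) (Vfield p) = fbe s,
      dot (geo lam p e s) e = fmu s & dot (geo lam p e s) (Vfield e) = fnu s].
Proof.
move=> [/= pp ee ep eV]; have pe : dot p e = 0 by rewrite dotC.
have Ve : dot (Vfield p) e = 0 by rewrite dotC.
have pV : dot p (Vfield e) = 0 by rewrite dotC dotVl eV oppr0.
have Vp : dot (Vfield e) p = 0 by rewrite dotC.
by rewrite /geo !dotDl !dotZl !dotVV !dotV0 !dotV0' pp ee ep eV pe Ve pV Vp; split; ring.
Qed.

(** The component of a geodesic along a vector of the complex line of p that is turned so that
    its derivative keeps a constant sign up to the period. *)
Definition height s : R := cos (lam * period / 2) * fal s - sin (lam * period / 2) * fbe s.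
Definition height_slope s : R := fS s * cos (lam * period / 2 - lam * s).

Lemma height_derive (s : R) : is_derive s 1 height (- height_slope s).
Proof.
apply: (is_derive_eq (is_deriveB (is_deriveZ (cos (lam * period / 2)) (is_derive_fal lam s))
  (is_deriveZ (sin (lam * period / 2)) (is_derive_fbe lam s)))).
rewrite /height_slope cosB /fmu /fnu /cosl /sinl /GRing.scale/=; ring.
Qed.

Lemma fS_gt0 s : 0 < s < period -> 0 < fS s.
Proof.
move=> /andP[s0 sl]; rewrite divr_gt0 ?tau_gt0// sin_gt0_pi// mulr_gt0 ?tau_gt0//=.
by move: sl; rewrite /period ltr_pdivlMr ?tau_gt0// mulrC.
Qed.

(** The angle is less than pi / 2 because |lam| < tau. *)
Lemma height_slope_gt0 s : 0 < s < period -> 0 < height_slope s.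
Proof.
move=> hs; rewrite mulr_gt0 ?fS_gt0//; move: hs => /andP[s0 sl].
apply: cos_gt0_pihalf; rewrite -ltr_norml.
have -> : lam * period / 2 - lam * s = lam * (period / 2 - s) by field.
rewrite normrM.
have h1 : `|period / 2 - s| < period / 2 by rewrite ltr_norml; lra.
have -> : pi / 2 = tau lam * (period / 2).
  by rewrite /period; field; exact: tau_neq0.
have p2 : 0 < period / 2 by rewrite divr_gt0// period_gt0.
apply: (le_lt_trans (ler_wpM2l (normr_ge0 lam) (ltW h1))).
by rewrite ltr_pM2r// lam_lt_tau.
Qed.

Lemma height_decr s t : 0 <= s -> s < t -> t <= period -> height t < height s.
Proof.
move=> s0 st tl.
have [x _|c /andP[c1 c2] E] := MVT_derive (f := height) (df := fun x => - height_slope x) st.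
  exact: height_derive.
rewrite -subr_lt0 E mulNr oppr_lt0 mulr_gt0 ?subr_gt0// height_slope_gt0//.
by rewrite (le_lt_trans s0)// (lt_le_trans c2).
Qed.

Lemma height_inj s t : 0 <= s <= period -> 0 <= t <= period -> height s = height t -> s = t.
Proof.
move=> /andP[s0 sl] /andP[t0 tl] E; case: (ltrgtP s t) => // h.
  by have := height_decr s0 h tl; rewrite E ltxx.
by have := height_decr t0 h sl; rewrite E ltxx.
Qed.

(** The height is strictly monotone, so close heights have close times. *)
Lemma height_isolates s0 d : 0 < s0 < period -> 0 < d -> exists2 k : R, 0 < k &
  forall s, 0 < s < period -> `|height s - height s0| < k -> `|s - s0| < d.
Proof.
move=> /andP[s00 s0l] d0; pose d' := Num.min (Num.min d s0) (period - s0).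
have d'0 : 0 < d' by rewrite !lt_min d0 s00 subr_gt0.
have dd : d' <= d by rewrite !ge_min lexx.
have ds : d' <= s0 by rewrite !ge_min lexx orbT.
have dl : d' <= period - s0 by rewrite !ge_min lexx orbT.
pose e := d' / 2; have e0 : 0 < e by rewrite divr_gt0.
have ed : d' = 2 * e by rewrite /e; field.
have h1 : height s0 < height (s0 - e) by apply: height_decr; lra.
have h2 : height (s0 + e) < height s0 by apply: height_decr; lra.
exists (Num.min (height (s0 - e) - height s0) (height s0 - height (s0 + e))).
  by rewrite lt_min !subr_gt0 h1 h2.
move=> s /andP[s1 s2]; rewrite lt_min => /andP[k1 k2].
apply: (@le_lt_trans _ _ e); last lra.
rewrite ler_norml; apply/andP; split.
  rewrite leNgt; apply/negP => h.
  have h3 : height (s0 - e) < height s by apply: height_decr; lra.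
  by have := ler_norm (height s - height s0); lra.
rewrite leNgt; apply/negP => h.
have h3 : height s < height (s0 + e) by apply: height_decr; lra.
by have := ler_norm (- (height s - height s0)); rewrite normrN; lra.
Qed.

(** The component along the moment vector at the time s0 has a zero derivative at s0, and the
    height has a non-zero one. *)
Lemma moment_stationary s0 e : 0 < s0 < period -> 0 < e -> exists2 k : R, 0 < k &
  forall s, 0 < s < period -> `|height s - height s0| < k ->
    `|(sinl lam s0 * fal s + cosl lam s0 * fbe s) - (sinl lam s0 * fal s0 + cosl lam s0 * fbe s0)|
      <= e * `|height s - height s0|.
Proof.
move=> hs e0; pose k := height_slope s0; have k0 : 0 < k := height_slope_gt0 hs.
have Dg : is_derive s0 1 (fun s => sinl lam s0 * fal s + cosl lam s0 * fbe s) 0.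
  apply: (is_derive_eq (is_deriveD (is_deriveZ (sinl lam s0) (is_derive_fal lam s0))
    (is_deriveZ (cosl lam s0) (is_derive_fbe lam s0)))).
  by rewrite /fmu /fnu /GRing.scale/=; ring.
have ek : 0 < e * (k / 2) by rewrite mulr_gt0// divr_gt0.
have k2 : 0 < k / 2 by rewrite divr_gt0.
have [d1 d10 H1] := is_derive_epsE Dg ek.
have [d2 d20 H2] := is_derive_epsE (height_derive s0) k2.
have d12 : 0 < Num.min d1 d2 by rewrite lt_min d10.
have [c c0 Hc] := height_isolates hs d12; exists c => // s s1 s2.
have := Hc s s1 s2; rewrite lt_min => /andP[sd1 sd2].
have := H1 _ sd1; have := H2 _ sd2; rewrite !subrKC scaler0 subr0 => h2 h1.
apply: (le_trans h1); rewrite -mulrA; apply: ler_wpM2l; first exact: ltW.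
have h3 : k * `|s - s0| <= `|height s - height s0| + k / 2 * `|s - s0|.
  have -> : k * `|s - s0| = `|(s - s0) *: - k|.
    by rewrite normrZ normrN (gtr0_norm k0) mulrC.
  have -> : (s - s0) *: - k = (height s - height s0) - (height s - height s0 - (s - s0) *: - k).
    by rewrite subKr.
  by apply: (le_trans (ler_normB _ _)); apply: lerD.
move: h3; move: `|s - s0| `|_| => x y; lra.
Qed.

(** The normal direction common to the geodesics from p at the time s. *)
Definition moment (p : 'rV[R]_4) s := sinl lam s *: p + cosl lam s *: Vfield p.

Lemma moment_unit p s : dot p p = 1 -> dot (moment p s) (moment p s) = 1.
Proof.
move=> pp; rewrite /moment dot_lincomb dotVV dotV0 dotV0' pp.
by apply: etrans (cosl_sinl lam s); ring.
Qed.

(** The geodesic has a non-zero component fmu e + fnu i e outside of the complex line of p, which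
    contains the moment vector. *)
Lemma moment_not_in_fiber p e s a b : unitary_pair (p, e) -> 0 < s < period ->
  moment p s <> a *: geo lam p e s + b *: Vfield (geo lam p e s).
Proof.
move=> U hs E; have [g1 g2 g3 g4] := geo_dots s U; have f0 := fS_gt0 hs.
case: U => /= pp ee ep eV.
have mm := moment_unit s pp.
have m1 : dot (moment p s) e = 0.
  by rewrite /moment dotDl !dotZl (dotC p e) (dotC (Vfield p) e) ep eV !mulr0 addr0.
have m2 : dot (moment p s) (Vfield e) = 0.
  by rewrite /moment dotDl !dotZl dotVV (dotC p e) ep (dotC p) dotVl eV !mulr0 oppr0 mulr0 addr0.
have V1 : dot (Vfield (geo lam p e s)) e = - fnu s by rewrite dotVl g4.
have V2 : dot (Vfield (geo lam p e s)) (Vfield e) = fmu s by rewrite dotVV.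
rewrite E dotDl !dotZl g3 V1 in m1; rewrite E dotDl !dotZl g4 V2 in m2.
have q : fmu s ^+ 2 + fnu s ^+ 2 = fS s ^+ 2.
  have -> : fmu s ^+ 2 + fnu s ^+ 2 = (cosl lam s ^+ 2 + sinl lam s ^+ 2) * fS s ^+ 2.
    by rewrite /fmu /fnu; ring.
  by rewrite cosl_sinl mul1r.
have q0 : fS s ^+ 2 != 0 by rewrite expf_neq0// gt_eqF.
have a0 : a = 0.
  have : a * fS s ^+ 2 = 0.
    rewrite -q; have -> : a * (fmu s ^+ 2 + fnu s ^+ 2) = fmu s * (a * fmu s + b * - fnu s) +
      fnu s * (a * fnu s + b * fmu s) by ring.
    by rewrite m1 m2 !mulr0 addr0.
  by move/eqP; rewrite mulf_eq0 (negbTE q0) orbF => /eqP.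
have b0 : b = 0.
  have : b * fS s ^+ 2 = 0.
    rewrite -q; have -> : b * (fmu s ^+ 2 + fnu s ^+ 2) = - fnu s * (a * fmu s + b * - fnu s) +
      fmu s * (a * fnu s + b * fmu s) by ring.
    by rewrite m1 m2 !mulr0 addr0.
  by move/eqP; rewrite mulf_eq0 (negbTE q0) orbF => /eqP.
by move: mm; rewrite E a0 b0 !scale0r addr0 dot0l => /eqP; rewrite eq_sym oner_eq0.
Qed.
End Height.

Section NormalAlongRays.
Variables (R : realType) (M : topologicalType) (A : set (chart R M)) (f N : M -> 'rV[R]_4).
Hypotheses (hM : C2_surface A) (hf : C2_immersion_S3 A f) (hN : unit_normal A f N).
Variable H : R.
Local Notation Z := (char_field f N).
Local Notation st := (state f N).
Local Notation reg x := (Nh f N x != 0).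
Local Notation l := (period H).
Hypothesis hH : forall x, reg x -> has_mean_curvature A f N x H.
Variables (x0 : M) (K : set M) (r : R).
Local Notation p := (f x0).
Local Notation dir e := (unitary_pair (p, e)).
Hypotheses (Kc : compact K) (Ki : injective_on f K) (nK : nbhs x0 K).
Hypotheses (Kr : forall y, K y -> y <> x0 -> reg y) (r0 : 0 < r).
Hypothesis rays : forall e t, dir e -> 0 < t <= r ->
  exists2 y, K y /\ y <> x0 & st y = Phi H t (p, e).
Hypothesis disc : \forall y \near x0, y <> x0 -> exists e t,
  [/\ dir e, 0 < t <= 3 * enorm (f y - p) & st y = Phi H t (p, e)].
Hypothesis sx0 : ~~ (reg x0).
Local Notation out := (out f N H x0 K r).

Let pp : dot p p = 1. Proof. exact: (sphere hf). Qed.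

(** Near y the points are reached at close times, which their heights control. *)
Lemma out_moment_near e s y (eta : R) : dir e -> 0 < s < l -> out e s y -> 0 < eta ->
  \forall z \near y, `|dot (f z - f y) (moment H p s)| <= eta * `|f z - f y|.
Proof.
move=> U hs oy eta0; have /andP[s0 sl] := hs.
pose v := cos (H * l / 2) *: p - sin (H * l / 2) *: Vfield p.
have hd e' s' z : dir e' -> st z = Phi H s' (p, e') ->
    dot (f z) v = height H s' /\ dot (f z) (moment H p s) = sinl H s * fal H s' + cosl H s * fbe H s'.
  move=> U' /(congr1 fst) /= ->; have [g1 g2 _ _] := geo_dots H s' U'.
  by rewrite /v /moment !dotDr dotNr !dotZr g1 g2.
have [_ Ey] := out_state oy; have [hv hm] := hd _ _ _ U Ey.
have B0 : 0 < 4 * `|v| + 1 by rewrite ltr_wpDl// mulr_ge0.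
have [k k0 Hk] := moment_stationary hs (divr_gt0 eta0 B0).
have d0 : 0 < l - s by rewrite subr_gt0.
have [W nW HW] := out_near hM hf hN hH Kc Ki nK Kr r0 rays disc sx0 U s0 oy d0.
have n2 : \forall z \near y, `|f z - f y| < k / (4 * `|v| + 1).
  have nn : nbhs (f y) (fun w => `|w - f y| < k / (4 * `|v| + 1)).
    by apply/nbhs_eps; exists (k / (4 * `|v| + 1)); [exact: divr_gt0|move=> w; rewrite distrC].
  have fc : {for y, continuous f} by exact: (immersion_continuous hM hf).
  exact: (fc _ nn).
have n1 : \forall z \near y, W z by exact: nW.
apply: filterS2 n1 n2 => z /HW[e' [s' [U' s'0 s'l oz]]] hz.
have {}s'l : s' < l by move: s'l; rewrite subrKC.
have [_ Ez] := out_state oz; have [hv' hm'] := hd _ _ _ U' Ez.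
have hb : `|height H s' - height H s| <= (4 * `|v| + 1) * `|f z - f y|.
  have -> : height H s' - height H s = dot (f z - f y) v by rewrite dotDl dotNl hv hv'.
  apply: (le_trans (dot_le_norm _ _)); have := normr_ge0 (f z - f y).
  move: `|f z - f y| `|v| => a b; lra.
have := Hk s'; rewrite s'0 s'l => /(_ isT) h.
have -> : dot (f z - f y) (moment H p s) = dot (f z) (moment H p s) - dot (f y) (moment H p s).
  by rewrite dotDl dotNl.
rewrite hm hm'; apply: (le_trans (h _)).
  by apply: (le_lt_trans hb); rewrite mulrC -ltr_pdivlMr.
rewrite mulrAC ler_pdivrMr// -mulrA; apply: ler_wpM2l; first exact: ltW.
by rewrite mulrC.
Qed.

(** Divide the previous estimate by the displacement along a curve tangent to w. *)
Lemma tangent_moment e s y w : dir e -> 0 < s < l -> out e s y ->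
  dot w (f y) = 0 -> dot w (N y) = 0 -> dot w (moment H p s) = 0.
Proof.
move=> U hs oy wf wN; have [c [u [Ac cu uy]]] := chart_at hM y.
rewrite -uy in wf wN; have [a aw] := tangent_surj hf hN Ac cu wf wN.
set m := moment H p s.
pose g (t : R) := f (param c (u + t *: a)).
have Dg : is_derive (0 : R) 1 g w.
  have dF : differentiable (f \o param c) (u + (0 : R) *: a).
    by rewrite scale0r addr0; exact: (chart_diff hf Ac cu).
  by apply: (is_derive_eq (is_derive_line dF)); rewrite scale0r addr0.
have g0 : g 0 = f y by rewrite /g scale0r addr0 uy.
have key (eta : R) : 0 < eta -> eta < 1 -> `|dot w m| <= eta * (`|w| + 1 + 4 * `|m|).
  move=> e0 e1; have n := out_moment_near U hs oy e0; rewrite -uy in n.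
  have cl1 : {for (0 : R), continuous (fun t : R => u + t *: a)}.
    exact (cvgD (cvg_cst u) (cvgZ cvg_id (cvg_cst a))).
  have cp : {for (0 : R), continuous (fun t : R => param c (u + t *: a))}.
    apply: (continuous_comp cl1); rewrite scale0r addr0; exact: (param_continuous hM Ac cu).
  have n1 : \forall t \near (0 : R), `|dot (g t - f y) m| <= eta * `|g t - f y|.
    have n' : nbhs (param c (u + (0 : R) *: a))
        (fun z => `|dot (f z - f (param c u)) m| <= eta * `|f z - f (param c u)|).
      by rewrite scale0r addr0; exact: n.
    by have := cp _ n'; rewrite uy.
  have [d1 d10 H1] := (nbhs_eps _ _).1 n1; have [d2 d20 H2] := is_derive_epsE Dg e0.
  pose h := Num.min d1 d2 / 2; have m0 : 0 < Num.min d1 d2 by rewrite lt_min d10.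
  have h0 : 0 < h by rewrite divr_gt0.
  have hd : h < Num.min d1 d2 by rewrite /h; move: m0; move: (Num.min d1 d2) => *; lra.
  move: hd; rewrite lt_min => /andP[hd1 hd2].
  have q1 := H1 h (ltac:(by rewrite sub0r normrN gtr0_norm)).
  have q2 := H2 h (ltac:(by rewrite gtr0_norm)).
  rewrite add0r g0 (gtr0_norm h0) in q2; set x := g h - f y in q1 q2.
  have E : h * dot w m = dot x m - dot (x - h *: w) m.
    by rewrite dotDl dotNl dotZl; ring.
  have xb : `|x| <= h * `|w| + eta * h.
    rewrite -(subrK (h *: w) x) addrC; apply: (le_trans (ler_normD _ _)); apply: lerD q2.
    by rewrite normrZ gtr0_norm.
  have : h * `|dot w m| <= eta * (h * `|w| + eta * h) + 4 * (eta * h) * `|m|.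
    rewrite -{1}(gtr0_norm h0) -normrM E; apply: (le_trans (ler_normB _ _)); apply: lerD.
      by apply: (le_trans q1); apply: ler_wpM2l => //; exact: ltW.
    apply: (le_trans (dot_le_norm _ _)); apply: ler_wpM2r => //.
    by apply: ler_wpM2l.
  have -> : eta * (h * `|w| + eta * h) + 4 * (eta * h) * `|m| = h * (eta * (`|w| + eta + 4 * `|m|)) by ring.
  rewrite ler_pM2l// => /le_trans; apply; apply: ler_wpM2l; first exact: ltW.
  by rewrite lerD2r lerD2l ltW.
apply/eqP; rewrite -normr_le0 leNgt; apply/negP => pos.
set B := `|w| + 1 + 4 * `|m| in key.
have B0 : 0 < B by rewrite /B -addrA addrCA ltr_pwDl// addr_ge0// mulr_ge0.
pose eta := Num.min (1 / 2) (`|dot w m| / (2 * B)).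
have eta0 : 0 < eta by rewrite lt_min !divr_gt0// mulr_gt0.
have eta1 : eta < 1 by rewrite gt_min; apply/orP; left; lra.
have := key eta eta0 eta1; have : eta <= `|dot w m| / (2 * B) by rewrite ge_min lexx orbT.
move=> /(ler_wpM2r (ltW B0)); have -> : `|dot w m| / (2 * B) * B = `|dot w m| / 2.
  by field; rewrite gt_eqF.
move: pos; move: `|_| (eta * B) => *; lra.
Qed.

(** The moment vector is orthogonal to the tangent vectors, so it is in the span of f and N. *)
Lemma normal_condition e s y : dir e -> 0 < s < l -> out e s y ->
  moment H p s = dot (moment H p s) (f y) *: f y + dot (moment H p s) (N y) *: N y.
Proof.
move=> U hs oy; have T := tangent_moment U hs oy.
have ff := sphere hf y; have NN := normal_unit hN y; have Nf := normal_tangent hN y.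
have fN : dot (f y) (N y) = 0 by rewrite dotC.
set m := moment H p s in T *; pose w := m - (dot m (f y) *: f y + dot m (N y) *: N y).
have wf : dot w (f y) = 0.
  by rewrite /w !dotDl dotNl !dotDl !dotZl ff Nf; ring.
have wN : dot w (N y) = 0.
  by rewrite /w !dotDl dotNl !dotDl !dotZl NN fN; ring.
have wm := T w wf wN.
have E : w = m - (dot m (f y) *: f y + dot m (N y) *: N y) by [].
have ww : dot w w = 0.
  clearbody w m; rewrite {2}E dotDr dotNr dotDr !dotZr wm wf wN; ring.
by apply/eqP; rewrite -subr_eq0; apply/eqP; exact: dot_eq0.
Qed.
End NormalAlongRays.

(** * The surface is swept by the flow lines *)

Section Directions.
Variables (R : realType) (p : 'rV[R]_4).
Hypothesis pp : dot p p = 1.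

Definition hdir (th : R) := cos th *: E1 p + sin th *: E2 p.

Lemma hdir_unitary th : unitary_pair (p, hdir th).
Proof.
split => //=; rewrite /hdir.
- by rewrite dot_lincomb E2V dotVV dotV0 dotV0' dotE1E1 pp; apply: etrans (cos2Dsin2 th); ring.
- by rewrite dotDl !dotZl dotE1p dotE2p; ring.
- by rewrite dotDl !dotZl dotE1V dotE2V; ring.
Qed.

(** The polar angle: an arc cosine for a nonnegative second component, its reflection otherwise. *)
Lemma hdir_surj e : unitary_pair (p, e) -> exists2 th, 0 <= th <= 2 * pi & e = hdir th.
Proof.
move=> [/= _ ee ep eV].
have eE : e = dot e (E1 p) *: E1 p + dot e (E2 p) *: E2 p.
  by have := frame_expand p e; rewrite pp scale1r ep eV !scale0r !add0r.
set a := dot e (E1 p) in eE; set c := dot e (E2 p) in eE.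
have ac : a ^+ 2 + c ^+ 2 = 1.
  by rewrite -ee eE dot_lincomb E2V dotVV dotV0 dotV0' dotE1E1 pp; ring.
have a1 : -1 <= a <= 1.
  rewrite -ler_norml -(@ler_pXn2r _ 2)// ?nnegrE// expr1n real_normK ?num_real//.
  by rewrite -ac lerDl sqr_ge0.
have p0 := pi_ge0 R.
have th1 := acos_ge0 a1; have th2 := acos_lepi a1.
have sE : sin (acos a) = `|c|.
  rewrite sin_acos//; have -> : 1 - a ^+ 2 = c ^+ 2 by rewrite -ac addrC addKr.
  exact: sqrtr_sqr.
case: (leP 0 c) => c0.
  exists (acos a); first by apply/andP; split; lra.
  by rewrite /hdir acosK// sE ger0_norm.
exists (2 * pi - acos a); first by apply/andP; split; lra.
have -> : 2 * pi - acos a = - acos a + pi *+ 2 by rewrite mulr_natl addrC.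
rewrite /hdir cosD2pi sinD2pi cosN sinN acosK// sE ltr0_norm// opprK.
exact: eE.
Qed.

Lemma hdir_continuous : continuous hdir.
Proof.
move=> th; apply: differentiable_continuous; apply/derivable1_diffP.
by case: (is_deriveD (is_derive_scalel (E1 p) (is_derive_cos th)) (is_derive_scalel (E2 p) (is_derive_sin th))).
Qed.

End Directions.

Section Sweep.
Variables (R : realType) (M : topologicalType) (A : set (chart R M)) (f N : M -> 'rV[R]_4).
Hypotheses (hM : C2_surface A) (hf : C2_immersion_S3 A f) (hN : unit_normal A f N).
Variable H : R.
Local Notation Z := (char_field f N).
Local Notation st := (state f N).
Local Notation reg x := (Nh f N x != 0).
Local Notation l := (period H).
Hypothesis hH : forall x, reg x -> has_mean_curvature A f N x H.
Hypothesis complete : complete_surface A f.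
Variables (x0 : M) (K : set M) (r : R).
Local Notation p := (f x0).
Local Notation dir e := (unitary_pair (p, e)).
Hypotheses (Kc : compact K) (Ki : injective_on f K) (nK : nbhs x0 K).
Hypotheses (Kr : forall y, K y -> y <> x0 -> reg y) (r0 : 0 < r) (rl : r < l).
Hypothesis rays : forall e t, dir e -> 0 < t <= r ->
  exists2 y, K y /\ y <> x0 & st y = Phi H t (p, e).
Hypothesis disc : \forall y \near x0, y <> x0 -> exists e t,
  [/\ dir e, 0 < t <= 3 * enorm (f y - p) & st y = Phi H t (p, e)].
Hypothesis sx0 : ~~ (reg x0).
Local Notation out := (out f N H x0 K r).
Local Notation reach := (reach f N H).
Local Notation edir := (hdir p).

Let pp : dot p p = 1. Proof. exact: (sphere hf). Qed.
Let fc : continuous f. Proof. exact: (immersion_continuous hM hf). Qed.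
Let hs := surface_hausdorff hM.

Lemma out_f e s y : out e s y -> f y = geo H p e s.
Proof. by move=> /out_state[_ /(congr1 fst)]. Qed.

Lemma fnbhs y (d : R) : 0 < d -> nbhs y (fun z => `|f z - f y| < d).
Proof.
move=> d0; have nn : nbhs (f y) (fun w => `|w - f y| < d).
  by apply/nbhs_eps; exists d => // w; rewrite distrC.
exact: (fc nn).
Qed.

(** Convergence in the surface along the flow line in the direction e, at the time t from below. *)
Definition ends e (t : R) (x : M) := forall W, nbhs x W -> exists a, [/\ 0 < a, a < t &
  forall s y, a < s < t -> out e s y -> W y].

Lemma ends_f e t x : dir e -> 0 < t -> (forall s, 0 < s < t -> exists y, out e s y) ->
  ends e t x -> f x = geo H p e t.
Proof.
move=> U t0 hex hx; apply/eqP; rewrite -subr_eq0 -normr_eq0; apply/eqP/le_anti.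
rewrite normr_ge0 andbT; apply/ler_addgt0Pl => d d0; rewrite addr0.
have d2 : 0 < d / 2 by rewrite divr_gt0.
have [a [a0 at_ Ha]] := hx _ (fnbhs x d2).
pose s := Num.max ((a + t) / 2) (t - d / 2).
have s1 : (a + t) / 2 <= s by rewrite le_max lexx.
have s2 : t - d / 2 <= s by rewrite le_max lexx orbT.
have s3 : s < t by rewrite gt_max; apply/andP; split; lra.
have [|y oy] := hex s; first by rewrite s3 andbT; lra.
have := Ha s y (ltac:(rewrite s3 andbT; lra)) oy; rewrite (out_f oy) distrC => h1.
have h2 := geo_lip H s t U.
have h3 : `|s - t| <= d / 2 by rewrite ler0_norm; lra.
rewrite -(subrK (geo H p e s) (f x)) -addrA; apply: (le_trans (ler_normD _ _)).
move: h1 h2 h3; move: `|_| `|_| `|s - t| => *; lra.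
Qed.

(** The flow line between the times s and t is a connected set. *)
Lemma path_in_trap x K' eta e s t y z : trap f x K' eta -> dir e -> 0 < s -> s <= t ->
  out e s y -> out e t z -> K' y -> (forall u, s <= u <= t -> `|geo H p e u - f x| < eta) -> K' z.
Proof.
move=> tK U s0 st oy oz Ky hu.
have [|y' oy' [c [cc c0 cs hc]]] := out_restrict hM hf Kc Ki Kr rays (s := t) (t := s) U _ oz.
  by rewrite s0.
have yE := out_unique hM hf Kc Ki Kr rays U oy' oy; rewrite {oy' y'}yE in c0 hc.
have ts0 : 0 <= t - s by rewrite subr_ge0.
have DK : c @` `[0, t - s] `<=` K'.
  apply: (trap_connected hs tK).
  - apply: connected_continuous_connected; first exact: segment_connected.
    exact: continuous_subspaceT.
  - move=> _ [u /= + <-]; rewrite in_itv/= => /andP[u0 us].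
    have [|_ /(congr1 fst) /= ->] := hc u; first by rewrite u0.
    have [_ E] := out_state oy.
    have -> : geo H (f y) (Z y) u = geo H p e (s + u).
      by have := congr1 fst (PhiD H s u (p, e)); rewrite -E.
    by apply: hu; rewrite lerDl u0 -lerBrDl.
  - by exists y => //; exists 0 => //=; rewrite in_itv/= lexx.
by rewrite -cs; apply: DK; exists (t - s) => //=; rewrite in_itv/= ts0 lexx.
Qed.

(** The points at the times t - t / (n + 2) form a Cauchy sequence. The limit of the sequence is
    a limit along the flow line, which cannot leave a trap around it. *)
Lemma ray_limit e t : dir e -> 0 < t -> (forall s, 0 < s < t -> exists y, out e s y) ->
  exists x, ends e t x.
Proof.
move=> U t0 hex.
pose s_ n : R := t - t / n.+2%:R.
have sp n : 0 < s_ n < t.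
  rewrite /s_ subr_gt0 gtrBl divr_gt0// andbT ltr_pdivrMr// ltr_pMr//.
  by rewrite ltr1n.
have smono m n : (m <= n)%N -> s_ m <= s_ n.
  move=> mn; rewrite /s_ lerD2l lerN2 ler_pM2l// lef_pV2 ?posrE// ler_nat.
  by rewrite !ltnS.
have [y_ oy] : exists y_ : nat -> M, forall n, out e (s_ n) (y_ n).
  exists (fun n => xget x0 [set y | out e (s_ n) y]) => n.
  by apply: (@xgetPex _ x0 [set y | out e (s_ n) y]); exact: hex.
have dist m n : (m <= n)%N -> (surface_dist A f (y_ m) (y_ n) <= (2 * (t / m.+2%:R))%:E)%E /\
    (surface_dist A f (y_ n) (y_ m) <= (2 * (t / m.+2%:R))%:E)%E.
  move=> mn; have /andP[sm0 _] := sp m; have /andP[_ sn] := sp n.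
  have [|y' oy' rr] := out_restrict hM hf Kc Ki Kr rays (s := s_ n) (t := s_ m) U _ (oy n).
    by rewrite sm0 smono.
  have yE := out_unique hM hf Kc Ki Kr rays U oy' (oy m); rewrite {oy' y'}yE in rr.
  have d0 : 0 <= s_ n - s_ m by rewrite subr_ge0 smono.
  have le : ((2 * (s_ n - s_ m))%:E <= (2 * (t / m.+2%:R))%:E)%E.
    rewrite lee_fin ler_pM2l//.
    have : 0 <= t / n.+2%:R by rewrite divr_ge0// ltW.
    rewrite /s_; move: (t / _) (t / _) => a b; lra.
  by have [h1 h2] := reach_dist hM hf hN d0 rr; split; exact: le_trans le.
have small (d : R) : 0 < d -> exists n0, forall m, (n0 <= m)%N -> 2 * (t / m.+2%:R) < d.
  move=> d0; have tn : 0 <= 2 * t / d by rewrite divr_ge0// ?mulr_ge0// ltW.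
  exists (Num.bound (2 * t / d)) => m hm; rewrite mulrA ltr_pdivrMr// [ltRHS]mulrC -ltr_pdivrMr//.
  apply: (lt_le_trans (archi_boundP tn)); rewrite ler_nat.
  by apply: (leq_trans hm); rewrite leqW// leqnSn.
have [x hx] : exists x : M, forall eps : R, 0 < eps -> exists n0 : nat, forall n : nat,
    (n0 <= n)%N -> (surface_dist A f (y_ n) x < eps%:E)%E.
  apply: complete => d d0; have [n0 hn0] := small d d0; exists n0 => m n hm hn.
  case: (leqP m n) => mn.
    have [h _] := dist m n mn; apply: (le_lt_trans h); rewrite lte_fin; exact: hn0.
  have [_ h] := dist n m (ltnW mn); apply: (le_lt_trans h); rewrite lte_fin; exact: hn0.
have hW W : nbhs x W -> exists n0, forall n, (n0 <= n)%N -> W (y_ n).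
  move=> nW; have [d d0 Hd] := surface_dist_nbhs hM hf nW.
  by have [n0 hn0] := hx d d0; exists n0 => n /hn0; exact: Hd.
have fx : f x = geo H p e t.
  apply/eqP; rewrite -subr_eq0 -normr_eq0; apply/eqP/le_anti.
  rewrite normr_ge0 andbT; apply/ler_addgt0Pl => d d0; rewrite addr0.
  have d2 : 0 < d / 2 by rewrite divr_gt0.
  have [n0 Hn0] := hW _ (fnbhs x d2); have [n1 Hn1] := small d d0.
  have := Hn0 (maxn n0 n1) (leq_maxl _ _); have := Hn1 (maxn n0 n1) (leq_maxr _ _).
  move: (maxn n0 n1) => n; rewrite (out_f (oy n)) distrC => h0 h1.
  have E : `|s_ n - t| = t / n.+2%:R.
    by rewrite distrC /s_ subKr ger0_norm// divr_ge0// ltW.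
  have := geo_lip H (s_ n) t U; rewrite E => h2.
  rewrite -(subrK (geo H p e (s_ n)) (f x)) -addrA; apply: (le_trans (ler_normD _ _)).
  move: h0 h1 h2; move: `|_| `|_| (t / _) => *; lra.
exists x => W nW; have [K' [eta [tK KW]]] := trap_exists hM hf nW.
have [_ _ Kx eta0 nK'] := tK.
have nKx : nbhs x K' by apply: nK' => //; rewrite subrr normr0.
have [n0 Hn0] := hW _ nKx; have e2 : 0 < eta by [].
have [n1 Hn1] := small eta e2; pose n := maxn n0 n1.
have /andP[sn0 sn1] := sp n; exists (s_ n); split => // s y /andP[s1 s2] oys.
apply: KW; apply: (path_in_trap tK U sn0 (ltW s1) (oy n) oys); first by apply: Hn0; exact: leq_maxl.
move=> u /andP[u1 u2]; rewrite fx; apply: (le_lt_trans (geo_lip H _ _ U)).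
have := Hn1 n (leq_maxr _ _); have : t - s_ n = t / n.+2%:R by rewrite /s_ subKr.
rewrite ler0_norm ?subr_le0 ?(le_trans u2) ?ltW//; have := ltW sn1.
move: (t / _) => w h1 h2 h3; lra.
Qed.

(** No flow line reaches a singular point before the time l: by continuity of the
    normal the moment vector would be a complex multiple of the point. *)
Lemma ends_regular e t x : dir e -> 0 < t < l -> (forall s, 0 < s < t -> exists y, out e s y) ->
  ends e t x -> reg x.
Proof.
move=> U ht hex hx; have /andP[t0 tl] := ht; have fx := ends_f U t0 hex hx.
apply/negP => /eqP Nx.
pose P (w : M * R) := moment H p w.2 - (dot (moment H p w.2) (f w.1) *: f w.1 +
  dot (moment H p w.2) (N w.1) *: N w.1).
have cP : P w @[w --> filter_prod (nbhs x) (nbhs t)] --> P (x, t).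
  have cf : f w.1 @[w --> filter_prod (nbhs x) (nbhs t)] --> f x.
    have fcx : {for x, continuous f} by exact: fc.
    exact (cvg_comp fst f cvg_fst fcx).
  have cN : N w.1 @[w --> filter_prod (nbhs x) (nbhs t)] --> N x.
    have Ncx : {for x, continuous N} by exact: (normal_continuous hN).
    exact (cvg_comp fst N cvg_fst Ncx).
  have c1 : sinl H w.2 @[w --> filter_prod (nbhs x) (nbhs t)] --> sinl H t.
    have h : {for t, continuous (sinl H)}.
      by apply: differentiable_continuous; apply/derivable1_diffP; case: (is_derive_sinl H t).
    exact (cvg_comp snd (sinl H) cvg_snd h).
  have c2 : cosl H w.2 @[w --> filter_prod (nbhs x) (nbhs t)] --> cosl H t.
    have h : {for t, continuous (cosl H)}.
      by apply: differentiable_continuous; apply/derivable1_diffP; case: (is_derive_cosl H t).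
    exact (cvg_comp snd (cosl H) cvg_snd h).
  have cm : moment H p w.2 @[w --> filter_prod (nbhs x) (nbhs t)] --> moment H p t.
    exact (cvgD (cvgZ c1 (cvg_cst p)) (cvgZ c2 (cvg_cst (Vfield p)))).
  exact (cvgB cm (cvgD (cvgZ (cvg_dot cm cf) cf) (cvgZ (cvg_dot cm cN) cN))).
have Px : P (x, t) = 0.
  apply/eqP; rewrite -normr_eq0; apply/eqP/le_anti; rewrite normr_ge0 andbT.
  apply/ler_addgt0Pl => d d0; rewrite addr0.
  have nn : nbhs (P (x, t)) (fun w => `|w - P (x, t)| < d).
    by apply/nbhs_eps; exists d => // w; rewrite distrC.
  have [[Q1 Q2] /= [nQ1 nQ2] HQ] := cP _ nn.
  have [a [a0 at_ Ha]] := hx _ nQ1; have [d1 d10 Hd1] := (nbhs_eps _ _).1 nQ2.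
  pose s := Num.max ((a + t) / 2) (t - d1 / 2).
  have s1 : (a + t) / 2 <= s by rewrite le_max lexx.
  have s2 : t - d1 / 2 <= s by rewrite le_max lexx orbT.
  have s3 : s < t by rewrite gt_max; apply/andP; split; lra.
  have [|y oy] := hex s; first by rewrite s3 andbT; lra.
  have Q1y := Ha s y (ltac:(rewrite s3 andbT; lra)) oy.
  have Q2s : Q2 s by apply: Hd1; rewrite gtr0_norm; lra.
  have Py : P (y, s) = 0.
    rewrite /P /=; apply/eqP; rewrite subr_eq0; apply/eqP.
    have sl' : 0 < s < l by apply/andP; split; lra.
    exact: (normal_condition hM hf hN hH Kc Ki nK Kr r0 rays disc sx0 U sl' oy).
  by have := HQ (y, s) (conj Q1y Q2s); rewrite /= Py sub0r normrN => /ltW.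
have NV : N x = dot (N x) (Vfield (f x)) *: Vfield (f x).
  by move/eqP: Nx; rewrite /Nh subr_eq0 => /eqP.
have := @moment_not_in_fiber R H p e t (dot (moment H p t) (f x))
  (dot (moment H p t) (N x) * dot (N x) (Vfield (f x))) U ht; apply.
move/eqP: Px; rewrite /P /= subr_eq0 -fx -scalerA => /eqP Px.
exact (etrans Px (congr1 (fun v => _ + _ *: v) NV)).
Qed.

(** The set of times reached is closed, as limits are regular and have flow boxes, and open. *)
Lemma out_total e s : dir e -> 0 < s < l -> exists y, out e s y.
Proof.
move=> U /andP[s0 sl]; case: (leP s r) => sr.
  by have [|y _ oy] := out_small Kr rays (e := e) (s := s) U; [rewrite s0|exists y].
have b0 : 0 <= s - r by rewrite subr_ge0 ltW.
have sE : r + (s - r) = s by rewrite subrKC.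
suff : exists y, out e (r + (s - r)) y by rewrite sE.
have hr : 0 < r <= r by rewrite r0 lexx.
apply: (@real_induction_closed R (fun t => exists y, out e (r + t) y) (s - r) b0).
- rewrite addr0; have [y _ oy] := out_small Kr rays (e := e) U hr; by exists y.
- move=> t /andP[t0 tb] IH.
  have hex u : 0 < u < r + t -> exists y, out e u y.
    move=> /andP[u0 ut]; case: (leP u r) => ur.
      have [|y _ oy] := out_small Kr rays (e := e) (s := u) U; first by rewrite u0.
      by exists y.
    have [|y] := IH (u - r); first by apply/andP; split; lra.
    by rewrite subrKC => oy; exists y.
  have rt0 : 0 < r + t by rewrite addr_gt0.
  have rtl : 0 < r + t < l by rewrite rt0 /=; lra.
  have [x hx] := ray_limit U rt0 hex; have rx := ends_regular U rtl hex hx.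
  have [d [K' [V [B Vx]]]] := box_exists hM hf hN hH rx.
  have [a [a0 at_ Ha]] := hx _ (open_nbhs_nbhs (conj (box_open B) Vx)).
  have d0 := box_pos B.
  pose u := Num.max ((a + (r + t)) / 2) (r + t - d / 2).
  have u1 : (a + (r + t)) / 2 <= u by rewrite le_max lexx.
  have u2 : r + t - d / 2 <= u by rewrite le_max lexx orbT.
  have u3 : u < r + t by rewrite gt_max; apply/andP; split; lra.
  have [|y oy] := hex u; first by rewrite u3 andbT; lra.
  have Vy := Ha u y (ltac:(rewrite u3 andbT; lra)) oy.
  have hu : 0 <= r + t - u <= d by apply/andP; split; lra.
  have [z _ rz] := box_reach hM hf hN B Vy hu.
  have /andP[hu0 _] := hu; have := out_extend hu0 oy rz; rewrite subrKC.
  by move=> oz; exists z.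
- move=> t /andP[t0 tb] [y oy]; have [ry _] := out_state oy.
  have [d [K' [V [B Vy]]]] := box_exists hM hf hN hH ry.
  exists d; first exact: box_pos B.
  move=> u /andP[tu ud] ub.
  have hu : 0 <= u - t <= d by apply/andP; split; lra.
  have [z _ rz] := box_reach hM hf hN B Vy hu.
  have /andP[hu0 _] := hu; have := out_extend hu0 oy rz.
  have -> : r + t + (u - t) = r + u by ring.
  by move=> oz; exists z.
Qed.

Definition swept := [set y | exists e s, [/\ dir e, 0 < s < l & out e s y]].
Local Notation T := swept.

Lemma swept_nbhs y : T y -> nbhs y T.
Proof.
move=> [e [s [U /andP[s0 sl] oy]]]; have d0 : 0 < l - s by rewrite subr_gt0.
have [W nW HW] := out_near hM hf hN hH Kc Ki nK Kr r0 rays disc sx0 U s0 oy d0.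
apply: filterS nW => z /HW[e' [s' [U' s'0 s'l oz]]]; exists e', s'; split => //.
by rewrite s'0 /=; move: s'l; rewrite subrKC.
Qed.

Lemma swept_open : open T.
Proof. by rewrite openE => y; exact: swept_nbhs. Qed.

Lemma swept_near_sing : \forall y \near x0, y = x0 \/ T y.
Proof.
have [V [oV Vx VK HV]] := near_sing hM hf nK disc r0.
apply: filterS (open_nbhs_nbhs (conj oV Vx)) => y Vy.
have [->|yx] := pselect (y = x0); [by left|right].
have [e [t [U t0 tr E]]] := HV y Vy yx; exists e, t; split => //.
  by rewrite t0 (lt_trans tr).
exists t, y; split => //; first exact: ltW; first by split => //; exact: VK.
by rewrite subrr; apply: reach_refl; apply: Kr => //; exact: VK.
Qed.

(** The value at the time l of all the geodesics: their components on e and i e vanish. *)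
Definition pole := fal H l *: p + fbe H l *: Vfield p.

Lemma fS_period : fS H l = 0.
Proof.
by rewrite /fS /period mulrCA divff ?tau_neq0// mulr1 sinpi mul0r.
Qed.

Lemma geo_pole e : geo H p e l = pole.
Proof. by rewrite /geo /fmu /fnu fS_period !mulr0 oppr0 !scale0r !addr0. Qed.

Lemma dir_compact : compact [set e | dir e].
Proof.
have -> : [set e | dir e] = edir @` `[0, 2 * pi].
  apply/seteqP; split=> [e /(hdir_surj pp)[th h ->]|_ [th _ <-]]; last exact: (hdir_unitary pp).
  by exists th => //=; rewrite in_itv.
apply: continuous_compact; last exact: segment_compact.
exact: continuous_subspaceT (@hdir_continuous R p).
Qed.

(** A limit of points of the swept region is attached to a cluster point of their directions and
    times, by compactness. If the time is inside (0, l), it is the endpoint of a flow line. *)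
Lemma closure_swept y : closure T y -> [\/ T y, y = x0 | f y = pole].
Proof.
move=> cy.
pose G (W : set M) := [set v : 'rV[R]_4 * R | [/\ dir v.1, 0 < v.2 < l &
  exists2 z, W z & out v.1 v.2 z]].
pose F : set_system ('rV[R]_4 * R)%type := fun S => exists2 W, nbhs y W & G W `<=` S.
have FF : ProperFilter F.
  apply: Build_ProperFilter; last split.
  - move=> [W nW GS]; have [z [[e [s [U hs' oz]]] Wz]] := cy W nW.
    by apply: (GS (e, s)); split => //; exists z.
  - by exists setT; first exact: filterT.
  - move=> S S' [W nW GS] [W' nW' GS']; exists (W `&` W'); first exact: filterI.
    move=> v [h1 h2 [z [Wz W'z] oz]]; split; [apply: GS|apply: GS'];
      by split => //; exists z.
  - by move=> S S' SS [W nW GS]; exists W => //; exact: subset_trans SS.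
have cC : compact ([set e | dir e] `*` `[0, l]%classic).
  by apply: compact_setX; [exact: dir_compact|exact: segment_compact].
have FC : F ([set e | dir e] `*` `[0, l]%classic).
  exists setT; first exact: filterT.
  by move=> [e s] [/= U /andP[s0 sl] _]; split => //=; rewrite in_itv/= !ltW.
have [[e s] [[/= U]]] := cC F FF FC; rewrite in_itv/= => /andP[s0 sl] clu.
have near_es (W : set M) (d : R) : nbhs y W -> 0 < d -> exists e' s' z,
    [/\ dir e', 0 < s' < l, `|e - e'| < d /\ `|s - s'| < d, W z & out e' s' z].
  move=> nW d0; have FW : F (G W) by exists W.
  have nn : nbhs (e, s) [set v : 'rV[R]_4 * R | `|e - v.1| < d /\ `|s - v.2| < d].
    exists ([set v | `|e - v| < d], [set v | `|s - v| < d]) => /=.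
      by split; apply/nbhs_eps; exists d.
    by move=> [v1 v2] [].
  have [[e' s'] [[/= h1 h2 [z Wz oz]] [/= h3 h4]]] := clu _ _ FW nn.
  by exists e', s', z.
have fy : f y = geo H p e s.
  apply/eqP; rewrite -subr_eq0 -normr_eq0; apply/eqP/le_anti.
  rewrite normr_ge0 andbT; apply/ler_addgt0Pl => d d0; rewrite addr0.
  have d2 : 0 < d / 2 by rewrite divr_gt0.
  have [c1 _] := @cvg_flow R H ('rV[R]_4 * R)%type (filter_prod (nbhs e) (nbhs s)) _
    (fun=> p) fst snd p e s (cvg_cst _) cvg_fst cvg_snd.
  have nn : nbhs (geo H p e s) (fun v => `|v - geo H p e s| < d / 2).
    by apply/nbhs_eps; exists (d / 2) => // v; rewrite distrC.
  have [[P Q] /= [nP nQ] PQ] := c1 _ nn.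
  have [d1 d10 HP] := (nbhs_eps _ _).1 nP; have [d3 d30 HQ] := (nbhs_eps _ _).1 nQ.
  have dm : 0 < Num.min d1 d3 by rewrite lt_min d10.
  have [e' [s' [z [U' hs' [h1 h2] hz oz]]]] := near_es _ _ (fnbhs y d2) dm.
  move: h1 h2; rewrite !lt_min => /andP[h1 _] /andP[_ h2].
  have := PQ (e', s') (conj (HP _ h1) (HQ _ h2)); move: hz; rewrite /= (out_f oz) => h3 h4.
  rewrite -(subrK (geo H p e' s') (f y)) -addrA; apply: (le_trans (ler_normD _ _)).
  move: h3; rewrite distrC => h3; move: h3 h4; move: `|_| `|_| => *; lra.
have [sl'|sl'] := eqVneq s l.
  by apply: Or33; rewrite fy sl' geo_pole.
have [s0'|s0'] := eqVneq s 0.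
  apply: Or32; apply: hs => W W1 nW nW1.
  have Kx0 : K x0 := nbhs_singleton nK.
  have [d1 d10 Hd1] := compact_inverse_continuous fc Kc Ki Kx0 nW1.
  have dm : 0 < Num.min r d1 by rewrite lt_min r0.
  have [e' [s' [z [U' /andP[s'0 s'l] [_ h2] Wz oz]]]] := near_es _ _ nW dm.
  move: h2; rewrite s0' sub0r normrN gtr0_norm// lt_min => /andP[h1 h2].
  have [|w Kw ow] := out_small Kr rays (e := e') (s := s') U'; first by rewrite s'0 ltW.
  have zw := out_unique hM hf Kc Ki Kr rays U' oz ow.
  exists z; split => //; apply: Hd1; first by rewrite zw.
  rewrite (out_f oz); have := geo_lip H s' 0 U'; rewrite geo0 subr0 gtr0_norm// => h.
  exact: le_lt_trans h2.
have hsl : 0 < s < l by rewrite !lt_neqAle eq_sym s0' s0 sl' sl.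
have [y1 oy1] := out_total U hsl; apply: Or31.
have s00 : 0 < s by case/andP: hsl.
suff -> : y = y1 by exists e, s.
apply: hs => W W1 nW nW1.
have [d d0 Hd] := out_cont hM hf hN hH Kc Ki Kr r0 rays U s00 oy1 nW1.
have [e' [s' [z [U' hs' [h1 h2] Wz oz]]]] := near_es _ _ nW d0.
have [z' Wz' oz'] := Hd e' s' U' h1 h2.
by exists z; split => //; rewrite (out_unique hM hf Kc Ki Kr rays U' oz oz').
Qed.

Lemma pole_height : dot pole (cos (H * l / 2) *: p - sin (H * l / 2) *: Vfield p) = height H l.
Proof.
rewrite /pole dotDr dotNr !dotZr !dotDl !dotZl dotVV dotV0 dotV0' pp /height; ring.
Qed.

Lemma geo_height e s : dir e ->
  dot (geo H p e s) (cos (H * l / 2) *: p - sin (H * l / 2) *: Vfield p) = height H s.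
Proof. by move=> U; have [g1 g2 _ _] := geo_dots H s U; rewrite dotDr dotNr !dotZr g1 g2. Qed.

(** Over the pole, take a punctured disc on which f does not take the value of the pole: in it
    the swept region is non-empty, open and closed. *)
Lemma closure_swept_nbhs y : closure T y -> nbhs y (closure T).
Proof.
move=> cy; have TC : T `<=` closure T := @subset_closure _ _.
have [Ty|nT] := pselect (T y); first exact: filterS TC (swept_nbhs Ty).
have [yx|yx] := pselect (y = x0).
  rewrite yx in cy *; apply: filterS swept_near_sing => z [->|/TC] //.
have fy : f y = pole by case: (closure_swept cy).
have [K' [eta [tK _]]] := trap_exists hM hf (filterT : nbhs y setT).
have [_ inj Ky eta0 nK'] := tK.
have nKy : nbhs y K' by apply: nK' => //; rewrite subrr normr0.
have nx : nbhs y (~` [set x0]).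
  apply: open_nbhs_nbhs; split => //; apply: closed_openC.
  exact: (accessible_closed_set1 (hausdorff_accessible hs)).
have [D [DW nD cD]] := punctured_nbhd hM hf (filterI nKy nx).
have [z [Tz Dz]] := cy D nD.
have zy : z <> y by move=> zy; apply: nT; rewrite -zy.
have DT : D `\ y `<=` T.
  have E : (D `\ y) `&` T = D `\ y.
    apply: cD.
    - by exists z; split.
    - by exists T => //; exact: swept_open.
    - exists (closure T); first exact: closed_closure.
      apply/seteqP; split=> w [[Dw wy] Tw]; split => //; first exact: TC.
      have [Kw wx] := DW w Dw; case: (closure_swept Tw) => // fw.
      by exfalso; apply: wy; apply: inj => //; rewrite fw.
  by move=> w Dw; have [_ Tw] : ((D `\ y) `&` T) w by rewrite E.
  apply: filterS nD => w Dw; have [->//|wy] := pselect (w = y).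
by apply: TC; apply: DT.
Qed.

Lemma end_exists e : dir e -> exists x, ends e l x /\ f x = pole.
Proof.
move=> U; have l0 := period_gt0 H; have hex s : 0 < s < l -> exists y, out e s y := out_total U.
have [x hx] := ray_limit U l0 hex; exists x; split => //.
by rewrite (ends_f U l0 hex hx) geo_pole.
Qed.

(** Close to the period the geodesics are close to the pole, so a flow line which enters a trap
    around y does not leave it, and ends at a point of the trap with the image of y. *)
Lemma ends_locally y : f y = pole -> exists2 W, nbhs y W & exists2 a, a < l &
  forall e s z, dir e -> 0 < s -> a < s < l -> out e s z -> W z -> ends e l y.
Proof.
move=> fy; have [K' [eta [tK _]]] := trap_exists hM hf (filterT : nbhs y setT).
have [K'c inj Ky eta0 nK'] := tK.
have nKy : nbhs y K' by apply: nK' => //; rewrite subrr normr0.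
exists K' => //; exists (l - eta); first by rewrite gtrBl.
move=> e s z U s0 /andP[as_ sl] oz Kz.
have inK u w : s <= u < l -> out e u w -> K' w.
  move=> /andP[su ul] ow; apply: (path_in_trap tK U s0 su oz ow Kz) => v /andP[v1 v2].
  rewrite fy -(geo_pole e); apply: (le_lt_trans (geo_lip H _ _ U)).
  by rewrite ler0_norm; lra.
have [x [ex fx]] := end_exists U.
have Kx : K' x.
  apply: (compact_closed hs K'c) => W nW; have [a' [a'0 a'l Ha']] := ex W nW.
  pose u := Num.max s ((a' + l) / 2).
  have u1 : s <= u by rewrite le_max lexx.
  have u2 : (a' + l) / 2 <= u by rewrite le_max lexx orbT.
  have u3 : u < l by rewrite gt_max sl /=; lra.
  have [|w ow] := out_total (s := u) U; first by rewrite u3 andbT; lra.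
  exists w; split; first by apply: inK ow; rewrite u1.
  by apply: (Ha' u w) ow; rewrite u3 andbT; lra.
by have <- : x = y by apply: inj => //; rewrite fx.
Qed.

Lemma ends_unique e x y : dir e -> ends e l x -> ends e l y -> x = y.
Proof.
move=> U hx hy; apply: hs => W W' nW nW'.
have [a [a0 al Ha]] := hx W nW; have [b [b0 bl Hb]] := hy W' nW'.
pose u := Num.max ((a + l) / 2) ((b + l) / 2).
have u1 : (a + l) / 2 <= u by rewrite le_max lexx.
have u2 : (b + l) / 2 <= u by rewrite le_max lexx orbT.
have u3 : u < l by rewrite gt_max; apply/andP; split; lra.
have [|w ow] := out_total (s := u) U; first by rewrite u3 andbT; lra.
exists w; split; first by apply: (Ha u w) ow; rewrite u3 andbT; lra.
by apply: (Hb u w) ow; rewrite u3 andbT; lra.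
Qed.

Lemma ends_open e x : dir e -> ends e l x -> exists2 d : R, 0 < d &
  forall e', dir e' -> `|e - e'| < d -> ends e' l x.
Proof.
move=> U ex; have [x' [ex' fx']] := end_exists U.
have xE := ends_unique U ex ex'; rewrite -{}xE in fx'.
have [W nW [a al Ha]] := ends_locally fx'.
have [b [b0 bl Hb]] := ex _ (nbhs_interior nW).
pose u := Num.max ((a + l) / 2) ((b + l) / 2).
have u1 : (a + l) / 2 <= u by rewrite le_max lexx.
have u2 : (b + l) / 2 <= u by rewrite le_max lexx orbT.
have u3 : u < l by rewrite gt_max; apply/andP; split; lra.
have u0 : 0 < u by lra.
have [|w ow] := out_total (s := u) U; first by rewrite u3 u0.
have Ww : nbhs w W by apply: (Hb u w) ow; rewrite u3 andbT; lra.
have [d d0 Hd] := out_cont hM hf hN hH Kc Ki Kr r0 rays U u0 ow Ww.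
exists d => // e' U' ee; have [|z Wz oz] := Hd e' u U' ee; first by rewrite subrr normr0.
by apply: (Ha e' u z U' u0 _ oz Wz); rewrite u3 andbT; lra.
Qed.

(** The circle of directions is connected, so all the flow lines end at one point. *)
Lemma common_end : exists x, f x = pole /\ forall e, dir e -> ends e l x.
Proof.
have [x [ex fx]] := end_exists ((hdir_unitary pp) 0); exists x; split => // e /(hdir_surj pp)[th /andP[th0 _] ->].
apply: (@real_induction R (fun t => ends (edir t) l x) th th0 ex).
move=> t _; have [x' [ex' _]] := end_exists ((hdir_unitary pp) t).
have [d d0 Hd] := ends_open ((hdir_unitary pp) t) ex'.
have [d1 d10 Hd1] := (continuous_eps _ _).1 (@hdir_continuous _ p t) d d0.
exists d1 => // a b _ _ ta tb _ ea.
have h1 := Hd _ ((hdir_unitary pp) a) (Hd1 a ta); have h2 := Hd _ ((hdir_unitary pp) b) (Hd1 b tb).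
by rewrite (ends_unique ((hdir_unitary pp) a) ea h1).
Qed.

Hypothesis connM : connected [set: M].

Lemma closure_swept_all : closure T = setT.
Proof.
apply: connM.
- have U := (hdir_unitary pp) 0; have hr : 0 < r < l by rewrite r0.
  by have [y oy] := out_total U hr; exists y; apply: subset_closure; exists (edir 0), r.
- exists (closure T); last by rewrite setTI.
  by rewrite openE => z; exact: closure_swept_nbhs.
- by exists (closure T); [exact: closed_closure|rewrite setTI].
Qed.

(** Flow lines pass arbitrarily close to y, at times close to l because of their heights. *)
Lemma over_pole y x : f y = pole -> f x = pole -> (forall e, dir e -> ends e l x) -> y = x.
Proof.
move=> fy fx hx; have [W nW [a al Ha]] := ends_locally fy.
have cy : closure T y.
  by rewrite closure_swept_all.
pose v := cos (H * l / 2) *: p - sin (H * l / 2) *: Vfield p.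
pose b := Num.max 0 a.
have b0 : 0 <= b by rewrite le_max lexx.
have bl : b < l by rewrite gt_max period_gt0.
have gap : 0 < height H b - height H l by rewrite subr_gt0; apply: height_decr.
have B0 : 0 < 4 * `|v| + 1 by rewrite ltr_wpDl// mulr_ge0.
have [z [[e [s [U /andP[s0 sl] oz]]] [Wz hz]]] := cy _ (filterI nW (fnbhs y (divr_gt0 gap B0))).
have sb : b < s.
  rewrite ltNge; apply/negP => sb.
  have h1 : height H b <= height H s.
    move: sb; rewrite le_eqVlt => /orP[/eqP->//|sb]; apply: ltW; apply: height_decr => //; exact: ltW.
  have h2 : height H s - height H l <= (4 * `|v| + 1) * `|f z - f y|.
    have -> : height H s - height H l = dot (f z - f y) v.
      by rewrite dotDl dotNl fy pole_height (out_f oz) geo_height.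
    apply: (le_trans (ler_norm _)); apply: (le_trans (dot_le_norm _ _)).
    have := normr_ge0 (f z - f y); move: `|f z - f y| `|v| => x1 x2; lra.
  move: hz; rewrite /= ltr_pdivlMr// mulrC; move: (_ * _) h2 => q; lra.
have ab : a < s by apply: le_lt_trans sb; rewrite le_max lexx orbT.
by apply: (ends_unique U _ (hx e U)); apply: (Ha e s z) => //; rewrite ab.
Qed.

(** The time is determined by the height, the direction by the time and the image. *)
Lemma sweep_bijective :
  set_bij [set: M] [set q | exists th s, 0 <= s <= l /\ q = geo H p (edir th) s] f.
Proof.
have [x [fx hx]] := common_end; have l0 := period_gt0 H.
have hgt y : exists s, [/\ 0 <= s <= l, dot (f y) (cos (H * l / 2) *: p - sin (H * l / 2) *: Vfield p) = height H s &
   [\/ 0 < s < l /\ exists2 e, dir e & out e s y, s = 0 /\ y = x0 | s = l /\ y = x]].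
  have cy : closure T y by rewrite closure_swept_all.
  case: (closure_swept cy) => [[e [s [U /andP[s0 sl] oy]]]|->|fy].
  - exists s; split; [by rewrite !ltW|by rewrite (out_f oy) geo_height|apply: Or31].
    by rewrite s0 sl; split => //; exists e.
  - exists 0; split; [by rewrite lexx ltW| |exact: Or32].
    by have := geo_height 0 ((hdir_unitary pp) 0); rewrite geo0.
  - exists l; split; [by rewrite lexx ltW|by rewrite fy pole_height|apply: Or33].
    by split => //; exact: over_pole.
split.
- move=> y _; have [s [hs' _ h]] := hgt y; case: h => [[_ [e U oy]]|[s0 yx]|[sl yx]].
  + have [th _ eE] := hdir_surj pp U; exists th, s; split => //.
    by rewrite -eE (out_f oy).
  + by exists 0, s; split; [exact: hs'|rewrite s0 yx geo0].
  + by exists 0, s; split; [exact: hs'|rewrite sl geo_pole yx].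
- move=> y z _ _ E; have [s [hs1 e1 h1]] := hgt y; have [t [ht1 e2 h2]] := hgt z.
  have st : s = t by apply: (height_inj (lam := H)) => //; rewrite -e1 -e2 E.
  rewrite -{t}st in h2 ht1 e2; case: h1 => [[hs1' [e U oy]]|[s0 yx]|[sl yx]].
  + case: h2 => [[_ [e' U' oz]]|[s0 _]|[sl _]].
    * suff ee : e = e' by rewrite -ee in oz; exact: (out_unique hM hf Kc Ki Kr rays U oy oz).
      have E' : geo H p e s = geo H p e' s by rewrite -(out_f oy) -(out_f oz).
      have d0 : fmu H s *: (e - e') + fnu H s *: Vfield (e - e') = 0.
        move/eqP: E'; rewrite -subr_eq0 => /eqP E'; rewrite -E' /geo VfieldD VfieldN.
        by apply/rowP => i; rewrite !mxE; ring.
      have : fS H s ^+ 2 * dot (e - e') (e - e') = 0.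
        have := congr1 (fun v => dot v v) d0; rewrite dot0l dot_lincomb dotVV dotV0 dotV0' => h.
        rewrite -h /fmu /fnu; rewrite -[LHS]mul1r -(cosl_sinl H s); ring.
      move/eqP; rewrite mulf_eq0 expf_eq0/= (gt_eqF (fS_gt0 hs1')) /= => /eqP/dot_eq0/eqP.
      by rewrite subr_eq0 => /eqP.
    * by move: hs1'; rewrite s0 ltxx.
    * by move: hs1'; rewrite sl ltxx andbF.
  + case: h2 => [[hs2 _]|[_ ->]|[sl _]]; [by move: hs2; rewrite s0 ltxx|by []|].
    by move: l0; rewrite -sl s0 ltxx.
  + case: h2 => [[hs2 _]|[s0 _]|[_ ->]]; [by move: hs2; rewrite sl ltxx andbF| |by []].
    by move: l0; rewrite -sl s0 ltxx.
- move=> q [th [s [/andP[s0 sl] ->]]]; have U := (hdir_unitary pp) th.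
  have [s0'|s0'] := eqVneq s 0; first by exists x0 => //; rewrite s0' geo0.
  have [sl'|sl'] := eqVneq s l; first by exists x => //; rewrite sl' geo_pole.
  have [|y oy] := out_total (s := s) U; first by rewrite !lt_neqAle eq_sym s0' s0 sl' sl.
  by exists y => //; rewrite (out_f oy).
Qed.
End Sweep.

(** * Congruence with the sphere *)

Section RightTranslation.
Variables (R : realType) (c : 'rV[R]_4).
Implicit Types (v w : 'rV[R]_4).
Local Notation phi := (fun v => qmul v c).

Lemma qmulDl v w : qmul (v + w) c = qmul v c + qmul w c.
Proof. by rewrite !qmulE; apply: rv4P; rewrite !crdE; ring. Qed.

Lemma qmulZl (a : R) v : qmul (a *: v) c = a *: qmul v c.
Proof. by rewrite !qmulE; apply: rv4P; rewrite !crdE; ring. Qed.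

Lemma qmul_V v : qmul (Vfield v) c = Vfield (qmul v c).
Proof. by rewrite !VfieldE !qmulE; apply: rv4P; rewrite !crdE; ring. Qed.

Lemma qmul_E1 v : qmul (E1 v) c = E1 (qmul v c).
Proof. by rewrite !E1E !qmulE; apply: rv4P; rewrite !crdE; ring. Qed.

Lemma qmul_E2 v : qmul (E2 v) c = E2 (qmul v c).
Proof. by rewrite !E2E !qmulE; apply: rv4P; rewrite !crdE; ring. Qed.

(** The quaternion norm is multiplicative. *)
Lemma dot_qmul v w : dot (qmul v c) (qmul w c) = dot c c * dot v w.
Proof. by rewrite !qmulE !dotE !crdE; ring. Qed.

Lemma qmul_geo lam p e s : qmul (geo lam p e s) c = geo lam (qmul p c) (qmul e c) s.
Proof. by rewrite /geo !qmulDl !qmulZl !qmul_V. Qed.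

Lemma qmul_direction p th : qmul (hdir p th) c = hdir (qmul p c) th.
Proof. by rewrite /hdir qmulDl !qmulZl qmul_E1 qmul_E2. Qed.

(** The product is x c = x_0 c + x_1 i c + x_2 j c + x_3 k c. *)
Lemma is_derive_qmul (x v : 'rV[R]_4) : is_derive x v phi (qmul v c).
Proof.
have D := is_derive_id x v.
have d k : is_derive x v (fun y : 'rV[R]_4 => crd y k) (crd v k) := is_derive_crd k D.
have := is_deriveD (is_deriveD (is_deriveD (is_derive_scalel c (d 0%N)) (is_derive_scalel (Vfield c) (d 1%N)))
  (is_derive_scalel (E1 c) (d 2%N))) (is_derive_scalel (E2 c) (d 3%N)).
have E w : crd w 0 *: c + crd w 1 *: Vfield c + crd w 2 *: E1 c + crd w 3 *: E2 c = qmul w c.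
  by rewrite VfieldE E1E E2E qmulE; apply: rv4P; rewrite !crdE; ring.
by rewrite E (_ : _ + _ = phi)//; apply/funext => w; exact: E.
Qed.

Lemma differentiable_qmul (x : 'rV[R]_4) : differentiable phi x.
Proof.
have E : phi = (fun w => crd w 0 *: c + crd w 1 *: Vfield c + crd w 2 *: E1 c + crd w 3 *: E2 c).
  apply/funext => w; rewrite VfieldE E1E E2E qmulE; apply: rv4P; rewrite !crdE; ring.
have d k (a : 'rV[R]_4) : differentiable (fun w : 'rV[R]_4 => crd w k *: a) x.
  apply: differentiable_scale; last exact: differentiable_cst.
  exact: (differentiable_coord x ord0 (inord k)).
by rewrite E; exact: (differentiableD (differentiableD (differentiableD (d _ _) (d _ _)) (d _ _)) (d _ _)).
Qed.

Lemma diff_qmul (x v : 'rV[R]_4) : 'd phi x v = qmul v c.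
Proof.
have h := deriveE v (differentiable_qmul x).
exact (etrans (esym h) (@derive_val _ _ _ _ _ _ _ (is_derive_qmul x v))).
Qed.

Lemma Ck_cst (V W : normedModType R) k (U : set V) (a : W) : Ck k U (fun=> a).
Proof.
elim: k a => [|k IH] a /=; first by move=> x _; exact: cvg_cst.
split=> [x _|v]; first exact: differentiable_cst.
have -> : (fun x : V => 'D_v (fun=> a) x) = (fun=> 0) by apply/funext => x; exact: derive_cst.
exact: IH.
Qed.

Lemma Ck_qmul k : Ck k [set: 'rV[R]_4] phi.
Proof.
case: k => [|k] /=; first by move=> x _; exact: differentiable_continuous (differentiable_qmul x).
split=> [x _|v]; first exact: differentiable_qmul.
have -> : (fun x => 'D_v phi x) = (fun=> qmul v c).
  by apply/funext => x; exact: (@derive_val _ _ _ _ _ _ _ (is_derive_qmul x v)).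
exact: Ck_cst.
Qed.

Hypothesis cc : dot c c = 1.

Lemma qmul_isometry : S3_isometry phi.
Proof.
(* The conjugate, inverse of c. *)
pose c' := quat (crd c 0) (- crd c 1) (- crd c 2) (- crd c 3).
have cc' : dot c' c' = 1 by rewrite -cc !dotE !crdE; ring.
have K1 v : qmul (qmul v c') c = v.
  rewrite -[RHS]scale1r -cc dotE !qmulE; apply: rv4P; rewrite !crdE; ring.
have K2 v : qmul (qmul v c) c' = v.
  rewrite -[RHS]scale1r -cc dotE !qmulE; apply: rv4P; rewrite !crdE; ring.
split.
- by exists setT; split => //; [exact: openT|move=> k; exact: Ck_qmul].
- split; first by move=> v /= vv; rewrite /S3/= dot_qmul cc mul1r.
  + by move=> v w _ _ /= E; rewrite -(K2 v) E K2.
  + move=> w ww; exists (qmul w c') => //=.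
    by have := dot_qmul (qmul w c') (qmul w c'); rewrite K1 cc mul1r; move: ww; rewrite /S3/= => -> <-.
- by move=> p X Y _ _ _; rewrite !diff_qmul dot_qmul cc mul1r.
Qed.

Lemma qmul_preserves_horizontal : preserves_horizontal phi.
Proof.
move=> p _; apply/seteqP; split=> [_ [_ [a [b ->]] <-]|_ [a [b ->]]].
  by exists a, b; rewrite diff_qmul qmulDl !qmulZl qmul_E1 qmul_E2.
exists (a *: E1 p + b *: E2 p); first by exists a, b.
by rewrite diff_qmul qmulDl !qmulZl qmul_E1 qmul_E2.
Qed.
End RightTranslation.

Section Geodesics.
Variables (R : realType) (lam : R).

(** The derivative of V is i X, whose normal component - <X, i p> vanishes for a horizontal X. *)
Lemma J_horizontal (p X : 'rV[R]_4) : dot X (Vfield p) = 0 -> J p X = Vfield X.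
Proof.
move=> XV; rewrite /J /covD /tproj.
have E : 'd (@Vfield R) p X = Vfield X.
  have dV : differentiable (@Vfield R) p by apply: (differentiable_V (F := id)).
  exact (etrans (esym (deriveE X dV)) (@derive_val _ _ _ _ _ _ _ (is_derive_V (is_derive_id p X)))).
by rewrite E dotVl XV oppr0 scale0r subr0.
Qed.

Lemma derive_curve (W : normedModType R) (g dg : R -> W) : (forall t : R, is_derive t 1 g (dg t)) ->
  forall v : R, (fun t => 'D_v g t) = (fun t => v *: dg t).
Proof.
move=> D v; apply/funext => t; have Dt := D t.
have d : differentiable g t by apply/derivable1_diffP; case: Dt.
have e1 : 'D_v g t = 'd g t v := deriveE _ d.
have e2 : 'D_1 g t = 'd g t 1 := deriveE _ d.
have e3 : v = v *: (1 : R) by rewrite /GRing.scale/= mulr1.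
have e4 : 'd g t v = v *: 'd g t (1 : R) by rewrite {1}e3; exact: linearZ.
exact (etrans e1 (etrans e4 (congr1 (fun z => v *: z) (etrans (esym e2) (@derive_val _ _ _ _ _ _ _ Dt))))).
Qed.

Lemma geo_geodesic p e : unitary_pair (p, e) -> geodesic lam (geo lam p e).
Proof.
move=> U; have Dg := is_derive_geo lam p e; have Dd := is_derive_dgeo lam p e.
pose d2 s := - geo lam p e s - (2 * lam) *: Vfield (dgeo lam p e s).
have D2 (s : R) : is_derive s 1 d2 (- dgeo lam p e s - (2 * lam) *: Vfield (d2 s)).
  exact: (is_deriveB (is_deriveN (Dg s)) (is_deriveZ (2 * lam) (is_derive_V (Dd s)))).
have dif (g : R -> 'rV[R]_4) (t : R) d : is_derive t 1 g d -> differentiable g t.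
  by move=> D; apply/derivable1_diffP; case: D.
have E1' : derive1 (geo lam p e) = dgeo lam p e.
  by apply/funext => s; rewrite derive1E; exact: (@derive_val _ _ _ _ _ _ _ (Dg s)).
have E2' : derive1 (dgeo lam p e) = d2.
  by apply/funext => s; rewrite derive1E; exact: (@derive_val _ _ _ _ _ _ _ (Dd s)).
split.
  split=> [s _|v]; first exact: dif (Dg s).
  rewrite (derive_curve Dg v).
  have Dv (s : R) : is_derive s 1 (fun t => v *: dgeo lam p e t) (v *: d2 s) := is_deriveZ v (Dd s).
  split=> [s _|w]; first exact: dif (Dv s).
  rewrite (derive_curve Dv w) => s _.
  have h : {for s, continuous d2} by apply: differentiable_continuous; exact: dif (D2 s).
  exact (cvgZ (cvg_cst w) (cvgZ (cvg_cst v) h)).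
move=> s; have [q1 e1 qe eV] := unitary_Phi lam s U; rewrite /= in q1 e1 qe eV.
rewrite E1' E2'; split => //.
- by apply/horizontalP.
- exact: enorm1.
- rewrite J_horizontal// /tproj /d2.
  move: q1 qe eV; move: (geo lam p e s) (dgeo lam p e s) => q v q1 qe eV.
  have -> : dot (- q - (2 * lam) *: Vfield v) q = - 1.
    by rewrite dotDl !dotNl dotZl q1 dotVl eV; ring.
  by apply: rv4P; rewrite !crdE; ring.
Qed.

(** The normal component of the acceleration is - x, by derivation of <x, x'> = 0; the equation of
    the geodesics then becomes the linear one, which has a unique solution. *)
Lemma geodesic_geo gam : geodesic lam gam ->
  unitary_pair (gam 0, derive1 gam 0) /\ forall s, gam s = geo lam (gam 0) (derive1 gam 0) s.
Proof.
move=> [[d1 /(_ 1)[d2 _]] hg].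
have D1 (s : R) : is_derive s 1 gam (derive1 gam s).
  rewrite derive1E; apply: DeriveDef; last by [].
  by apply/derivable1_diffP; exact: d1.
have D1E : (fun x => 'D_1 gam x) = derive1 gam by apply/funext => x; rewrite derive1E.
have D2 (s : R) : is_derive s 1 (derive1 gam) (derive1 (derive1 gam) s).
  rewrite derive1E; apply: DeriveDef; last by [].
  by apply/derivable1_diffP; rewrite -D1E; exact: d2.
have U s : unitary_pair (gam s, derive1 gam s).
  have [h1 h2 h3 _] := hg s; have [h4 h5] := (horizontalP _ h1).1 h2.
  by split; [exact: h1|rewrite /= -enorm_sqr h3 expr1n|exact: h4|exact: h5].
have acc s : derive1 (derive1 gam) s = - gam s - (2 * lam) *: Vfield (derive1 gam s).
  have [_ _ _ eV] := U s; have [_ _ _] := hg s; rewrite (J_horizontal eV).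
  have gg : dot (derive1 (derive1 gam) s) (gam s) = - 1.
    have Dz := is_derive_dot (D1 s) (D1 s).
    have D3 := is_derive_dot (D2 s) (D1 s).
    have z1 : (fun t => dot (derive1 gam t) (gam t)) = (fun=> 0).
      by apply/funext => t; have [_ _ ? _] := U t.
    rewrite z1 in D3; have := @derive_val _ _ _ _ _ _ _ D3.
    rewrite derive_cst; have [_ e1 _ _] := U s; rewrite /= in e1; rewrite e1 => /esym/eqP.
    by rewrite addr_eq0 => /eqP.
  rewrite /tproj gg scaleN1r opprK => /eqP; rewrite addr_eq0 => /eqP h.
  by apply/eqP; rewrite -subr_eq0 opprD !opprK addrA h addNr.
split; first exact: U.
have D2' (s : R) : is_derive s 1 (derive1 gam) (- gam s - (2 * lam) *: Vfield (derive1 gam s)).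
  by rewrite -acc.
by move=> s; have [] := flow_unique D1 D2' s.
Qed.

Lemma Slambda_geo : Slambda lam = [set q | exists th s, 0 <= s <= period lam /\
  q = geo lam (quat 1 0 0 0) (hdir (quat 1 0 0 0) th) s].
Proof.
have pp : dot (quat 1 0 0 0 : 'rV[R]_4) (quat 1 0 0 0) = 1 by rewrite dotE !crdE; ring.
apply/seteqP; split=> q.
- move=> [th [s [gam [_ hs hg [g0 g0'] ->]]]]; exists th, s; split => //.
  by have [_ ->] := geodesic_geo hg; rewrite g0 g0'.
- move=> [th [s [hs ->]]]; have U := hdir_unitary pp th.
  have [th' hth E] := hdir_surj pp U; exists th', s; rewrite E.
  exists (geo lam (quat 1 0 0 0) (hdir (quat 1 0 0 0) th')).
  have U' := hdir_unitary pp th'.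
  split; [exact: hth|exact: hs|exact: geo_geodesic| |by []].
  split; first exact: geo0.
  by rewrite derive1E (@derive_val _ _ _ _ _ _ _ (is_derive_geo lam _ _ (0 : R))) dgeo0.
Qed.
End Geodesics.

(** The horizontal unit normal changes sign with the normal, and so does its divergence. *)
Lemma opposite_normal (R : realType) (M : topologicalType) (A : set (chart R M))
    (f N : M -> 'rV[R]_4) (H : R) : C2_surface A -> C2_immersion_S3 A f -> unit_normal A f N ->
  (forall x, Nh f N x != 0 -> has_mean_curvature A f N x H) ->
  unit_normal A f (fun x => - N x) /\
  (forall x, Nh f (fun x => - N x) x != 0 -> has_mean_curvature A f (fun x => - N x) x (- H)).
Proof.
move=> hM hf hN hH.
have NhE x : Nh f (fun x => - N x) x = - Nh f N x.
  by rewrite /Nh dotNl scaleNr opprB addrC opprK.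
split.
  case: hN => cN hx; split; first by move=> x; exact (cvgN (cN x)).
  move=> x; have [h1 h2 h3] := hx x; split.
  - by rewrite dotNl dotNr opprK.
  - by move: h2; rewrite /tangentS3/= dotNl => ->; rewrite oppr0.
  - by move=> w /h3; rewrite dotNl => ->; rewrite oppr0.
move=> x; rewrite NhE oppr_eq0 => rx c u a b Ac cu ux e DW ea eb eab.
have h := hH x rx c u a b Ac cu ux ea eb eab.
have nE : nuh f (fun x => - N x) = (fun x => - nuh f N x).
  by apply/funext => y; rewrite /nuh NhE enormN scalerN.
have dn : differentiable (nuh f N \o param c) u.
  by apply: (nuh_differentiable hM hf hN Ac cu); rewrite ux.
have e1 v : 'd (nuh f (fun x => - N x) \o param c) u v = - 'd (nuh f N \o param c) u v.
  exact (etrans (congr1 (fun G : M -> 'rV[R]_4 => 'd (G \o param c) u v) nE)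
    (congr1 (fun L : 'rV[R]_2 -> 'rV[R]_4 => L v) (diffN dn))).
have aux (q w w' : 'rV[R]_4) : w = - w' -> tproj q w = - tproj q w'.
  by move=> ->; rewrite /tproj dotNl scaleNr opprB opprK addrC.
have dE v := aux (f x) _ _ (e1 v).
have aux2 (y z y' z' v w : 'rV[R]_4) : y = - y' -> z = - z' ->
    - 2 * H = dot y' v + dot z' w -> - 2 * - H = dot y v + dot z w.
  by move=> -> -> h2; rewrite mulrN h2 !dotNl; ring.
exact (aux2 _ _ _ _ _ _ (dE a) (dE b) h).
Qed.

(** The flow lines from x0 sweep the surface, and the right translation by the conjugate of f x0
    carries their images to the geodesics from 1. *)
Lemma congruent_of_upward_normal (R : realType) (M : topologicalType) (A : set (chart R M))
    (f N : M -> 'rV[R]_4) (H : R) (x0 : M) :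
  C2_surface A -> C2_immersion_S3 A f -> unit_normal A f N -> connected [set: M] ->
  complete_surface A f -> (forall x, Nh f N x != 0 -> has_mean_curvature A f N x H) ->
  isolated_singular_point A f x0 -> N x0 = Vfield (f x0) -> congruent f (Slambda H).
Proof.
move=> hM hf hN hconn hcomplete hH [sx [U [oU Ux UE]]] Nx0.
have WR y : U y -> y <> x0 -> Nh f N y != 0.
  move=> Uy yx; apply/eqP => /(singularP hM hf hN) sy; apply: yx.
  by have : (U `&` singular_set A f) y by []; rewrite UE.
have [K [r [[Kc Ki nK] Kr r0 rays disc]]] := isolated_structure hM hf hN hH Nx0
  (open_nbhs_nbhs (conj oU Ux)) WR.
have l0 := period_gt0 H; pose r' := Num.min r (period H / 2).
have r'0 : 0 < r' by rewrite lt_min r0 divr_gt0.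
have r'r : r' <= r by rewrite ge_min lexx.
have r'l : r' < period H.
  have : r' <= period H / 2 by rewrite ge_min lexx orbT.
  by move: l0; move: (period H) (r') => *; lra.
have rays' e t : unitary_pair (f x0, e) -> 0 < t <= r' ->
    exists2 y, K y /\ y <> x0 & state f N y = Phi H t (f x0, e).
  by move=> V /andP[t0 tr]; apply: rays => //; rewrite t0 (le_trans tr).
have s0 : ~~ (Nh f N x0 != 0) by rewrite negbK (singular_Nh hf Nx0).
have [b1 b2 b3] := sweep_bijective hM hf hN hH hcomplete Kc Ki nK Kr r'0 r'l rays' disc s0 hconn.
pose p := f x0; have pp : dot p p = 1 := sphere hf x0.
pose c := quat (crd p 0) (- crd p 1) (- crd p 2) (- crd p 3).
have cc : dot c c = 1 by rewrite -pp !dotE !crdE; ring.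
have pc : qmul p c = quat 1 0 0 0.
  by rewrite -{1}pp dotE qmulE /c; apply: rv4P; rewrite !crdE; ring.
have key th s : qmul (geo H p (hdir p th) s) c =
    geo H (quat 1 0 0 0) (hdir (quat 1 0 0 0) th) s.
  by rewrite qmul_geo qmul_direction pc.
have [iso1 [j1 j2 j3] iso3] := qmul_isometry cc.
exists (fun v => qmul v c); split; [exact: qmul_isometry|exact: qmul_preserves_horizontal|].
rewrite Slambda_geo; split.
- move=> y /b1[th [s [hs fE]]]; exists th, s; split; first exact: hs.
  by have := key th s; rewrite /= fE.
- move=> y z _ _ /= E; apply: b2; rewrite ?inE//.
  by apply: j2 => //; rewrite inE; case: hf => h _; exact: h.
- move=> q [th [s [hs ->]]]; have [|y _ fy] := b3 (geo H p (hdir p th) s).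
    by exists th, s.
  by exists y => //=; rewrite fy key.
Qed.
Theorem theorem5p3 (R : realType) (M : topologicalType) (A : set (chart R M))
    (f N : M -> 'rV[R]_4)
    (hM : C2_surface A)
    (hf : C2_immersion_S3 A f)
    (hN : unit_normal A f N)
    (hconn : connected [set: M])
    (hcomplete : complete_surface A f)
    (hH : constant_mean_curvature A f N)
    (hsing : exists x : M, isolated_singular_point A f x) :
  exists lambda : R, congruent f (Slambda lambda).
Proof.
case: hH => H hH; case: hsing => x0 hx0.
have hH' x : Nh f N x != 0 -> has_mean_curvature A f N x H.
  by move=> rx; apply: hH => /(singularP hM hf hN) /eqP; rewrite (negbTE rx).
have /(singularP hM hf hN) Nx := hx0.1.
pose k := dot (N x0) (Vfield (f x0)).
have NV : N x0 = k *: Vfield (f x0) by move/eqP: Nx; rewrite /Nh subr_eq0 => /eqP.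
have kk : k ^+ 2 = 1.
  have := normal_unit hN x0; rewrite NV dotZl dotZr dotVV (sphere hf) mulr1.
  by rewrite expr2.
have /orP[/eqP k1|/eqP k1] : (k == 1) || (k == -1) by rewrite -sqrf_eq1 kk eqxx.
  exists H; apply: (congruent_of_upward_normal hM hf hN hconn hcomplete hH' hx0).
  by rewrite NV k1 scale1r.
have [hN' hH''] := opposite_normal hM hf hN hH'.
exists (- H); apply: (congruent_of_upward_normal hM hf hN' hconn hcomplete hH'' hx0).
by rewrite NV k1 scaleN1r opprK.
Qed.
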